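(* Let $\mathbb{P},\mathbb{P}_1,\mathbb{P}_2$ be finite quantum spaces, let $\mathbb{O},\mathbb{O}_1,\mathbb{O}_2$ be compact quantum spaces, and let $\rho\colon C(\mathbb{P}_2)\to C(\mathbb{P}_1)$ and $\pi\colon C(\mathbb{O}_1)\to C(\mathbb{O}_2)$ be unital $*$-homomorphisms. Then: (1) if $\pi$ is surjective then so is $\mathbb{M}_{\mathrm{id},\pi}\colon C(\mathbb{M}_{\mathbb{P},\mathbb{O}_1})\to C(\mathbb{M}_{\mathbb{P},\mathbb{O}_2})$; (2) if $\rho$ is injective then $\mathbb{M}_{\rho,\mathrm{id}}\colon C(\mathbb{M}_{\mathbb{P}_1,\mathbb{O}})\to C(\mathbb{M}_{\mathbb{P}_2,\mathbb{O}})$ is surjective; (3) if $\pi$ is injective then so is $\mathbb{M}_{\mathrm{id},\pi}\colon C(\mathbb{M}_{\mathbb{P},\mathbb{O}_1})\to C(\mathbb{M}_{\mathbb{P},\mathbb{O}_2})$; (4) if $\rho$ is surjective then $\mathbb{M}_{\rho,\mathrm{id}}\colon C(\mathbb{M}_{\mathbb{P}_1,\mathbb{O}})\to C(\mathbb{M}_{\mathbb{P}_2,\mathbb{O}})$ is injective.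
   Context: A quantum space $\mathbb{X}$ is an object of the category dual to the category of C*-algebras; the corresponding C*-algebra is denoted $C_0(\mathbb{X})$, or $C(\mathbb{X})$ when it is unital. $\mathbb{X}$ is compact if $C(\mathbb{X})$ is unital and finite if $C(\mathbb{X})$ is finite-dimensional. For C*-algebras $A,B$, $\mathrm{Mor}(A,B)$ is the set of non-degenerate $*$-homomorphisms from $A$ to the multiplier algebra $M(B)$ (unital $*$-homomorphisms $A\to B$ if both are unital). $\otimes$ is the minimal tensor product. For $\mathbb{P}$ finite and $\mathbb{O}$ compact, $(C(\mathbb{M}_{\mathbb{P},\mathbb{O}}),\boldsymbol{\Phi}_{\mathbb{P},\mathbb{O}})$ denotes the (existing, unique up to isomorphism) pair consisting of a unital C*-algebra and a unital $*$-homomorphism $\boldsymbol{\Phi}_{\mathbb{P},\mathbb{O}}\colon C(\mathbb{O})\to C(\mathbb{P})\otimes C(\mathbb{M}_{\mathbb{P},\mathbb{O}})$ with the universal property: for every quantum space $\mathbb{X}$ and every $\Psi\in\mathrm{Mor}(C(\mathbb{O}),C(\mathbb{P})\otimes C_0(\mathbb{X}))$ there is a unique $\Lambda\in\mathrm{Mor}(C(\mathbb{M}_{\mathbb{P},\mathbb{O}}),C_0(\mathbb{X}))$ with $\Psi=(\mathrm{id}\otimes\Lambda)\circ\boldsymbol{\Phi}_{\mathbb{P},\mathbb{O}}$. The C*-algebra $C(\mathbb{M}_{\mathbb{P},\mathbb{O}})$ is generated by $\{(\omega\otimes\mathrm{id})\boldsymbol{\Phi}_{\mathbb{P},\mathbb{O}}(a)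 : a\in C(\mathbb{O}),\ \omega\in C(\mathbb{P})^*\}$. For unital $*$-homomorphisms $\rho\colon C(\mathbb{P}_2)\to C(\mathbb{P}_1)$ and $\pi\colon C(\mathbb{O}_1)\to C(\mathbb{O}_2)$, the map $\mathbb{M}_{\rho,\pi}\colon C(\mathbb{M}_{\mathbb{P}_1,\mathbb{O}_1})\to C(\mathbb{M}_{\mathbb{P}_2,\mathbb{O}_2})$ is the unique unital $*$-homomorphism $\Lambda$ such that $(\mathrm{id}\otimes\Lambda)\circ\boldsymbol{\Phi}_{\mathbb{P}_1,\mathbb{O}_1}=(\rho\otimes\mathrm{id})\circ\boldsymbol{\Phi}_{\mathbb{P}_2,\mathbb{O}_2}\circ\pi$.
   Formalization: In (4) it is additionally assumed that C(P_1) or C(O) is nonzero: if both are the zero algebra and C(P_2) is not, then C(M_{P_1,O}) is the complex numbers and C(M_{P_2,O}) = 0, so the map is not injective. *)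

(* Defs.v *)
From HB Require Import structures.
From mathcomp Require Import all_boot all_order all_algebra.
From mathcomp Require Import complex.
From mathcomp Require Import all_classical all_reals all_analysis.

Set Implicit Arguments.
Unset Strict Implicit.
Unset Printing Implicit Defensive.

Import Order.TTheory GRing.Theory Num.Theory numFieldNormedType.Exports.
Local Open Scope classical_set_scope.
Local Open Scope complex_scope.
Local Open Scope ring_scope.

(* C*-algebras over the complex numbers R[i].  They need not be unital, and    *)
(* MathComp's rings are unital, so the product is part of the mixin.  The zero *)
(* algebra is allowed, and is unital.                                          *)
HB.mixin Record isCStarAlgebra (R : realType) A
    of CompleteNormedModule R[i] A := {
  cmul : A -> A -> A;
  cstar : A -> A;
  cmulA : associative cmul;
  cmul_linearl : forall y : A, linear (fun x => cmul x y);
  cmul_linearr : forall x : A, linear (cmul x);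
  cstar_antilinear : forall (k : R[i]) (x y : A),
    cstar (k *: x + y) = conjc k *: cstar x + cstar y;
  cstarK : involutive cstar;
  cstarM : forall x y : A, cstar (cmul x y) = cmul (cstar y) (cstar x);
  norm_cmul_le : forall x y : A, `|cmul x y| <= `|x| * `|y|;
  norm_cstar_mul : forall x : A, `|cmul (cstar x) x| = `|x| ^+ 2 }.

#[short(type="cstarAlgType")]
HB.structure Definition CStarAlgebra (R : realType) :=
  {A of CompleteNormedModule R[i] A & isCStarAlgebra R A}.

Notation "x *c y" := (cmul x y) (at level 40, left associativity) : ring_scope.

Section CStarDefs.
Variable R : realType.
Implicit Types A B : cstarAlgType R.

Definition is_one A (e : A) : Prop := forall x : A, e *c x = x /\ x *c e = x.

Definition compact_qspace A : Prop := exists e : A, is_one e.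

Definition finite_dimensional A : Prop :=
  exists (n : nat) (e : 'I_n -> A),
    forall x : A, exists c : 'I_n -> R[i], x = \sum_(i < n) c i *: e i.

Definition finite_qspace A : Prop := compact_qspace A /\ finite_dimensional A.

Definition star_hom A B (f : A -> B) : Prop :=
  [/\ linear f,
      forall x y : A, f (x *c y) = f x *c f y
    & forall x : A, f (cstar x) = cstar (f x)].

Definition unital_star_hom A B (f : A -> B) : Prop :=
  star_hom f /\ (forall e : A, is_one e -> is_one (f e)).

(* The multiplier algebra M(B), realized as the adjointable operators of the   *)
(* Hilbert module B over itself, whose inner product is (x, y) |-> x^* y.  The *)
(* adjoint is determined by the operator, and adjointable operators are        *)
(* automatically linear, bounded and right B-linear.  The product of M(B) is   *)
(* composition, its involution is the adjoint.                                 *)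
Record multiplier B := Multiplier {
  mult_fun :> B -> B;
  mult_adj : B -> B;
  mult_adjP : forall x y : B,
    cstar (mult_fun x) *c y = cstar x *c mult_adj y }.

Lemma left_mult_adjP B (b x y : B) :
  cstar (b *c x) *c y = cstar x *c (cstar b *c y).
Proof. by rewrite cstarM cmulA. Qed.

(* the canonical embedding of B into M(B), i.e. the identity morphism of B *)
Definition left_mult B (b : B) : multiplier B :=
  Multiplier (@left_mult_adjP B b).

(* f \in Mor(A, B): f is a *-homomorphism from A to M(B), and f(A)B spans a    *)
(* dense subspace of B.                                                        *)
Definition is_mor A B (f : A -> multiplier B) : Prop :=
  [/\ forall (k : R[i]) (x y : A) (b : B),
        f (k *: x + y) b = k *: f x b + f y b,
      forall (x y : A) (b : B), f (x *c y) b = f x (f y b),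
      forall (x : A) (b : B), f (cstar x) b = mult_adj (f x) b
    & closure [set z : B | exists (n : nat) (x : 'I_n -> A) (b : 'I_n -> B),
                 z = \sum_(i < n) f (x i) (b i)] = setT].

Definition lin_indep A n (a : 'I_n -> A) : Prop :=
  forall c : 'I_n -> R[i], \sum_(i < n) c i *: a i = 0 -> forall i, c i = 0.

(* t induces an injective *-homomorphism from the algebraic tensor product of  *)
(* A and B to T.  Every element of the former is a sum of a_i (x) b_i with     *)
(* (a_i) linearly independent, and then vanishes iff all the b_i do.           *)
Definition tensor_pairing A B (T : cstarAlgType R) (t : A -> B -> T) : Prop :=
  [/\ forall b : B, linear (fun a => t a b),
      forall a : A, linear (t a),
      forall (a a' : A) (b b' : B), t a b *c t a' b' = t (a *c a') (b *c b'),
      forall (a : A) (b : B), cstar (t a b) = t (cstar a) (cstar b)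
    & forall n (a : 'I_n -> A) (b : 'I_n -> B), lin_indep a ->
        \sum_(i < n) t (a i) (b i) = 0 -> forall i, b i = 0].

(* T, together with the map t : (a, b) |-> a (x) b, is the completion of the   *)
(* algebraic tensor product for its smallest C*-norm; the pairings into        *)
(* C*-algebras T' yield all the C*-norms.                                      *)
Definition min_tensor A B (T : cstarAlgType R) (t : A -> B -> T) : Prop :=
  [/\ tensor_pairing t,
      closure [set z : T | exists (n : nat) (a : 'I_n -> A) (b : 'I_n -> B),
                 z = \sum_(i < n) t (a i) (b i)] = setT
    & forall (T' : cstarAlgType R) (t' : A -> B -> T'), tensor_pairing t' ->
        forall n (a : 'I_n -> A) (b : 'I_n -> B),
          `|\sum_(i < n) t (a i) (b i)| <= `|\sum_(i < n) t' (a i) (b i)|].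

Record tensorProduct A B := TensorProduct {
  tensor_alg :> cstarAlgType R;
  tens : A -> B -> tensor_alg;
  tensP : min_tensor tens }.

(* h = f (x) g, for *-homomorphisms f and g *)
Definition is_tensor_hom A A' B B'
    (T : tensorProduct A B) (T' : tensorProduct A' B')
    (f : A -> A') (g : B -> B') (h : T -> T') : Prop :=
  star_hom h /\ (forall (a : A) (b : B), h (tens T a b) = tens T' (f a) (g b)).

(* h = f (x) g, for morphisms f and g in the sense of is_mor *)
Definition is_tensor_mor A A' B B'
    (T : tensorProduct A B) (T' : tensorProduct A' B')
    (f : A -> multiplier A') (g : B -> multiplier B')
    (h : T -> multiplier T') : Prop :=
  is_mor h /\
  (forall (a : A) (b : B) (a' : A') (b' : B'),
     h (tens T a b) (tens T' a' b') = tens T' (f a a') (g b b')).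

(* The universal property of (M, Phi), quantified over all the C*-algebras X   *)
(* and all the models TX of the tensor product of P and X.                     *)
Definition universal_family (P O M : cstarAlgType R) (T : tensorProduct P M)
    (Phi : O -> T) : Prop :=
  forall (X : cstarAlgType R) (TX : tensorProduct P X)
         (Psi : O -> multiplier TX), is_mor Psi ->
    exists! Lambda : M -> multiplier X,
      is_mor Lambda /\
      exists idLambda : T -> multiplier TX,
        is_tensor_mor (@left_mult P) Lambda idLambda /\
        Psi = idLambda \o Phi.

(* models of (C(M_{P,O}), Phi_{P,O}) *)
Record qmaps (P O : cstarAlgType R) := QMaps {
  qmaps_alg :> cstarAlgType R;
  qmaps_compact : compact_qspace qmaps_alg;
  qmaps_tensor : tensorProduct P qmaps_alg;
  qmaps_Phi : O -> qmaps_tensor;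
  qmaps_Phi_hom : unital_star_hom qmaps_Phi;
  qmaps_universal : universal_family qmaps_Phi }.

(* Lambda = M_{rho,pi} : a unital *-homomorphism such that                     *)
(* (id (x) Lambda) o Phi_{P1,O1} = (rho (x) id) o Phi_{P2,O2} o pi             *)
Definition is_qmaps_map (P1 P2 O1 O2 : cstarAlgType R)
    (M1 : qmaps P1 O1) (M2 : qmaps P2 O2)
    (rho : P2 -> P1) (pi : O1 -> O2) (Lambda : M1 -> M2) : Prop :=
  unital_star_hom Lambda /\
  exists (T : tensorProduct P1 M2)
         (idLambda : qmaps_tensor M1 -> T) (rhoid : qmaps_tensor M2 -> T),
    [/\ is_tensor_hom id Lambda idLambda,
        is_tensor_hom rho id rhoid
      & idLambda \o @qmaps_Phi _ _ M1 = rhoid \o @qmaps_Phi _ _ M2 \o pi].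

Definition surjective A B (f : A -> B) : Prop :=
  forall y : B, exists x : A, f x = y.

(* If C(P1) = 0 and C(O) = 0 then C(M_{P1,O}) is the algebra of complex        *)
(* numbers, whereas C(M_{P2,O}) = 0 as soon as C(P2) is not 0: the surjection  *)
(* C(P2) -> 0 then induces a noninjective map.                                 *)
Definition nonzero A : Prop := exists x : A, x <> 0.

End CStarDefs.

(* Main.v *)
Require Import Defs.
From HB Require Import structures.
From mathcomp Require Import all_boot all_order all_algebra.
From mathcomp Require Import complex ring lra.
From mathcomp Require Import all_classical all_reals all_analysis.

Set Implicit Arguments.
Unset Strict Implicit.
Unset Printing Implicit Defensive.

Import Order.TTheory GRing.Theory Num.Theory numFieldNormedType.Exports.
Local Open Scope classical_set_scope.
Local Open Scope complex_scope.
Local Open Scope ring_scope.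

(** For a finite-dimensional P the tensor product of P and X is algebraic, so
    that Phi(a) has coordinates b_k(a) in a basis e_k of P that is orthonormal
    for a trace.  The universal property, applied to unital algebras X, says
    that the b_k(a) generate C(M_{P,O}) and that every unital homomorphism
    C(O) -> P (x) X comes from one C(M_{P,O}) -> X.

    (1), (2): the range of a homomorphism is closed, and the one at hand
    contains the generators.

    (4): let s be the section of rho on the orthogonal complement of its
    kernel.  From sum_k s(e_k) (x) (1 (x) b_k(a)) + (1 - s(1)) (x) Phi(a) one
    gets a homomorphism C(M_{P2,O}) -> P1 (x) C(M_{P1,O}) whose composite with
    M_{rho,id} is m |-> 1 (x) m, which is injective if P1 <> 0.

    (3): let s be a positive functional on C(M_{P,O1}) and V a finite set of
    vectors of its GNS space.  As positive functionals extend from matrices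
    over C(O1) to matrices over C(O2), there is a representation kappa of C(O2)
    on a space K that has, on finitely many vectors orthogonal to a copy of V in
    K, the matrix coefficients of Phi on P (x) V.  An involutive unitary U of
    P (x) B(K) exchanges P (x) V with a copy of it made of these vectors, and
    intertwines Phi there with 1 (x) kappa, so that U (1 (x) kappa) U gives
    C(M_{P,O2}) -> B(K) such that the image of M_{id,pi}(m) maps the copy of
    1 in V to that of m.  Hence s(m^* m) <= |M_{id,pi}(m)|^2 s(1) for all words m
    in the generators, and M_{id,pi} is injective. *)

(** Spectral theory is avoided: positivity, absolute values and closed ranges rest on one
    scalar-dominated iteration for the square root and on the criterion |t - a| <= t. Hilbert spaces
    are avoided as well: operators act on spaces with possibly degenerate semi-inner products, and
    only the algebra they form is separated and completed. Vectors x enter that algebra as rank-one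
    operators |x><y|, so that statements about vectors become equations in P (x) X. The trace on P
    is the regular one, x |-> trace of left multiplication by x, because its orthonormal bases
    satisfy sum_k e_k^* e_k = 1. This makes J = sum_k e_k (x) D_k, from which U is built, a partial
    isometry with the right domain; that sum_k e_k (x) e_k^* is invariant under P makes J
    intertwine. The set V may be taken finite because a given word, evaluated letter by letter on
    the vector 1, meets finitely many vectors only. If P = 0 there are no vectors to work with, and
    C(M_{P,O}) consists of the multiples of its unit; this case is settled by the universal property
    alone. *)

Section ComplexScalars.
Variable R : realType.
Implicit Types (k : R[i]) (r : R).

Definition cabs k : R := complex.Re `|k|.

Lemma cabsE k : `|k| = (cabs k)%:C.
Proof. by rewrite /cabs RRe_real // normr_real. Qed.

Lemma cabs_real r : cabs r%:C = `|r|.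
Proof. by rewrite /cabs normc_def /= expr0n addr0 sqrtr_sqr. Qed.

Lemma cabs_sqr k : ((cabs k) ^+ 2)%:C = conjc k * k.
Proof.
rewrite rmorphXn /= -cabsE.
have -> : `|k| ^+ 2 = ((complex.Re k) ^+ 2 + (complex.Im k) ^+ 2)%:C.
  by rewrite add_Re2_Im2.
by case: k => a b; simpc; rewrite -!expr2 addrC [b * a]mulrC subrr.
Qed.

Lemma cabs_ge0 k : 0 <= cabs k.
Proof. by rewrite -ler0c -cabsE normr_ge0. Qed.

Lemma real_complexD (a b : R) : (a + b)%:C = a%:C + b%:C.
Proof. exact: rmorphD. Qed.

Lemma real_complexM (a b : R) : (a * b)%:C = a%:C * b%:C.
Proof. exact: rmorphM. Qed.

Lemma complex2 : (2 : R)%:C = 1 + 1.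
Proof. by rewrite -[2]/(1 + 1 : R) real_complexD. Qed.

Lemma half_complex : (2^-1 : R)%:C = 2^-1.
Proof. by rewrite fmorphV rmorph_nat. Qed.

Lemma ge0_complexE k : 0 <= k -> k = (complex.Re k)%:C.
Proof. by move=> /ger0_real/RRe_real. Qed.

Lemma conjcM k l : conjc (k * l) = conjc k * conjc l.
Proof. exact: rmorphM. Qed.

Lemma conjcD k l : conjc (k + l) = conjc k + conjc l.
Proof. exact: rmorphD. Qed.

Lemma conjcN k : conjc (- k) = - conjc k.
Proof. exact: rmorphN. Qed.

Lemma mulii : 'i * 'i = -1 :> R[i].
Proof. by rewrite -expr2 sqr_i. Qed.

Lemma conji : conjc 'i = - 'i :> R[i].
Proof. by simpc. Qed.

End ComplexScalars.

(** * Real-valued norms and limits of sequences *)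

Section RealNorm.
Variables (R : realType) (V : normedModType R[i]).
Implicit Types x y z : V.

(** The norm of a module over [R[i]] has values in [R[i]]. Its real part loses nothing and gives
    access to infima and to [lra]. *)
Definition nm x : R := complex.Re `|x|.

Lemma nmE x : `|x| = (nm x)%:C.
Proof. by rewrite /nm RRe_real // normr_real. Qed.

Lemma nm_ge0 x : 0 <= nm x.
Proof. by rewrite -ler0c -nmE normr_ge0. Qed.

Lemma nm0 : nm 0 = 0.
Proof. by rewrite /nm normr0. Qed.

Lemma nm0_eq0 x : nm x = 0 -> x = 0.
Proof. by move=> h; apply/eqP; rewrite -normr_eq0 nmE h. Qed.

Lemma nm_le0 x : nm x <= 0 -> x = 0.
Proof. by move=> h; apply: nm0_eq0; apply/eqP; rewrite eq_le h nm_ge0. Qed.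

Lemma nmD x y : nm (x + y) <= nm x + nm y.
Proof. by rewrite -lecR rmorphD /= -!nmE ler_normD. Qed.

Lemma nmN x : nm (- x) = nm x.
Proof. by rewrite /nm normrN. Qed.

Lemma nmB x y : nm (x - y) <= nm x + nm y.
Proof. by rewrite -(nmN y) nmD. Qed.

Lemma nmBC x y : nm (x - y) = nm (y - x).
Proof. by rewrite -nmN opprB. Qed.

Lemma nm_dist z x y : nm (x - y) <= nm (x - z) + nm (z - y).
Proof. by apply: le_trans (nmD _ _); rewrite addrA subrK. Qed.

Lemma nmZ (k : R[i]) x : nm (k *: x) = cabs k * nm x.
Proof. by apply: (@complexI R); rewrite -nmE normrZ cabsE nmE rmorphM. Qed.

Lemma nmZr (r : R) x : nm (r%:C *: x) = `|r| * nm x.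
Proof. by rewrite nmZ cabs_real. Qed.

Lemma eq_of_nm_le x y : (forall e : R, 0 < e -> nm (x - y) <= e) -> x = y.
Proof.
move=> h; apply/eqP; rewrite -subr_eq0; apply/eqP/nm_le0.
by apply/ler_addgt0Pl => e e0; rewrite addr0 h.
Qed.

Definition tendsto (u : nat -> V) (l : V) : Prop :=
  forall e : R, 0 < e -> exists N : nat, forall n, (N <= n)%N -> nm (u n - l) < e.

Lemma tendsto_unique u l l' : tendsto u l -> tendsto u l' -> l = l'.
Proof.
move=> h h'; apply: eq_of_nm_le => e e0.
have [N hN] := h _ (divr_gt0 e0 (ltr0n R 2)).
have [N' hN'] := h' _ (divr_gt0 e0 (ltr0n R 2)).
have := hN _ (leq_maxl N N'); have := hN' _ (leq_maxr N N').
set w := u _; rewrite (nmBC w l) => h1 h2; apply: le_trans (nm_dist w _ _) _.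
by rewrite [e]splitr ltW ?ltrD.
Qed.

Lemma tendsto_cst l : tendsto (fun=> l) l.
Proof. by move=> e e0; exists 0%N => n _; rewrite subrr nm0. Qed.

Lemma tendstoD u v l m :
  tendsto u l -> tendsto v m -> tendsto (fun n => u n + v n) (l + m).
Proof.
move=> h h' e e0.
have [N hN] := h _ (divr_gt0 e0 (ltr0n R 2)).
have [N' hN'] := h' _ (divr_gt0 e0 (ltr0n R 2)).
exists (maxn N N') => n; rewrite geq_max => /andP[h1 h2].
rewrite opprD addrACA; apply: le_lt_trans (nmD _ _) _.
by rewrite [e]splitr ltrD ?hN ?hN'.
Qed.

Lemma tendsto_nm_le u l (c : R) :
  tendsto u l -> (forall n, nm (u n) <= c) -> nm l <= c.
Proof.
move=> h hc; apply/ler_addgt0Pr => e e0; have [N /(_ N (leqnn _)) hN] := h _ e0.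
have := nm_dist (u N) l 0; rewrite !subr0 nmBC => /le_trans; apply.
by rewrite addrC lerD // ltW.
Qed.

End RealNorm.

Section Lipschitz.
Variables (R : realType) (V W : normedModType R[i]).

Lemma tendsto_lip (f : V -> W) (c : R) (u : nat -> V) (l : V) :
  (forall x y, nm (f x - f y) <= c * nm (x - y)) ->
  tendsto u l -> tendsto (f \o u) (f l).
Proof.
move=> hf h e e0; have c0 : 0 < `|c| + 1 by rewrite ltr_wpDl.
have [N hN] := h _ (divr_gt0 e0 c0); exists N => n /hN.
rewrite ltr_pdivlMr // mulrC => h1; apply: le_lt_trans h1.
apply: le_trans (hf _ _) _; apply: ler_wpM2r; first exact: nm_ge0.
by apply: (le_trans (ler_norm _)); rewrite lerDl.
Qed.

End Lipschitz.

Section Complete.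
Variables (R : realType) (V : completeNormedModType R[i]).

Definition cauchy_nm (U : normedModType R[i]) (u : nat -> U) : Prop :=
  forall e : R, 0 < e ->
  exists N : nat, forall m n, (N <= m)%N -> (N <= n)%N -> nm (u m - u n) < e.

Lemma cauchy_nm_tendsto (u : nat -> V) : cauchy_nm u -> exists l, tendsto u l.
Proof.
move=> hu; have cu : cauchy (u @ \oo).
  apply/cauchy_ballP => e e0; rewrite near_simpl.
  move: e0; rewrite ltcE /= => /andP[/eqP ei e0].
  have [N hN] := hu _ e0.
  exists ([set n | N <= n]%N, [set n | N <= n]%N) => /=.
    by split; exists N.
  move=> [m n] /= [hm hn]; rewrite -ball_normE /ball_ /= nmE.
  by rewrite ltcE /= ei eqxx /= hN.
have /cvg_ex[l hl] : cvg (u @ \oo) by exact: cauchy_cvg.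
exists l => e e0; have e0' : (0 : R[i]) < e%:C by rewrite ltcR.
have /cvgrPdist_lt/(_ _ e0') := hl => -[N _ hN].
by exists N => n /hN /=; rewrite distrC nmE ltcR.
Qed.

Lemma closureE (U : normedModType R[i]) (S : set U) (x : U) :
  closure S x <-> forall e : R, 0 < e -> exists2 y, S y & nm (x - y) < e.
Proof.
split=> [h e e0|h B].
  have e0' : (0 : R[i]) < e%:C by rewrite ltcR.
  have [y [Sy]] := h _ (nbhsx_ballx x (PosNum e0')%:num e0').
  rewrite -ball_normE /ball_ /= nmE ltcR => hy; by exists y.
move=> /nbhs_ballP[e /= e0 hB].
move: (e0); rewrite ltcE /= => /andP[/eqP ei e0r].
have [y Sy hy] := h _ e0r; exists y; split => //; apply: hB.
by rewrite -ball_normE /ball_ /= nmE ltcE /= ei eqxx.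
Qed.

Lemma geometric_cauchy (u : nat -> V) (c : R) :
  (forall n, nm (u n.+1 - u n) <= c * (2^-1) ^+ n) -> cauchy_nm u.
Proof.
move=> hu.
have hs m n : nm (u (m + n)%N - u m) <= 2 * c * (2^-1) ^+ m.
  (* Subtracting the remaining tail gives a bound that the induction on n can carry. *)
  suff : nm (u (m + n)%N - u m) <= 2 * c * (2^-1) ^+ m - 2 * c * (2^-1) ^+ (m + n).
    move=> h; apply: (le_trans h); rewrite gerBl.
    have := hu 0%N; rewrite expr0 mulr1 => /(le_trans (nm_ge0 _)) c0.
    by rewrite mulr_ge0 ?mulr_ge0 ?exprn_ge0 // invr_ge0.
  elim: n => [|n ih]; first by rewrite addn0 !subrr nm0.
  apply: le_trans (nm_dist (u (m + n)%N) _ _) _; rewrite addnS.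
  have := hu (m + n)%N => h; apply: le_trans (lerD h ih) _.
  by rewrite exprS; lra.
have c0 : 0 <= c by have := hu 0%N; rewrite expr0 mulr1 => /(le_trans (nm_ge0 _)).
move=> e e0.
(* Two tails of size at most [2 * c * 2^-N] meet at [u N], whence the 4. *)
have [N hN] : exists N, 4 * c * (2^-1) ^+ N < e.
  have hc : (GRing.exp (2^-1 : R)) @ \oo --> (0 : R).
    by apply: cvg_expr; rewrite ger0_norm ?invr_ge0 // invf_lt1 ?ltr1n.
  have : (fun n => 4 * c * (2^-1) ^+ n : R) @ \oo --> (0 : R).
    by rewrite -[X in _ --> X](mulr0 (4 * c)); exact: cvgMr.
  move=> /cvgrPdist_lt/(_ _ e0)[N _ /(_ N (leqnn N))].
  rewrite /= sub0r normrN => h; exists N; exact: le_lt_trans (ler_norm _) h.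
exists N => m n hm hn.
apply: le_lt_trans hN; apply: le_trans (nm_dist (u N) _ _) _.
rewrite (nmBC (u N)) -(subnKC hm) -(subnKC hn).
by apply: le_trans (lerD (hs _ _) (hs _ _)) _; lra.
Qed.

End Complete.

(** * Equalities of linear combinations by reflection *)

Section LmoduleNormalization.
Variables (K : comPzRingType) (V : lmodType K).

Inductive lexp : Type :=
  | LVar of nat | LAdd of lexp & lexp | LOpp of lexp | LZero
  | LScale of K & lexp.

Fixpoint leval (env : seq V) (t : lexp) : V :=
  match t with
  | LVar i => nth 0 env i
  | LAdd t1 t2 => leval env t1 + leval env t2
  | LOpp t1 => - leval env t1
  | LZero => 0
  | LScale k t1 => k *: leval env t1
  end.

Fixpoint lcoef (t : lexp) (i : nat) : K :=
  match t with
  | LVar j => if eqn i j then 1 else 0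
  | LAdd t1 t2 => lcoef t1 i + lcoef t2 i
  | LOpp t1 => - lcoef t1 i
  | LZero => 0
  | LScale k t1 => k * lcoef t1 i
  end.

(** A conjunction of equations rather than a Boolean test: equality of scalars is not computable
    here, so each coefficient is handed over to [ring] or [field]. *)
Fixpoint lsame (n : nat) (t1 t2 : lexp) : Prop :=
  match n with
  | 0%N => True
  | n'.+1 => lcoef t1 n' = lcoef t2 n' /\ lsame n' t1 t2
  end.

Lemma levalE env t : leval env t = \sum_(i < size env) lcoef t i *: env`_i.
Proof.
elim: t => [j|t1 h1 t2 h2|t1 h1||k t1 h1] /=.
- case: (ltnP j (size env)) => hj; last first.
    rewrite nth_default // big1 // => i _; case: eqnP => [e|]; last by rewrite scale0r.
    by move: hj; rewrite -e leqNgt ltn_ord.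
  rewrite (bigD1 (Ordinal hj)) //= big1 ?addr0.
    by case: eqnP => // _; rewrite scale1r.
  move=> i hi; case: eqnP => [e|]; last by rewrite scale0r.
  by case/eqP: hi; apply: val_inj.
- by rewrite h1 h2 -big_split; apply: eq_bigr => i _; rewrite scalerDl.
- by rewrite h1 -sumrN; apply: eq_bigr => i _; rewrite scaleNr.
- by rewrite big1 // => i _; rewrite scale0r.
- by rewrite h1 scaler_sumr; apply: eq_bigr => i _; rewrite scalerA.
Qed.

Lemma leval_same env t1 t2 :
  lsame (size env) t1 t2 -> leval env t1 = leval env t2.
Proof.
move=> h; rewrite !levalE; apply: eq_bigr => i _; congr (_ *: _).
have := ltn_ord i; elim: (size env) (nat_of_ord i) h => //= n ih m [h1 h2].
by rewrite ltnS leq_eqVlt => /orP[/eqP->//|]; apply: ih.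
Qed.

End LmoduleNormalization.

Ltac lm_mem a env :=
  lazymatch env with
  | nil => constr:(false)
  | cons a _ => constr:(true)
  | cons _ ?l => lm_mem a l
  end.
Ltac lm_add a env :=
  let b := lm_mem a env in
  lazymatch b with true => env | false => constr:(cons a env) end.
Ltac lm_index a env :=
  lazymatch env with
  | cons a _ => constr:(0%N)
  | cons _ ?l => let n := lm_index a l in constr:(S n)
  end.
Ltac lm_atoms t env :=
  lazymatch t with
  | @GRing.add _ ?a ?b => let e := lm_atoms a env in lm_atoms b e
  | @GRing.opp _ ?a => lm_atoms a env
  | @GRing.zero _ => env
  | @GRing.scale _ _ ?k ?a => lm_atoms a env
  | _ => lm_add t env
  end.
Ltac lm_quote K t env :=
  lazymatch t with
  | @GRing.add _ ?a ?b =>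
      let x := lm_quote K a env in let y := lm_quote K b env in constr:(LAdd x y)
  | @GRing.opp _ ?a => let x := lm_quote K a env in constr:(LOpp x)
  | @GRing.zero _ => constr:(LZero K)
  | @GRing.scale _ _ ?k ?a => let x := lm_quote K a env in constr:(@LScale K k x)
  | _ => let n := lm_index t env in constr:(@LVar K n)
  end.
(* Equalities of linear combinations in a module over a commutative ring K. *)
Ltac lmodule K :=
  lazymatch goal with
  | |- @eq ?V ?a ?b =>
      let e0 := lm_atoms a (@nil V) in
      let env := lm_atoms b e0 in
      let x := lm_quote K a env in
      let y := lm_quote K b env in
      let lmh := fresh "lmh" in
      pose proof (@leval_same K _ env x y) as lmh;
      cbn [leval nth size lsame lcoef eqn] in lmh;
      apply lmh; clear lmh; repeat split; try ring; try field
  end.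

Section LinearProp.
Variables (K : pzRingType) (U V : lmodType K) (f : U -> V).
Hypothesis lf : linear f.

Lemma lin0 : f 0 = 0.
Proof.
have := lf 1 0 0; rewrite !scale1r addr0 => h.
by apply: (@addrI _ (f 0)); rewrite addr0 -h.
Qed.

Lemma linD x y : f (x + y) = f x + f y.
Proof. by have := lf 1 x y; rewrite !scale1r. Qed.

Lemma linZ k x : f (k *: x) = k *: f x.
Proof. by have := lf k x 0; rewrite !addr0 lin0 addr0. Qed.

Lemma linN x : f (- x) = - f x.
Proof. by rewrite -!scaleN1r linZ. Qed.

Lemma linB x y : f (x - y) = f x - f y.
Proof. by rewrite linD linN. Qed.

Lemma lin_sum I (r : seq I) (P : pred I) (F : I -> U) :
  f (\sum_(i <- r | P i) F i) = \sum_(i <- r | P i) f (F i).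
Proof. exact: (big_morph f linD lin0). Qed.

End LinearProp.

(** * Elementary consequences of the C*-identity *)

Section Algebra.
Variables (R : realType) (A : cstarAlgType R).
Implicit Types (x y z : A) (k : R[i]).

Lemma cmulDl x y z : (x + y) *c z = x *c z + y *c z.
Proof. exact: (linD (cmul_linearl z)). Qed.

Lemma cmulDr x y z : z *c (x + y) = z *c x + z *c y.
Proof. exact: (linD (cmul_linearr z)). Qed.

Lemma cmulNl x z : (- x) *c z = - (x *c z).
Proof. exact: (linN (cmul_linearl z)). Qed.

Lemma cmulNr x z : z *c (- x) = - (z *c x).
Proof. exact: (linN (cmul_linearr z)). Qed.

Lemma cmulBl x y z : (x - y) *c z = x *c z - y *c z.
Proof. exact: (linB (cmul_linearl z)). Qed.

Lemma cmulBr x y z : z *c (x - y) = z *c x - z *c y.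
Proof. exact: (linB (cmul_linearr z)). Qed.

Lemma cmulZl k x z : (k *: x) *c z = k *: (x *c z).
Proof. exact: (linZ (cmul_linearl z)). Qed.

Lemma cmulZr k x z : z *c (k *: x) = k *: (z *c x).
Proof. exact: (linZ (cmul_linearr z)). Qed.

Lemma cmul0l z : 0 *c z = 0 :> A.
Proof. exact: (lin0 (cmul_linearl z)). Qed.

Lemma cmul0r z : z *c 0 = 0 :> A.
Proof. exact: (lin0 (cmul_linearr z)). Qed.

Lemma cmul_suml I (r : seq I) (P : pred I) (F : I -> A) z :
  (\sum_(i <- r | P i) F i) *c z = \sum_(i <- r | P i) F i *c z.
Proof. exact: (lin_sum (cmul_linearl z)). Qed.

Lemma cmul_sumr I (r : seq I) (P : pred I) (F : I -> A) z :
  z *c (\sum_(i <- r | P i) F i) = \sum_(i <- r | P i) z *c F i.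
Proof. exact: (lin_sum (cmul_linearr z)). Qed.

Lemma cstarD x y : cstar (x + y) = cstar x + cstar y.
Proof. by have := cstar_antilinear 1 x y; rewrite conjc1 !scale1r. Qed.

Lemma cstar0 : cstar 0 = 0 :> A.
Proof. by apply: (@addrI _ (cstar 0)); rewrite -cstarD !addr0. Qed.

Lemma cstarZ k x : cstar (k *: x) = conjc k *: cstar x.
Proof. by have := cstar_antilinear k x 0; rewrite !addr0 cstar0 addr0. Qed.

Lemma cstarN x : cstar (- x) = - cstar x.
Proof. by apply/eqP; rewrite -addr_eq0 -cstarD addrC subrr cstar0. Qed.

Lemma cstarB x y : cstar (x - y) = cstar x - cstar y.
Proof. by rewrite cstarD cstarN. Qed.

Lemma cstarZr (r : R) x : cstar (r%:C *: x) = r%:C *: cstar x.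
Proof. by rewrite cstarZ conjc_real. Qed.

Lemma cstar_sum I (r : seq I) (P : pred I) (F : I -> A) :
  cstar (\sum_(i <- r | P i) F i) = \sum_(i <- r | P i) cstar (F i).
Proof. exact: (big_morph _ cstarD cstar0). Qed.

Lemma nmM x y : nm (x *c y) <= nm x * nm y.
Proof. by rewrite -lecR rmorphM /= -!nmE norm_cmul_le. Qed.

Lemma nm_sq x : nm (cstar x *c x) = nm x ^+ 2.
Proof. by apply: (@complexI R); rewrite rmorphXn /= -!nmE norm_cstar_mul. Qed.

(** From |z|^2 = |z^* z| <= |z^*| |z| one gets |z| <= |z^*|, and the involution gives the
    converse. *)
Lemma nm_cstar x : nm (cstar x) = nm x.
Proof.
have le_cstar z : nm z <= nm (cstar z).
  case: (eqVneq (nm z) 0) => [->|nz]; first exact: nm_ge0.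
  have z0 : 0 < nm z by rewrite lt_def nz nm_ge0.
  by rewrite -(ler_pM2r z0) -expr2 -nm_sq nmM.
by apply/eqP; rewrite eq_le -{2}(cstarK x) !le_cstar.
Qed.

Lemma nm_sqr x : nm (x *c cstar x) = nm x ^+ 2.
Proof. by rewrite -{1}(cstarK x) nm_sq nm_cstar. Qed.

Lemma cstar_mul_eq0 x : cstar x *c x = 0 -> x = 0.
Proof.
move=> h; apply: nm0_eq0; apply/eqP.
by rewrite -(sqrf_eq0 (nm x)) -nm_sq h nm0.
Qed.

Lemma mul_cstar_eq0 x : x *c cstar x = 0 -> x = 0.
Proof.
by rewrite -{1}(cstarK x) => /cstar_mul_eq0 h; rewrite -(cstarK x) h cstar0.
Qed.

Definition selfadj x := cstar x = x.

Lemma selfadj_sqr_eq0 x : selfadj x -> x *c x = 0 -> x = 0.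
Proof. by move=> h; rewrite -{1}h => /cstar_mul_eq0. Qed.

(** If x^3 = 0 then (x^2)^2 = 0, and the C*-identity applies twice. Cubes occur below because n a n
    = - n^3 for the negative part n of a. *)
Lemma selfadj_cube_eq0 x : selfadj x -> x *c x *c x = 0 -> x = 0.
Proof.
move=> hx h; apply: selfadj_sqr_eq0 => //; apply: selfadj_sqr_eq0.
  by rewrite /selfadj cstarM hx.
by rewrite cmulA h cmul0l.
Qed.

Lemma selfadjD x y : selfadj x -> selfadj y -> selfadj (x + y).
Proof. by rewrite /selfadj cstarD => -> ->. Qed.
Lemma selfadjN x : selfadj x -> selfadj (- x).
Proof. by rewrite /selfadj cstarN => ->. Qed.
Lemma selfadjB x y : selfadj x -> selfadj y -> selfadj (x - y).
Proof. by rewrite /selfadj cstarB => -> ->. Qed.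
Lemma selfadjZ (r : R) x : selfadj x -> selfadj (r%:C *: x).
Proof. by rewrite /selfadj cstarZr => ->. Qed.
Lemma selfadj0 : selfadj 0. Proof. exact: cstar0. Qed.
Lemma selfadjM x y : selfadj x -> selfadj y -> x *c y = y *c x ->
  selfadj (x *c y).
Proof. by rewrite /selfadj cstarM => -> ->. Qed.
Lemma selfadj_sq x : selfadj (cstar x *c x).
Proof. by rewrite /selfadj cstarM cstarK. Qed.

Lemma nm_selfadj_sq x : selfadj x -> nm (x *c x) = nm x ^+ 2.
Proof. by move=> hx; rewrite -{1}hx nm_sq. Qed.

Definition hpart x : A := (2^-1)%:C *: (x + cstar x).
(** The factor is 1 / (2i), so that x is [hpart x] plus i times [apart x], both selfadjoint. *)
Definition apart x : A := (- 'i * (2^-1)%:C) *: (x - cstar x).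

Lemma hpart_selfadj x : selfadj (hpart x).
Proof. by rewrite /selfadj /hpart cstarZr cstarD cstarK addrC. Qed.

Lemma apart_selfadj x : selfadj (apart x).
Proof.
rewrite /selfadj /apart cstarZ cstarB cstarK conjcM conjcN conji conjc_real opprK.
by rewrite mulNr scaleNr -scalerN opprB.
Qed.

Lemma half_half_complex : (2^-1)%:C + (2^-1)%:C = 1 :> R[i].
Proof. by rewrite -rmorphD /=; congr (_%:C); lra. Qed.

Lemma cartesian x : x = hpart x + 'i *: apart x.
Proof.
rewrite /hpart /apart scalerA mulrA mulrN mulii opprK mul1r -scalerDr addrACA subrr addr0.
by rewrite scalerDr -scalerDl half_half_complex scale1r.
Qed.

Lemma nm_hpart x : nm (hpart x) <= nm x.
Proof.
rewrite nmZr ger0_norm ?invr_ge0 //; have := nmD x (cstar x); rewrite nm_cstar.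
by move=> h; rewrite mulrC ler_pdivrMr //; lra.
Qed.

Lemma cabs_i : cabs ('i : R[i]) = 1.
Proof. by rewrite /cabs normc_def /= expr0n expr1n add0r sqrtr1. Qed.

Lemma nm_apart x : nm (apart x) <= nm x.
Proof.
rewrite /apart -scalerA scaleNr nmN nmZ cabs_i mul1r nmZr ger0_norm ?invr_ge0 //.
have := nmB x (cstar x); rewrite nm_cstar.
by move=> h; rewrite mulrC ler_pdivrMr //; lra.
Qed.

Lemma hpart_id x : selfadj x -> hpart x = x.
Proof.
by move=> h; rewrite /hpart h scalerDr -scalerDl half_half_complex scale1r.
Qed.

Lemma hpartD x y : hpart (x + y) = hpart x + hpart y.
Proof. by rewrite /hpart cstarD -scalerDr addrACA. Qed.
Lemma hpartZ (r : R) x : hpart (r%:C *: x) = r%:C *: hpart x.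
Proof. by rewrite /hpart cstarZr -scalerDr !scalerA mulrC. Qed.

End Algebra.

Ltac lcomb R := lmodule (complex_complex__canonical__GRing_ComNzRing R).

(* Expands products, scalars first, and compares the coefficients of the words. *)
Ltac calg R :=
  rewrite ?(cmulDl, cmulDr, cmulNl, cmulNr, cmulZl, cmulZr, cmulA, cmul0l, cmul0r);
  lcomb R.

(** * Square roots and positive elements *)

Section TendstoAlgebra.
Variables (R : realType) (A : cstarAlgType R).
Implicit Types (x y z : A) (u v : nat -> A).

Lemma tendstoZ (k : R[i]) u l : tendsto u l -> tendsto (fun n => k *: u n) (k *: l).
Proof.
apply: (@tendsto_lip _ _ _ (fun x : A => k *: x) (cabs k)) => x y.
by rewrite -scalerBr nmZ.
Qed.

Lemma tendsto_cstar u l : tendsto u l -> tendsto (fun n => cstar (u n)) (cstar l).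
Proof.
apply: (@tendsto_lip _ _ _ (@cstar R A) 1) => x y.
by rewrite -cstarB nm_cstar mul1r.
Qed.

Lemma tendsto_mull z u l : tendsto u l -> tendsto (fun n => z *c u n) (z *c l).
Proof.
apply: (@tendsto_lip _ _ _ (fun x : A => z *c x) (nm z)) => x y.
by rewrite -cmulBr nmM.
Qed.

Lemma tendsto_mulr z u l : tendsto u l -> tendsto (fun n => u n *c z) (l *c z).
Proof.
apply: (@tendsto_lip _ _ _ (fun x : A => x *c z) (nm z)) => x y.
by rewrite -cmulBl mulrC nmM.
Qed.

Lemma tendstoM u v l m :
  tendsto u l -> tendsto v m -> tendsto (fun n => u n *c v n) (l *c m).
Proof.
move=> hu hv.
have h1 : tendsto (fun n => (u n - l) *c v n) 0.
  move=> e e0; pose c := nm m + 1; have c0 : 0 < c by rewrite ltr_wpDl ?nm_ge0.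
  have [N hN] := hu _ (divr_gt0 e0 c0); have [N' hN'] := hv _ ltr01.
  exists (maxn N N') => n; rewrite geq_max => /andP[/hN h1 /hN' h2].
  rewrite subr0; apply: le_lt_trans (nmM _ _) _.
  have h3 : nm (v n) <= c.
    have := nmD (v n - m) m; rewrite subrK => /le_trans; apply.
    by rewrite addrC lerD2l ltW.
  rewrite ltr_pdivlMr // in h1; apply: le_lt_trans h1.
  by apply: ler_wpM2l h3; exact: nm_ge0.
have := tendstoD h1 (tendsto_mull l hv); rewrite add0r => h e e0.
have [N hN] := h e e0; exists N => n /hN.
by rewrite cmulBl subrK.
Qed.

Lemma tendsto_ext u v l : (forall n, u n = v n) -> tendsto u l -> tendsto v l.
Proof. by move=> /funext ->. Qed.

End TendstoAlgebra.

Section SquareRootIteration.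
Variables (R : realType) (A : cstarAlgType R) (e : A).
Hypothesis e1 : is_one e.
Implicit Types x y z : A.

Lemma cmul1l x : e *c x = x. Proof. by case: (e1 x). Qed.
Lemma cmul1r x : x *c e = x. Proof. by case: (e1 x). Qed.

Lemma cstar_one : cstar e = e.
Proof. by rewrite -[LHS]cmul1l -{1}(cstarK e) -cstarM cmul1l cstarK. Qed.

Lemma nm_one_le : nm e <= 1.
Proof.
have := nm_sq e; rewrite cstar_one cmul1l => h.
have := nm_ge0 e; rewrite le_eqVlt => /orP[/eqP <- //|h0].
by rewrite -(ler_pM2r h0) mul1r -expr2 -h.
Qed.

(* The binomial series of [1 - sqrt (1 - x)], summed by y <- (x + y^2) / 2; the
   numerical iteration for x = 1 dominates it. *)
Fixpoint sqit x n : A :=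
  if n is m.+1 then (2^-1)%:C *: (x + sqit x m *c sqit x m) else 0.
Fixpoint sqit1 n : R := if n is m.+1 then 2^-1 * (1 + sqit1 m ^+ 2) else 0.

(** With t = 1 - u the scalar iteration reads t |-> t - t^2 / 2, which is increasing on [0, 1] and
    whose orbits decay like 2 / n; the bound 2 / (n + 2) is therefore inherited from one step to the
    next. *)
Lemma sqit1_bounds n : [/\ 0 <= sqit1 n, 1 - sqit1 n <= 2 / n.+2%:R & sqit1 n <= 1].
Proof.
elim: n => [|n [h1 h2 h3]]; first by split => //=; rewrite subr0 divff.
split => /=.
- by rewrite mulr_ge0 ?invr_ge0 // addr_ge0 ?sqr_ge0.
- set u := sqit1 n in h1 h2 h3 *.
  have n0 : 0 < n.+2%:R :> R by rewrite ltr0n.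
  set t : R := n.+2%:R in h2 n0 *.
  have -> : n.+3%:R = t + 1 :> R by rewrite /t -natr1.
  set d := 2 / t in h2 *.
  have td : t * d = 2 by rewrite /d mulrC divfK // gt_eqF.
  rewrite ler_pdivlMr; last by lra.
  have d0 : 0 < d by rewrite divr_gt0.
  have d1 : d <= 1.
    by rewrite /d ler_pdivrMr // mul1r /t ler_nat.
  have hmono : (1 - u) - (1 - u) ^+ 2 / 2 <= d - d ^+ 2 / 2.
    have : 0 <= (d - (1 - u)) * (2 - d - (1 - u)) by apply: mulr_ge0; lra.
    by rewrite !expr2; nra.
  have -> : 1 - 2^-1 * (1 + u ^+ 2) = (1 - u) - (1 - u) ^+ 2 / 2 by field.
  apply: le_trans (_ : (d - d ^+ 2 / 2) * (t + 1) <= _).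
    by apply: ler_wpM2r hmono; lra.
  have -> : (d - d ^+ 2 / 2) * (t + 1) = (t * d) + d - (t * d) * d / 2 - d ^+ 2 / 2.
    by field.
  by rewrite td; nra.
- by have : sqit1 n ^+ 2 <= 1; [rewrite expr_le1|lra].
Qed.

Lemma sqit1_tail n : 1 - sqit1 n <= 2 / n.+2%:R.
Proof. by case: (sqit1_bounds n). Qed.

Section Iteration.
Variable x : A.
Hypotheses (xs : selfadj x) (x1 : nm x <= 1).

Lemma sqit_selfadj n : selfadj (sqit x n).
Proof.
elim: n => [|n ih] /=; first exact: selfadj0.
by apply: selfadjZ; apply: selfadjD => //; apply: selfadjM.
Qed.

Lemma nm_sqit n : nm (sqit x n) <= sqit1 n.
Proof.
elim: n => [|n ih] /=; first by rewrite nm0.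
rewrite nmZr ger0_norm ?invr_ge0 //; apply: ler_wpM2l; first by rewrite invr_ge0.
apply: le_trans (nmD _ _) _; apply: lerD => //.
by apply: le_trans (nmM _ _) _; rewrite expr2; apply: ler_pM; rewrite ?nm_ge0.
Qed.

(** The increments are dominated by the scalar ones because y^2 - z^2 = y (y - z) + (y - z) z, a
    splitting that requires no commutation. The scalar increments telescope, which gives the Cauchy
    property. *)
Lemma nm_sqitS n : nm (sqit x n.+1 - sqit x n) <= sqit1 n.+1 - sqit1 n.
Proof.
elim: n => [|n ih]; first by rewrite /= cmul0l !subr0 expr0n !addr0 nmZr ger0_norm ?invr_ge0 // ler_wpM2l // invr_ge0.
set y := sqit x n.+1 in ih *; set z := sqit x n in ih *.
have -> : sqit x n.+2 - y = (2^-1)%:C *: (y *c (y - z) + (y - z) *c z).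
  have -> : sqit x n.+2 = (2^-1)%:C *: (x + y *c y) by [].
  have {3}-> : y = (2^-1)%:C *: (x + z *c z) by [].
  by clear ih; calg R.
have -> : sqit1 n.+2 - sqit1 n.+1 =
    2^-1 * (sqit1 n.+1 * (sqit1 n.+1 - sqit1 n) + (sqit1 n.+1 - sqit1 n) * sqit1 n).
  have -> : sqit1 n.+2 = 2^-1 * (1 + sqit1 n.+1 ^+ 2) by [].
  have {2}-> : sqit1 n.+1 = 2^-1 * (1 + sqit1 n ^+ 2) by [].
  by field.
rewrite nmZr ger0_norm ?invr_ge0 //; apply: ler_wpM2l; first by rewrite invr_ge0.
apply: le_trans (nmD _ _) _; apply: lerD; apply: le_trans (nmM _ _) _;
  by apply: ler_pM => //; rewrite ?nm_ge0 // nm_sqit.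
Qed.

Lemma nm_sqit_tail m n : (n <= m)%N -> nm (sqit x m - sqit x n) <= 2 / n.+2%:R.
Proof.
move=> nm_; apply: le_trans (sqit1_tail n).
have : nm (sqit x m - sqit x n) <= sqit1 m - sqit1 n.
  rewrite -(subnKC nm_); elim: (m - n)%N => [|d ih]; first by rewrite addn0 !subrr nm0.
  rewrite addnS; apply: le_trans (nm_dist (sqit x (n + d)) _ _) _.
  by have := lerD (nm_sqitS (n + d)) ih; rewrite addrA subrK.
by move=> h; apply: (le_trans h); rewrite lerD2r; case: (sqit1_bounds m).
Qed.

Lemma sqit_cvg : exists y, tendsto (sqit x) y.
Proof.
apply: cauchy_nm_tendsto => d d0.
have [N hN] : exists N : nat, 4 / N.+2%:R < d.
  exists (Num.truncn (4 / d)); rewrite ltr_pdivrMr ?ltr0n //.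
  have := truncnS_gt (4 / d); rewrite ltr_pdivrMr // => h.
  by apply: (lt_trans h); rewrite mulrC ltr_pM2l // ltr_nat.
exists N => m n hm hn; apply: le_lt_trans hN.
apply: le_trans (nm_dist (sqit x N) _ _) _; rewrite (nmBC (sqit x N)).
by apply: le_trans (lerD (nm_sqit_tail hm) (nm_sqit_tail hn)) _; rewrite -mulrDl -natrD.
Qed.

(** The limit is a fixed point, y = (x + y^2) / 2, that is (1 - y)^2 = 1 - x. Each iterate commutes
    with whatever commutes with x, and this passes to the limit. *)
Lemma sqrt_one_sub : exists y, [/\ selfadj y, nm y <= 1,
  (e - y) *c (e - y) = e - x & forall z, x *c z = z *c x -> y *c z = z *c y].
Proof.
have [y hy] := sqit_cvg; exists y.
have fix_y : y = (2^-1)%:C *: (x + y *c y).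
  apply: (@tendsto_unique _ _ (fun n => sqit x n.+1)).
    by move=> d d0; have [N hN] := hy d d0; exists N => n hn; apply: hN; exact: leqW.
  apply: tendstoZ; apply: tendstoD; first exact: tendsto_cst.
  exact: tendstoM.
split.
- apply: (@tendsto_unique _ _ (sqit x)) => //.
  by apply: tendsto_ext (tendsto_cstar hy) => n; exact: sqit_selfadj.
- apply: tendsto_nm_le hy _ => n; apply: le_trans (nm_sqit n) _.
  by case: (sqit1_bounds n).
- have -> : (e - y) *c (e - y) = e - y - y + y *c y.
    rewrite cmulBl !cmulBr !cmul1l cmul1r; lcomb R.
  have -> : e - y - y + y *c y = e - x + (x + y *c y - (y + y)).
    lcomb R.
  by rewrite {3 4}fix_y -scalerDl half_half_complex scale1r subrr addr0.
- move=> z hz; apply: (@tendsto_unique _ _ (fun n => sqit x n *c z)).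
    exact: tendsto_mulr.
  apply: tendsto_ext (tendsto_mull z hy) => n; elim: n => [|n ih] /=.
    by rewrite cmul0l cmul0r.
  rewrite cmulZl cmulZr cmulDl cmulDr hz; congr (_ *: (_ + _)).
  by rewrite -cmulA -ih !cmulA ih.
Qed.

End Iteration.
End SquareRootIteration.

Section Positivity.
Variables (R : realType) (A : cstarAlgType R).
Implicit Types x y z a b : A.

Definition comm x y := x *c y = y *c x.

Lemma comm_sym x y : comm x y -> comm y x. Proof. by []. Qed.
Lemma commD x y z : comm z x -> comm z y -> comm z (x + y).
Proof. by rewrite /comm cmulDl cmulDr => -> ->. Qed.
Lemma commN x z : comm z x -> comm z (- x).
Proof. by rewrite /comm cmulNl cmulNr => ->. Qed.
Lemma commB x y z : comm z x -> comm z y -> comm z (x - y).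
Proof. by move=> h1 h2; apply: commD => //; exact: commN. Qed.
Lemma commZ k x z : comm z x -> comm z (k *: x).
Proof. by rewrite /comm cmulZl cmulZr => ->. Qed.
Lemma commM x y z : comm z x -> comm z y -> comm z (x *c y).
Proof. by rewrite /comm => h1 h2; rewrite cmulA h1 -cmulA h2 cmulA. Qed.
Lemma comm_refl x : comm x x. Proof. by []. Qed.

(** Positivity without spectra. That such squares are closed under sums, and that every x^* x is one
    of them, is the content of [posD] and [pos_star_mul]. *)
Definition pos a := exists2 b, selfadj b & a = b *c b.

Lemma pos_selfadj a : pos a -> selfadj a.
Proof. by move=> [b hb ->]; exact: selfadjM. Qed.

Lemma pos0 : pos (0 : A).
Proof. by exists 0; [exact: selfadj0|rewrite cmul0l]. Qed.

Lemma posZ (r : R) a : 0 <= r -> pos a -> pos (r%:C *: a).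
Proof.
move=> r0 [b hb ->]; exists ((Num.sqrt r)%:C *: b); first exact: selfadjZ.
by rewrite cmulZl cmulZr scalerA -rmorphM /= -expr2 sqr_sqrtr.
Qed.

(* [k + i l] has square norm [k^2 + l^2] and real part [k]. *)
Lemma nm_sq_le_sum k l : selfadj k -> selfadj l -> comm k l ->
  nm k ^+ 2 <= nm (k *c k + l *c l).
Proof.
move=> hk hl hkl; set u := k + 'i *: l.
have us : cstar u = k - 'i *: l by rewrite cstarD cstarZ hk hl conji scaleNr.
have -> : k *c k + l *c l = cstar u *c u.
  rewrite us /u cmulBl !cmulDr !cmulZl !cmulZr hkl scalerA mulii scaleN1r.
  lcomb R.
rewrite nm_sq; have -> : k = hpart u.
  by rewrite /hpart us /u addrACA subrr addr0 scalerDr -scalerDl half_half_complex scale1r.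
by rewrite lerXn2r ?nnegrE ?nm_ge0 // nm_hpart.
Qed.

Variable e : A.
Hypothesis e1 : is_one e.
Let cmul1l := cmul1l e1.
Let cmul1r := cmul1r e1.

Lemma selfadj_one : selfadj e. Proof. exact: cstar_one. Qed.
Lemma comm_one x : comm x e. Proof. by rewrite /comm cmul1l cmul1r. Qed.
Lemma pos_one : pos e.
Proof. by exists e; [exact: selfadj_one|rewrite cmul1l]. Qed.

(** The hypothesis says that x = 1 - a / t has norm at most 1, so that [sqrt_one_sub] applies. The
    root obtained satisfies the same criterion with radius sqrt t, hence is itself positive. *)
Lemma sqrt_of_nm a (t : R) : selfadj a -> nm (t%:C *: e - a) <= t ->
  exists b, [/\ selfadj b, exists2 s : R, 0 <= s & nm (s%:C *: e - b) <= s, a = b *c b &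
    forall z, comm z a -> comm z b].
Proof.
move=> ha ht; have := le_trans (nm_ge0 _) ht; rewrite le_eqVlt => /orP[/eqP t0|t0].
  have -> : a = 0.
    by apply: nm_le0; move: ht; rewrite -t0 scale0r sub0r nmN.
  exists 0; split; rewrite ?cmul0l //; first exact: selfadj0.
  by exists 0 => //; rewrite scale0r subr0 nm0.
have tn : t != 0 by rewrite gt_eqF.
pose x := e - (t^-1)%:C *: a.
have hx : x = (t^-1)%:C *: (t%:C *: e - a).
  by rewrite scalerBr scalerA -rmorphM /= mulVf // scale1r.
have xs : selfadj x by apply: selfadjB (selfadj_one) _; exact: selfadjZ.
have x1 : nm x <= 1.
  by rewrite hx nmZr gtr0_norm ?invr_gt0 // mulrC ler_pdivrMr // mul1r.
have [y [ys y1 hy cy]] := sqrt_one_sub e1 xs x1.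
pose s := Num.sqrt t; have s0 : 0 <= s by exact: sqrtr_ge0.
exists (s%:C *: (e - y)); split.
- by apply: selfadjZ; apply: selfadjB => //; exact: selfadj_one.
- exists s => //; rewrite scalerBr opprB addrCA subrr addr0 nmZr ger0_norm //.
  by rewrite -[leRHS]mulr1 ler_wpM2l.
- rewrite cmulZl cmulZr hy scalerA -rmorphM /= -expr2 sqr_sqrtr ?ltW //.
  by rewrite /x opprB addrCA subrr addr0 scalerA -rmorphM /= divff // scale1r.
- move=> z hz; apply: commZ; apply: commB; first exact: comm_one.
  apply: comm_sym; apply: cy; apply: comm_sym; apply: commB; first exact: comm_one.
  exact: commZ.
Qed.

Lemma pos_of_nm a (t : R) : selfadj a -> nm (t%:C *: e - a) <= t -> pos a.
Proof. by move=> ha /(sqrt_of_nm ha)[b [hb _ -> _]]; exists b. Qed.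

(** Write 1 - a^2 = w^2 with w selfadjoint and commuting with a. Then w^2 + a^2 = 1, and
    [nm_sq_le_sum] bounds |w|^2 by |1|. *)
Lemma nm_one_sub_sq a : selfadj a -> nm a <= 1 -> nm (e - a *c a) <= 1.
Proof.
move=> ha a1.
have hx : selfadj (a *c a) by exact: selfadjM.
have x1 : nm (a *c a) <= 1.
  by apply: le_trans (nmM _ _) _; rewrite -[leRHS]mulr1 ler_pM ?nm_ge0.
have [y [ys _ hy cy]] := sqrt_one_sub e1 hx x1.
have ws : selfadj (e - y) by apply: selfadjB => //; exact: selfadj_one.
rewrite -hy nm_selfadj_sq //.
have := nm_sq_le_sum ws ha; rewrite hy subrK => h.
apply: le_trans (nm_one_le e1); apply: h; apply: comm_sym; apply: commB.
  exact: comm_one.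
by apply: comm_sym; apply: cy; rewrite cmulA.
Qed.

Lemma nm_sub_sq a (t : R) : selfadj a -> nm a ^+ 2 <= t ->
  nm (t%:C *: e - a *c a) <= t.
Proof.
move=> ha ht; have := le_trans (sqr_ge0 _) ht; rewrite le_eqVlt => /orP[/eqP t0|t0].
  have -> : a = 0.
    apply: nm0_eq0; apply/eqP; rewrite -(sqrf_eq0 (nm a)) eq_le sqr_ge0 andbT.
    by rewrite t0.
  by rewrite -t0 scale0r cmul0l subr0 nm0.
have s0 : 0 < Num.sqrt t by rewrite sqrtr_gt0.
pose b := ((Num.sqrt t)^-1)%:C *: a.
have bs : selfadj b by exact: selfadjZ.
have b1 : nm b <= 1.
  rewrite nmZr gtr0_norm ?invr_gt0 // mulrC ler_pdivrMr // mul1r.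
  by rewrite -(ler_pXn2r (ltn0Sn 1)) ?nnegrE ?nm_ge0 ?sqrtr_ge0 // sqr_sqrtr // ltW.
have -> : t%:C *: e - a *c a = t%:C *: (e - b *c b).
  rewrite scalerBr; congr (_ - _).
  rewrite /b cmulZl cmulZr !scalerA -!rmorphM /=.
  rewrite -[X in X * _](sqr_sqrtr (ltW t0)) expr2 -mulrA.
  by rewrite mulVKf ?gt_eqF // mulfV ?gt_eqF // scale1r.
rewrite nmZr gtr0_norm // -[leRHS]mulr1; apply: ler_wpM2l; first exact: ltW.
exact: nm_one_sub_sq.
Qed.

Lemma pos_nm_sub a (t : R) : pos a -> nm a <= t -> nm (t%:C *: e - a) <= t.
Proof.
move=> [b hb ->]; rewrite nm_selfadj_sq // => h; exact: nm_sub_sq.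
Qed.

Lemma pos_sqrt a : pos a ->
  exists b, [/\ pos b, a = b *c b & forall z, comm z a -> comm z b].
Proof.
move=> ha; have [b [bs [s s0 hs] hb cb]] :=
  sqrt_of_nm (pos_selfadj ha) (pos_nm_sub ha (lexx _)).
by exists b; split => //; exact: pos_of_nm hs.
Qed.

(** In the criterion |t - a| <= t the radii add up. This is why positivity is passed through the
    norm instead of through roots. *)
Lemma posD a b : pos a -> pos b -> pos (a + b).
Proof.
move=> ha hb; apply: (@pos_of_nm _ (nm a + nm b)).
  by apply: selfadjD; exact: pos_selfadj.
rewrite rmorphD /= scalerDl opprD addrACA; apply: le_trans (nmD _ _) _.
by apply: lerD; exact: pos_nm_sub.
Qed.

Lemma selfadj_le_nm a (t : R) : selfadj a -> nm a <= t -> pos (t%:C *: e - a).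
Proof.
move=> ha ht; apply: (@pos_of_nm _ t).
  by apply: selfadjB => //; apply: selfadjZ; exact: selfadj_one.
by rewrite opprB addrCA subrr addr0.
Qed.

Lemma pos_comm_sqrt a b : pos a -> pos b -> comm a b ->
  exists k l, [/\ selfadj k, selfadj l, comm k l, a = k *c k & b = l *c l].
Proof.
move=> ha hb hab; have [k [kp ek ck]] := pos_sqrt ha.
have [l [lp el cl]] := pos_sqrt hb.
exists k, l; split => //; [exact: pos_selfadj|exact: pos_selfadj|].
by apply: cl; apply: comm_sym; apply: ck; apply: comm_sym.
Qed.

Lemma posM a b : pos a -> pos b -> comm a b -> pos (a *c b).
Proof.
move=> ha hb hab; have [k [l [hk hl hkl -> ->]]] := pos_comm_sqrt ha hb hab.
exists (k *c l); first exact: selfadjM.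
by rewrite !cmulA; congr (_ *c l); rewrite -!cmulA; congr (k *c _).
Qed.

Lemma nm_pos_mono a b : pos a -> pos b -> comm a b -> nm a <= nm (a + b).
Proof.
move=> ha hb hab; have [k [l [hk hl hkl -> ->]]] := pos_comm_sqrt ha hb hab.
by rewrite nm_selfadj_sq // nm_sq_le_sum.
Qed.

Lemma pos_antisym a : pos a -> pos (- a) -> a = 0.
Proof.
move=> ha hna; apply: nm_le0; have := nm_pos_mono ha hna (commN (comm_refl a)).
by rewrite subrr nm0.
Qed.

Lemma pos_add_eq0 a b : pos a -> pos b -> a + b = 0 -> a = 0.
Proof.
move=> ha hb /eqP; rewrite addr_eq0 => /eqP h; apply: pos_antisym => //.
by rewrite h opprK.
Qed.

Lemma nm_le_of_pos a (s : R) : 0 <= s -> pos a -> pos (s%:C *: e - a) -> nm a <= s.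
Proof.
move=> s0 ha hs; have hc : comm a (s%:C *: e - a).
  by apply: commB => //; apply: commZ; exact: comm_one.
apply: (le_trans (nm_pos_mono ha hs hc)); rewrite addrCA subrr addr0.
rewrite nmZr ger0_norm // -[leRHS]mulr1; apply: ler_wpM2l => //.
exact: nm_one_le e1.
Qed.

(** With y = p - q one has y^2 p + y^2 q = 0. Both terms are positive by commutation, so both
    vanish, and their difference is y^3. *)
Lemma pos_sqrt_unique p q : pos p -> pos q -> comm p q -> p *c p = q *c q -> p = q.
Proof.
move=> hp hq hc hpq; apply/eqP; rewrite -subr_eq0; apply/eqP; set y := p - q.
have ps := pos_selfadj hp; have qs := pos_selfadj hq.
have ys : selfadj y by exact: selfadjB.
have y2 : pos (y *c y) by exists y.
have cpy : comm p y by apply: commB.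
have cqy : comm q y by apply: commB => //; exact: comm_sym.
have h0 : y *c (p + q) = 0.
  by rewrite /y cmulBl !cmulDr hpq hc opprD addrA addrK subrr.
have p1 : pos (y *c y *c p) by apply: posM => //; apply: comm_sym; exact: commM.
have p2 : pos (y *c y *c q) by apply: posM => //; apply: comm_sym; exact: commM.
have h1 : y *c y *c p + y *c y *c q = 0 by rewrite -cmulDr -cmulA h0 cmul0r.
have h2 := pos_add_eq0 p1 p2 h1.
have h3 : y *c y *c q = 0 by move: h1; rewrite h2 add0r.
by apply: selfadj_cube_eq0 => //; rewrite {3}/y cmulBr h2 h3 subrr.
Qed.

Lemma comm_sub_mul_add p q : comm p q -> p *c p = q *c q -> (q - p) *c (q + p) = 0.
Proof. by move=> hc h; rewrite cmulBl !cmulDr -h hc; lcomb R. Qed.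

(** Here b plays the part of |x|. The element p = b + x satisfies p^2 = 2 b p, so that b p is
    positive; p is then identified with the positive root q of p^2 by showing y = q - p to be 0. *)
Lemma pos_abs_add b x : pos b -> selfadj x -> comm b x -> b *c b = x *c x ->
  pos (b + x).
Proof.
move=> hb xs cbx hbx; set p := b + x.
have bs := pos_selfadj hb.
have ps : selfadj p by exact: selfadjD.
have cbp : comm b p by apply: commD.
have hpp : p *c p = 2%:C *: (b *c p).
  rewrite /p cmulDl !cmulDr -hbx -cbx -[2%:C]/((1 + 1)%:C) rmorphD /= scalerDl !scale1r.
  by rewrite [b *c x + _]addrC.
have pp : pos (p *c p) by exists p.
have [q [hq eq cq]] := pos_sqrt pp.
have qs := pos_selfadj hq.
have cqp : comm p q by apply: cq; rewrite /comm cmulA.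
have cqb : comm b q by apply: cq; exact: commM.
suff -> : p = q by [].
apply/eqP; rewrite eq_sym -subr_eq0; apply/eqP; set y := q - p.
have ys : selfadj y by exact: selfadjB.
have cby : comm b y by apply: commB.
have cpy : comm p y by apply: commB.
have cqy : comm q y by apply: commB => //; exact: comm_sym.
have y2 : pos (y *c y) by exists y.
have h0 : y *c (q + p) = 0.
  exact: comm_sub_mul_add.
have h1 : y *c y *c p = - (y *c y *c q).
  by apply/eqP; rewrite -addr_eq0 addrC -cmulDr -cmulA h0 cmul0r.
have hbp : pos (b *c p).
  have -> : b *c p = (2^-1)%:C *: (p *c p).
    by rewrite hpp scalerA -rmorphM /= mulVf ?scale1r // pnatr_eq0.
  by apply: posZ; rewrite ?invr_ge0.
(* The element y^2 b p is positive because b p is, and its opposite is positive because y^2 p = -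
   y^2 q; hence it vanishes. *)
have h2 : pos (y *c y *c (b *c p)).
  apply: posM => //; apply: comm_sym; apply: commM; apply: comm_sym;
  by apply: commM; apply: comm_sym.
have h3 : pos (- (y *c y *c (b *c p))).
  have -> : - (y *c y *c (b *c p)) = (y *c y *c q) *c b.
    by rewrite cbp cmulA h1 cmulNl opprK.
  apply: posM => //; last first.
    by apply: comm_sym; apply: commM => //; apply: commM.
  by apply: posM => //; apply: comm_sym; apply: commM.
have h4 := pos_antisym h2 h3.
(* Indeed (y q) (y q)^* = y q^2 y = 2 y (b p) y, which is 0 by the previous step. *)
have h5 : y *c q = 0.
  apply: mul_cstar_eq0; rewrite cstarM ys qs.
  rewrite !cmulA -[y *c q *c q]cmulA -eq hpp.
  rewrite cmulZr cmulZl -[y *c _ *c y]cmulA.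
  have -> : (b *c p) *c y = y *c (b *c p).
    by apply: comm_sym; apply: commM; exact: comm_sym.
  by rewrite cmulA h4 scaler0.
have h6 : y *c y *c q = 0 by rewrite -cmulA h5 cmul0r.
apply: selfadj_cube_eq0 => //.
by rewrite {3}/y cmulBr h1 h6 oppr0 subrr.
Qed.

Lemma selfadj_abs x : selfadj x ->
  exists b, [/\ pos b, b *c b = x *c x, pos (b + x), pos (b - x) &
    forall z, comm z x -> comm z b].
Proof.
move=> xs; have p2 : pos (x *c x) by exists x.
have [b [hb eb cb]] := pos_sqrt p2.
have cbx : comm b x by apply: comm_sym; apply: cb; exact: commM.
exists b; split => //.
- exact: pos_abs_add.
- apply: pos_abs_add => //; [exact: selfadjN|exact: commN|].
  by rewrite cmulNl cmulNr opprK.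
- by move=> z hz; apply: cb; exact: commM.
Qed.

Lemma selfadj_parts x : selfadj x ->
  exists p n, [/\ pos p, pos n, x = p - n, p *c n = 0 & n *c p = 0].
Proof.
move=> xs; have [b [hb hbx h1 h2 cb]] := selfadj_abs xs.
have cbx : comm x b by exact: cb.
exists ((2^-1)%:C *: (b + x)), ((2^-1)%:C *: (b - x)); split.
- by apply: posZ; rewrite ?invr_ge0.
- by apply: posZ; rewrite ?invr_ge0.
- by rewrite -{1}[x]scale1r -(half_half_complex R); lcomb R.
- rewrite cmulZl cmulZr cmulDl !cmulBr hbx cbx.
  by rewrite addrA subrK subrr !scaler0.
- rewrite cmulZl cmulZr cmulBl !cmulDr hbx cbx.
  by rewrite [x *c x + _]addrC subrr !scaler0.
Qed.

Lemma star_mul_add y : cstar y *c y + y *c cstar y =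
  2%:C *: (hpart y *c hpart y + apart y *c apart y).
Proof.
move: (hpart_selfadj y) (apart_selfadj y) (cartesian y).
move: (hpart y) (apart y) => h k; rewrite /selfadj => hs ks ->.
rewrite cstarD cstarZ hs ks conji.
rewrite !cmulDl !cmulDr !cmulZl !cmulZr !scalerA mulNr mulrN mulii opprK.
rewrite -[2%:C]/((1 + 1)%:C) rmorphD /=; lcomb R.
Qed.

(* Kaplansky: [g = y y^*] is then positive as well, and of norm [s = |y|^2], so
   [|s - g| <= s], while [y^* (s - g)^2 y = - m (s + m)^2] has norm at least
   [2 s^3]. *)
Lemma pos_opp_star_mul y m : pos m -> cstar y *c y = - m -> m = 0.
Proof.
move=> mp hm.
pose g := y *c cstar y.
have gp : pos g.
  have -> : g = 2%:C *: (hpart y *c hpart y + apart y *c apart y) + m.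
    by rewrite -star_mul_add addrC addrA hm subrr add0r.
  apply: posD => //; apply: posZ => //; apply: posD.
    by exists (hpart y) => //; exact: hpart_selfadj.
  by exists (apart y) => //; exact: apart_selfadj.
pose s := nm y ^+ 2.
have s0 : 0 <= s by exact: sqr_ge0.
have gn : nm g = s by rewrite /g nm_sqr.
have mn : nm m = s by rewrite -nmN -hm nm_sq.
pose d := s%:C *: e - g.
have dn : nm d <= s by apply: pos_nm_sub => //; rewrite gn.
have gy k : cstar y *c (g *c k) = - (m *c (cstar y *c k)).
  by rewrite /g !cmulA hm !cmulNl.
have hd k : cstar y *c (d *c k) = s%:C *: (cstar y *c k) + m *c (cstar y *c k).
  by rewrite /d cmulBl cmulBr cmulZl cmul1l cmulZr gy opprK.
have eqd : cstar y *c (d *c (d *c y)) =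
   - ((2 * s)%:C *: (m *c m) + (s%:C *: (s%:C *: m) + m *c m *c m)).
  rewrite !hd hm (real_complexM 2 s) complex2; calg R.
have le1 : nm (cstar y *c (d *c (d *c y))) <= s ^+ 3.
  apply: le_trans (nmM _ _) _; rewrite nm_cstar.
  have h1 : nm (d *c (d *c y)) <= s * (s * nm y).
    apply: le_trans (nmM _ _) _; apply: ler_pM => //; try exact: nm_ge0.
    by apply: le_trans (nmM _ _) _; apply: ler_pM => //; exact: nm_ge0.
  apply: le_trans (ler_wpM2l (nm_ge0 _) h1) _.
  by rewrite /s le_eqVlt; apply/orP; left; apply/eqP; ring.
have ms := pos_selfadj mp.
have m2 : pos (m *c m) by exists m.
have m3 : pos (m *c m *c m).
  by apply: posM => //; apply: comm_sym; apply: commM.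
have le2 : (2 * s) * s ^+ 2 <= nm (cstar y *c (d *c (d *c y))).
  rewrite eqd nmN; apply: le_trans (_ : nm ((2 * s)%:C *: (m *c m)) <= _).
    by rewrite nmZr nm_selfadj_sq // mn ger0_norm // mulr_ge0.
  apply: nm_pos_mono.
  - by apply: posZ => //; rewrite mulr_ge0.
  - by apply: posD => //; apply: posZ => //; exact: posZ.
  - apply: comm_sym; apply: commZ; apply: comm_sym.
    apply: commD; first by apply: commZ; apply: commZ; apply: comm_sym; exact: commM.
    by apply: commM; [exact: comm_refl|apply: comm_sym; exact: commM].
have s3 : s ^+ 3 <= 0 by have := le_trans le2 le1; rewrite !exprS expr0; nra.
apply: nm0_eq0; rewrite mn; apply/eqP.
have := expf_eq0 s 3; rewrite /= => <-; by rewrite eq_le s3 exprn_ge0.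
Qed.

(** Let n be the negative part of x^* x. Then (x n)^* (x n) = - n^3, and [pos_opp_star_mul] forces
    n^3 = 0. *)
Lemma pos_star_mul x : pos (cstar x *c x).
Proof.
have [p [n [hp hn ex pn np]]] := selfadj_parts (selfadj_sq x).
have ns := pos_selfadj hn.
have h : cstar (x *c n) *c (x *c n) = - (n *c n *c n).
  by rewrite cstarM ns cmulA -[n *c cstar x *c x]cmulA ex cmulBr np sub0r cmulNl.
have mp : pos (n *c n *c n).
  by apply: posM => //; [exists n|apply: comm_sym; apply: commM].
have n0 : n = 0 by apply: selfadj_cube_eq0 => //; exact: pos_opp_star_mul h.
by rewrite ex n0 subr0.
Qed.

Lemma pos_conj a x : pos a -> pos (cstar x *c a *c x).
Proof.
move=> [b hb ->]; rewrite cmulA -[_ *c b *c x]cmulA -[X in X *c _](_ : cstar (b *c x) = _).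
  exact: pos_star_mul.
by rewrite cstarM hb.
Qed.

Lemma star_mul_le x : pos ((nm x ^+ 2)%:C *: e - cstar x *c x).
Proof. by apply: selfadj_le_nm; [exact: selfadj_sq|rewrite nm_sq]. Qed.

End Positivity.

Lemma comm_sqM (R : realType) (A : cstarAlgType R) (x y : A) :
  comm x y -> (x *c y) *c (x *c y) = (x *c x) *c (y *c y).
Proof. by move=> h; rewrite cmulA -[x *c y *c x]cmulA -h !cmulA. Qed.

(** * Star-homomorphisms *)

Section StarHom.
Variables (R : realType) (A B : cstarAlgType R) (f : A -> B).
Hypothesis hf : star_hom f.

Lemma hom_linear : linear f. Proof. by case: hf. Qed.
Lemma homM x y : f (x *c y) = f x *c f y. Proof. by case: hf => _ /(_ x y). Qed.
Lemma hom_star x : f (cstar x) = cstar (f x). Proof. by case: hf => _ _ /(_ x). Qed.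
Lemma homD x y : f (x + y) = f x + f y. Proof. exact: linD hom_linear _ _. Qed.
Lemma homB x y : f (x - y) = f x - f y. Proof. exact: linB hom_linear _ _. Qed.
Lemma homN x : f (- x) = - f x. Proof. exact: linN hom_linear _. Qed.
Lemma homZ k x : f (k *: x) = k *: f x. Proof. exact: linZ hom_linear _ _. Qed.
Lemma hom0 : f 0 = 0. Proof. exact: lin0 hom_linear. Qed.
Lemma hom_sum I (r : seq I) (P : pred I) (F : I -> A) :
  f (\sum_(i <- r | P i) F i) = \sum_(i <- r | P i) f (F i).
Proof. exact: (lin_sum hom_linear). Qed.

Lemma hom_selfadj x : selfadj x -> selfadj (f x).
Proof. by rewrite /selfadj -hom_star => ->. Qed.

Lemma hom_pos x : pos x -> pos (f x).
Proof. by move=> [b hb ->]; exists (f b); rewrite ?homM //; exact: hom_selfadj. Qed.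

Lemma hom_comm x y : comm x y -> comm (f x) (f y).
Proof. by rewrite /comm -!homM => ->. Qed.

Lemma hom_inj : (forall x, f x = 0 -> x = 0) -> injective f.
Proof.
move=> h x y hxy; apply/eqP; rewrite -subr_eq0; apply/eqP/h.
by rewrite homB hxy subrr.
Qed.

End StarHom.

Section UnitalHom.
Variables (R : realType) (A B : cstarAlgType R) (f : A -> B) (e : A).
Hypotheses (hf : star_hom f) (e1 : is_one e) (fe1 : is_one (f e)).

(** A homomorphism preserves the positivity of |x|^2 - x^* x. *)
Lemma nm_hom x : nm (f x) <= nm x.
Proof.
have h := hom_pos hf (star_mul_le e1 x).
rewrite -(ler_pXn2r (ltn0Sn 1)) ?nnegrE ?nm_ge0 // -nm_sq -(hom_star hf) -(homM hf).
apply: (nm_le_of_pos fe1); first exact: sqr_ge0.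
  by apply: (hom_pos hf); exact: pos_star_mul e1 _.
by rewrite -(homZ hf) -(homB hf).
Qed.

Lemma hom_tendsto u l : tendsto u l -> tendsto (f \o u) (f l).
Proof.
by apply: (@tendsto_lip _ _ _ _ 1) => x y; rewrite -(homB hf) mul1r nm_hom.
Qed.

(* [a' = (|a + r| - |a - r|) / 2] truncates a at height r. *)
Lemma clip_lift a (r : R) : selfadj a -> nm (f a) <= r ->
  exists a', [/\ selfadj a', f a' = f a & nm a' <= r].
Proof.
move=> ha hr; have r0 := le_trans (nm_ge0 _) hr.
have re : selfadj (r%:C *: e) by apply: selfadjZ; exact: selfadj_one.
have [b [hb bb _ _ cb]] := selfadj_abs e1 (selfadjD ha re).
have [c [hc cc _ _ cc']] := selfadj_abs e1 (selfadjB ha re).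
have ae : comm a (r%:C *: e) by apply: commZ; exact: comm_one.
have ab : comm a b by apply: cb; apply: commD.
have ac : comm a c by apply: cc'; apply: commB.
have bc : comm b c.
  apply: cc'; apply: commB; first exact: comm_sym.
  by apply: commZ; exact: comm_one.
pose y := (2^-1)%:C *: (b - c).
have ys : selfadj y by apply: selfadjZ; apply: selfadjB; exact: pos_selfadj.
have fas := hom_selfadj hf ha.
(* As |f a| <= r, both r + f a and r - f a are positive, so by uniqueness of positive roots they are
   the images of b = |a + r| and c = |a - r|. *)
have fbE : f b = f a + r%:C *: f e.
  rewrite -(homZ hf) -(homD hf); apply: (pos_sqrt_unique fe1).
  - exact: hom_pos.
  - rewrite (homD hf) (homZ hf) addrC -[f a]opprK -(homN hf).
    apply: (selfadj_le_nm fe1); last by rewrite (homN hf) nmN.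
    by rewrite (homN hf); exact: selfadjN.
  - apply: (hom_comm hf); apply: commD; first exact: comm_sym.
    by apply: commZ; exact: comm_one.
  - by rewrite -!(homM hf) bb.
have fcE : f c = r%:C *: f e - f a.
  rewrite -(homZ hf) -(homB hf); apply: (pos_sqrt_unique fe1).
  - exact: hom_pos.
  - by rewrite (homB hf) (homZ hf); exact: (selfadj_le_nm fe1).
  - apply: (hom_comm hf); apply: commB; last exact: comm_sym.
    by apply: commZ; exact: comm_one.
  - by rewrite -!(homM hf) cc -[in RHS]opprB cmulNl cmulNr opprK.
exists y; split => //.
  rewrite (homZ hf) (homB hf) fbE fcE -[f a in RHS]scale1r -(half_half_complex R).
  lcomb R.
rewrite -(ler_pXn2r (ltn0Sn 1)) ?nnegrE ?nm_ge0 // -nm_selfadj_sq //.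
apply: (nm_le_of_pos e1); first exact: sqr_ge0.
  by exists y.
(* With d = |a + r| |a - r| one finds r^2 - y^2 = (d + x) / 2, and d^2 = x^2, so that [pos_abs_add]
   applies. *)
pose d := b *c c; pose x := (r ^+ 2)%:C *: e - a *c a.
have dp : pos d by exact: posM e1 _ _ _ _ _.
have xs : selfadj x.
  apply: selfadjB; last exact: selfadjM.
  by apply: selfadjZ; exact: selfadj_one.
have ad : comm a d by exact: commM.
have dx : comm d x.
  apply: commB; first by apply: commZ; exact: comm_one.
  by apply: commM; exact: comm_sym.
have h1 : x = - ((a + r%:C *: e) *c (a - r%:C *: e)).
  rewrite /x.
  rewrite cmulDl !cmulBr !cmulZl !cmulZr (cmul1l e1) (cmul1r e1) (cmul1l e1).
  rewrite expr2 real_complexM; lcomb R.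
have h2 : comm (a + r%:C *: e) (a - r%:C *: e).
  by apply: comm_sym; apply: commD; apply: comm_sym; apply: commB => //;
    exact: comm_sym.
have dd : d *c d = x *c x.
  by rewrite h1 cmulNl cmulNr opprK /d (comm_sqM bc) (comm_sqM h2) bb cc.
have := pos_abs_add e1 dp xs dx dd => /(@posZ _ _ 2^-1 _ _).
rewrite invr_ge0 => /(_ (ler0n _ _)); congr pos.
rewrite /y cmulZl cmulZr cmulBl !cmulBr bb cc -bc.
rewrite /d /x !cmulDl !cmulDr !cmulNl !cmulNr !cmulZl !cmulZr !(cmul1l e1) !(cmul1r e1).
by rewrite expr2 real_complexM half_complex; lcomb R.
Qed.

(** The real and imaginary parts are truncated separately, which costs the factor 2. *)
Lemma hom_lift b : exists a, f a = f b /\ nm a <= 2 * nm (f b).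
Proof.
have fh : f (hpart b) = hpart (f b).
  by rewrite /hpart (homZ hf) (homD hf) (hom_star hf).
have fa : f (apart b) = apart (f b).
  by rewrite /apart (homZ hf) (homB hf) (hom_star hf).
have h1 : nm (f (hpart b)) <= nm (f b) by rewrite fh nm_hpart.
have h2 : nm (f (apart b)) <= nm (f b) by rewrite fa nm_apart.
have [h [_ fh' nh]] := clip_lift (hpart_selfadj b) h1.
have [k [_ fk' nk]] := clip_lift (apart_selfadj b) h2.
exists (h + 'i *: k); split.
  by rewrite (homD hf) (homZ hf) fh' fk' -(homZ hf) -(homD hf) -cartesian.
apply: le_trans (nmD _ _) _; rewrite nmZ cabs_i mul1r.
by apply: le_trans (lerD nh nk) _; lra.
Qed.

(** Choose points of the range approaching b at rate 2^-n, lift their increments with control of the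
    norm by [hom_lift], and sum the lifts. *)
Lemma hom_closed_range b :
  (forall d : R, 0 < d -> exists a, nm (b - f a) < d) -> exists a, f a = b.
Proof.
move=> hb.
have p2 n : 0 < (2^-1 : R) ^+ n by rewrite exprn_gt0 ?invr_gt0.
pose u n := projT1 (cid (hb _ (p2 n))).
have hu n : nm (b - f (u n)) < 2^-1 ^+ n by exact: (projT2 (cid (hb _ (p2 n)))).
pose g n := projT1 (cid (hom_lift (u n.+1 - u n))).
have [fg ng] : (forall n, f (g n) = f (u n.+1 - u n)) /\
    (forall n, nm (g n) <= 2 * nm (f (u n.+1 - u n))).
  by split=> n; case: (projT2 (cid (hom_lift (u n.+1 - u n)))).
pose s := fix s n := if n is m.+1 then s m + g m else u 0%N.
have fs n : f (s n) = f (u n).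
  by elim: n => [//|n ih] /=; rewrite (homD hf) ih fg -(homD hf) addrC subrK.
have cs : cauchy_nm s.
  (* One factor 2 comes from [hom_lift], the other from comparing two successive approximations of
     b. *)
  apply: (@geometric_cauchy _ _ _ 4) => n /=; rewrite addrAC subrr add0r.
  apply: le_trans (ng n) _.
  have : nm (f (u n.+1 - u n)) <= 2 * 2^-1 ^+ n.
    rewrite (homB hf); apply: le_trans (nm_dist b _ _) _; rewrite (nmBC _ b).
    have h1 := hu n.+1; have h2 := hu n.
    have h3 : (2^-1 : R) ^+ n.+1 <= 2^-1 ^+ n.
      by rewrite exprS ger_pMl // invf_le1 // ler1n.
    by lra.
  by lra.
have [l hl] := cauchy_nm_tendsto cs.
exists l; apply: (@tendsto_unique _ _ (f \o s)); first exact: hom_tendsto.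
move=> d d0; have [N hN] : exists N, (2^-1 : R) ^+ N < d.
  exists (Num.truncn d^-1).+1.
  rewrite exprVn -[ltRHS]invrK ltf_pV2 ?posrE ?invr_gt0 ?exprn_gt0 //.
  apply: lt_le_trans (truncnS_gt _) _.
  by rewrite -natrX ler_nat ltnW // ltn_expl.
exists N => n hn; rewrite /= fs nmBC; apply: lt_trans (hu n) _.
by apply: le_lt_trans hN; rewrite ler_wiXn2l // ?invr_ge0 // invf_le1 // ler1n.
Qed.

Hypothesis finj : injective f.

(** Truncating a selfadjoint a at height |f a| does not change its image, so by injectivity it does
    not change a. *)
Lemma nm_hom_inj x : nm (f x) = nm x.
Proof.
have hs a : selfadj a -> nm a <= nm (f a).
  by move=> ha; have [a' [_ /finj -> //]] := clip_lift ha (lexx _).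
apply/eqP; rewrite eq_le nm_hom /= -(ler_pXn2r (ltn0Sn 1)) ?nnegrE ?nm_ge0 //.
rewrite -!nm_sq -(hom_star hf) -(homM hf); apply: hs; exact: selfadj_sq.
Qed.

(** If n is the negative part of a, then f(n) f(a) f(n) = - f(n^3) is positive, and so is f(n^3);
    hence f(n^3) = 0 and n = 0. *)
Lemma hom_inj_pos a : selfadj a -> pos (f a) -> pos a.
Proof.
move=> ha hfa; have [p [n [hp hn ea pn np]]] := selfadj_parts e1 ha.
have ns := pos_selfadj hn.
have h3 : pos (n *c n *c n).
  by apply: (posM e1) => //; [exists n|apply: comm_sym; exact: commM].
have := pos_conj fe1 (f n) hfa.
rewrite -(hom_star hf) -!(homM hf) ns ea cmulBr np sub0r cmulNl (homN hf).
move=> /(pos_antisym fe1 (hom_pos hf h3)); rewrite -(hom0 hf) => /finj h0.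
by rewrite (selfadj_cube_eq0 ns h0) subr0 .
Qed.

End UnitalHom.

Lemma lt_quarters (R : realFieldType) (x y z r : R) :
  x < r / 4 -> y < r / 4 -> z < r / 4 -> 0 < r -> x + (y + z) < r.
Proof. by move=> *; lra. Qed.

Lemma seq_lim_le (R : realType) (f g : nat -> R) (a b : R) :
  f @ \oo --> a -> g @ \oo --> b -> (forall n, f n <= g n) -> a <= b.
Proof. by move=> fa gb fg; apply: (ler_cvg_to fa gb); exact: nearW. Qed.

(** * Completion of a C*-seminorm *)

Section SequentialCompleteness.
Variables (R : realType) (V : normedModType R[i]).

(** Completeness is required for Cauchy filters. Points near the sets of radius 2^-n in the filter
    form a Cauchy sequence, and its limit is the limit of the filter. *)
Lemma seq_complete :
  (forall u : nat -> V, cauchy_nm u -> exists l, tendsto u l) ->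
  forall F : set_system V, ProperFilter F -> cauchy F -> cvg F.
Proof.
move=> sc F FF /cauchyP cF.
have p2 n : 0 < (2^-1 : R) ^+ n by rewrite exprn_gt0 ?invr_gt0.
have p2c n : (0 : R[i]) < ((2^-1 : R) ^+ n)%:C by rewrite ltcR.
have /choice[u hu] : forall n, exists x, F [set y | nm (x - y) < 2^-1 ^+ n].
  move=> n; have [x hx] := cF _ (p2c n); exists x; apply: filterS hx => y.
  by rewrite -ball_normE /ball_ /= nmE ltcR.
have small (d : R) : 0 < d -> exists N, (2^-1 : R) ^+ N < d.
  move=> d0; exists (Num.truncn d^-1).+1.
  rewrite exprVn -[ltRHS]invrK ltf_pV2 ?posrE ?invr_gt0 ?exprn_gt0 //.
  apply: lt_le_trans (truncnS_gt _) _.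
  by rewrite -natrX ler_nat ltnW // ltn_expl.
have mono m n : (n <= m)%N -> (2^-1 : R) ^+ m <= 2^-1 ^+ n.
  by move=> h; rewrite ler_wiXn2l // ?invr_ge0 // invf_le1 // ler1n.
have [l hl] : exists l, tendsto u l.
  apply: sc => d d0; have [N hN] := small _ (divr_gt0 d0 (ltr0n R 2)).
  exists N => m n hm hn.
  have [x [/= h1 h2]] := @filter_ex _ _ _ _ (filterI (hu m) (hu n)).
  apply: le_lt_trans (nm_dist x _ _) _; rewrite (nmBC x).
  have := mono _ _ hm; have := mono _ _ hn; lra.
apply/cvg_ex; exists l => S /nbhs_ballP[d /= d0 hS].
move: (d0); rewrite ltcE /= => /andP[/eqP di dr].
have [N hN] := small _ (divr_gt0 dr (ltr0n R 2)).
have [N' hN'] := hl _ (divr_gt0 dr (ltr0n R 2)).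
apply: filterS (hu (maxn N N')) => x /= hx; apply: hS.
rewrite -ball_normE /ball_ /= nmE ltcE /= di eqxx /=.
apply: le_lt_trans (nm_dist (u (maxn N N')) _ _) _; rewrite (nmBC l).
have := hN' _ (leq_maxr N N'); have := mono _ _ (leq_maxl N N'); lra.
Qed.

End SequentialCompleteness.

(* A C*-seminorm on a *-algebra carried by a linear subspace [pc_dom] of a vector
   space; the operations are meaningful on [pc_dom] only. *)
Record preCstar (R : realType) := PreCstar {
  pc_space : lmodType R[i];
  pc_dom : set pc_space;
  pc_mul : pc_space -> pc_space -> pc_space;
  pc_star : pc_space -> pc_space;
  pc_nm : pc_space -> R;
  pc_dom0 : pc_dom 0;
  pc_domL : forall k x y, pc_dom x -> pc_dom y -> pc_dom (k *: x + y);
  pc_domM : forall x y, pc_dom x -> pc_dom y -> pc_dom (pc_mul x y);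
  pc_dom_star : forall x, pc_dom x -> pc_dom (pc_star x);
  pc_mulA : forall x y z, pc_dom x -> pc_dom y -> pc_dom z ->
    pc_mul x (pc_mul y z) = pc_mul (pc_mul x y) z;
  pc_mulLl : forall k x y z, pc_dom x -> pc_dom y -> pc_dom z ->
    pc_mul (k *: x + y) z = k *: pc_mul x z + pc_mul y z;
  pc_mulLr : forall k x y z, pc_dom x -> pc_dom y -> pc_dom z ->
    pc_mul z (k *: x + y) = k *: pc_mul z x + pc_mul z y;
  pc_starL : forall k x y, pc_dom x -> pc_dom y ->
    pc_star (k *: x + y) = conjc k *: pc_star x + pc_star y;
  pc_starK : forall x, pc_dom x -> pc_star (pc_star x) = x;
  pc_starM : forall x y, pc_dom x -> pc_dom y ->
    pc_star (pc_mul x y) = pc_mul (pc_star y) (pc_star x);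
  pc_nmD : forall x y, pc_dom x -> pc_dom y -> pc_nm (x + y) <= pc_nm x + pc_nm y;
  pc_nmZ : forall k x, pc_dom x -> pc_nm (k *: x) = cabs k * pc_nm x;
  pc_nmM : forall x y, pc_dom x -> pc_dom y -> pc_nm (pc_mul x y) <= pc_nm x * pc_nm y;
  pc_nm_sq : forall x, pc_dom x -> pc_nm (pc_mul (pc_star x) x) = pc_nm x ^+ 2 }.

Section Completion.
Variables (R : realType) (d : preCstar R).
Notation V := (pc_space d).
Notation D := (@pc_dom R d).
Notation "x ** y" := (pc_mul x y) (at level 40, left associativity).
Notation p := (@pc_nm R d).
Notation st := (@pc_star R d).
Implicit Types (u v w : nat -> V).

Let DZ k x : D x -> D (k *: x).
Proof. by move=> h; have := pc_domL k h (pc_dom0 d); rewrite addr0. Qed.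
Let DD x y : D x -> D y -> D (x + y).
Proof. by move=> h h'; have := pc_domL 1 h h'; rewrite scale1r. Qed.
Let DN x : D x -> D (- x). Proof. by move=> h; rewrite -scaleN1r; exact: DZ. Qed.
Let DB x y : D x -> D y -> D (x - y). Proof. by move=> h h'; apply: DD => //; exact: DN. Qed.

Let p0 : p 0 = 0.
Proof. by have := pc_nmZ 0 (pc_dom0 d); rewrite scale0r /cabs normr0 mul0r. Qed.
Let pN x : D x -> p (- x) = p x.
Proof. by move=> h; rewrite -scaleN1r pc_nmZ // /cabs normrN1 mul1r. Qed.
Let p_ge0 x : D x -> 0 <= p x.
Proof.
move=> h; have := pc_nmD h (DN h); rewrite subrr p0 pN // => h2; lra.
Qed.
Let pBC x y : D x -> D y -> p (x - y) = p (y - x).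
Proof. by move=> h h'; rewrite -pN ?opprB //; exact: DB. Qed.
Let p_dist z x y : D x -> D y -> D z -> p (x - y) <= p (x - z) + p (z - y).
Proof.
move=> h h' h2; have := pc_nmD (DB h h2) (DB h2 h'); by rewrite addrA subrK.
Qed.
Let p_star x : D x -> p (st x) = p x.
Proof.
have le_cstar z : D z -> p z <= p (st z).
  move=> Dz; case: (eqVneq (p z) 0) => [->|nz]; first by apply: p_ge0; exact: pc_dom_star.
  have z0 : 0 < p z by rewrite lt_def nz p_ge0.
  by rewrite -(ler_pM2r z0) -expr2 -pc_nm_sq // pc_nmM //; exact: pc_dom_star.
move=> h; apply/eqP; rewrite eq_le le_cstar // andbT -{2}(pc_starK h).
by apply: le_cstar; exact: pc_dom_star.
Qed.

Definition cseq u := (forall n, D (u n)) /\ forall r : R, 0 < r ->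
  exists N, forall m n, (N <= m)%N -> (N <= n)%N -> p (u m - u n) < r.

Definition ceqv u v := forall r : R, 0 < r ->
  exists N, forall n, (N <= n)%N -> p (u n - v n) < r.

Lemma ceqv_refl u : ceqv u u.
Proof. by move=> r r0; exists 0%N => n _; rewrite subrr p0. Qed.

Lemma ceqv_sym u v : cseq u -> cseq v -> ceqv u v -> ceqv v u.
Proof.
move=> [hu _] [hv _] h r /h[N hN]; exists N => n /hN; by rewrite pBC.
Qed.

Lemma ceqv_trans v u w : cseq u -> cseq v -> cseq w -> ceqv u v -> ceqv v w -> ceqv u w.
Proof.
move=> [hu _] [hv _] [hw _] h h' r r0.
have [N hN] := h _ (divr_gt0 r0 (ltr0n R 2)).
have [N' hN'] := h' _ (divr_gt0 r0 (ltr0n R 2)).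
exists (maxn N N') => n; rewrite geq_max => /andP[/hN h1 /hN' h2].
apply: le_lt_trans (p_dist (hu n) (hw n) (hv n)) _; lra.
Qed.

Lemma cseq_dom u (hu : cseq u) n : D (u n). Proof. by case: hu. Qed.

Definition cclass u : set (nat -> V) := [set v | cseq v /\ ceqv u v].

(** A point is an equivalence class taken as a set of sequences, so that equality of points is
    equality of sets. Sequences at seminorm distance 0 are identified, hence a seminorm is
    enough. *)
Record completion : Type := Completion {
  cset :> set (nat -> V); csetP : exists2 u, cseq u & cset = cclass u }.

Definition rep (x : completion) : nat -> V := projT1 (cid2 (csetP x)).
Lemma rep_cseq x : cseq (rep x).
Proof. by rewrite /rep; case: (cid2 _). Qed.
Lemma cset_rep x : cset x = cclass (rep x).
Proof. by rewrite /rep; case: (cid2 _). Qed.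

Definition cls u (hu : cseq u) : completion :=
  Completion (ex_intro2 (fun u => cseq u) (fun v => cclass u = cclass v) u hu erefl).

Lemma completion_eq (x y : completion) : cset x = cset y -> x = y.
Proof.
case: x y => [s hs] [s' hs'] /= e; case: _ / e hs' => hs'.
by rewrite (Prop_irrelevance hs hs').
Qed.

Lemma cls_eq u v (hu : cseq u) (hv : cseq v) : ceqv u v -> cls hu = cls hv.
Proof.
move=> h; apply: completion_eq; apply/seteqP; split => w /= [hw h']; split => //.
  by apply: ceqv_trans h' => //; exact: ceqv_sym.
exact: ceqv_trans h'.
Qed.

Lemma rep_cls u (hu : cseq u) : ceqv (rep (cls hu)) u.
Proof.
have : cset (cls hu) u by split => //; exact: ceqv_refl.
by rewrite cset_rep => -[].
Qed.

Lemma cls_rep x : cls (rep_cseq x) = x.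
Proof. by apply: completion_eq; rewrite [RHS]cset_rep. Qed.

Lemma clsP x : exists u (hu : cseq u), x = cls hu.
Proof. by exists (rep x), (rep_cseq x); rewrite cls_rep. Qed.

Lemma cseq_bounded u : cseq u -> exists2 c : R, 0 < c & forall n, p (u n) <= c.
Proof.
move=> [hu cu]; have [N hN] := cu _ ltr01.
pose c := \sum_(i < N.+1) p (u i) + 1.
have ci i : (i <= N)%N -> p (u i) + 1 <= c.
  move=> hi; rewrite /c lerD2r (bigD1 (Ordinal (hi : i < N.+1)%N)) //=.
  by rewrite lerDl sumr_ge0 // => j _; exact: p_ge0.
exists c.
  by apply: lt_le_trans (ci 0%N _) => //; apply: ltr_wpDl => //; exact: p_ge0.
move=> n; case: (leqP n N) => hn.
  by apply: le_trans (ci n hn); rewrite lerDl.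
apply: le_trans (ci N (leqnn _)).
have := pc_nmD (hu N) (DB (hu n) (hu N)); rewrite addrC subrK => /le_trans; apply.
by rewrite lerD2l ltW // hN // ltnW.
Qed.

Lemma cseqL (k : R[i]) u v : cseq u -> cseq v -> cseq (fun n => k *: u n + v n).
Proof.
move=> [hu cu] [hv cv]; split=> [n|r r0]; first exact: pc_domL.
have c0 : 0 < cabs k + 1 by apply: ltr_wpDl => //; exact: cabs_ge0.
have [N hN] := cu _ (divr_gt0 (divr_gt0 r0 (ltr0n R 2)) c0).
have [N' hN'] := cv _ (divr_gt0 r0 (ltr0n R 2)).
exists (maxn N N') => m n; rewrite !geq_max => /andP[m1 m2] /andP[n1 n2].
rewrite opprD addrACA -scalerBr.
apply: le_lt_trans (pc_nmD (DZ _ (DB (hu _) (hu _))) (DB (hv _) (hv _))) _.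
rewrite pc_nmZ; last exact: DB.
have h1 := hN _ _ m1 n1; have h2 := hN' _ _ m2 n2.
rewrite ltr_pdivlMr // in h1.
have : 0 <= p (u m - u n) by apply: p_ge0; exact: DB.
by move: h1 h2; nra.
Qed.

Lemma cseqM u v : cseq u -> cseq v -> cseq (fun n => u n ** v n).
Proof.
move=> hu0 hv0; have [a a0 ha] := cseq_bounded hu0.
have [b b0 hb] := cseq_bounded hv0; case: hu0 hv0 => [hu cu] [hv cv].
split=> [n|r r0]; first exact: pc_domM.
have [N hN] := cu _ (divr_gt0 (divr_gt0 r0 (ltr0n R 2)) b0).
have [N' hN'] := cv _ (divr_gt0 (divr_gt0 r0 (ltr0n R 2)) a0).
exists (maxn N N') => m n; rewrite !geq_max => /andP[m1 m2] /andP[n1 n2].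
have Duu := DB (hu m) (hu n); have Dvv := DB (hv m) (hv n).
have -> : u m ** v m - u n ** v n = (u m - u n) ** v m + u n ** (v m - v n).
  have h1 := pc_mulLl (-1) (hu n) (hu m) (hv m).
  have h2 := pc_mulLr (-1) (hv n) (hv m) (hu n).
  rewrite !scaleN1r in h1 h2; rewrite [u m - _]addrC [v m - _]addrC h1 h2.
  by lcomb R.
apply: le_lt_trans (pc_nmD (pc_domM Duu (hv m)) (pc_domM (hu n) Dvv)) _.
apply: le_lt_trans (lerD (pc_nmM Duu (hv m)) (pc_nmM (hu n) Dvv)) _.
have h1 := hN _ _ m1 n1; have h2 := hN' _ _ m2 n2.
rewrite ltr_pdivlMr // in h1; rewrite ltr_pdivlMr // in h2.
have : p (u m - u n) * p (v m) <= p (u m - u n) * b.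
  by apply: ler_wpM2l => //; exact: p_ge0.
have : p (u n) * p (v m - v n) <= a * p (v m - v n).
  by apply: ler_wpM2r => //; exact: p_ge0.
by move: h1 h2; rewrite mulrC [_ * a]mulrC; lra.
Qed.

Lemma cseq_star u : cseq u -> cseq (fun n => st (u n)).
Proof.
move=> [hu cu]; split=> [n|r /cu[N hN]]; first exact: pc_dom_star.
exists N => m n hm hn; have := hN _ _ hm hn; rewrite -p_star; last exact: DB.
have := pc_starL (-1) (hu n) (hu m); rewrite scaleN1r [- _ + _]addrC => ->.
by rewrite rmorphN1 scaleN1r addrC.
Qed.

Lemma cseq_cst x : D x -> cseq (fun=> x).
Proof. by move=> h; split=> // r r0; exists 0%N => m n _ _; rewrite subrr p0. Qed.

Lemma ceqvL (k : R[i]) u u' v v' : cseq u -> cseq u' -> cseq v -> cseq v' ->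
  ceqv u u' -> ceqv v v' ->
  ceqv (fun n => k *: u n + v n) (fun n => k *: u' n + v' n).
Proof.
move=> [hu _] [hu' _] [hv _] [hv' _] e1 e2 r r0.
have c0 : 0 < cabs k + 1 by apply: ltr_wpDl => //; exact: cabs_ge0.
have [N hN] := e1 _ (divr_gt0 (divr_gt0 r0 (ltr0n R 2)) c0).
have [N' hN'] := e2 _ (divr_gt0 r0 (ltr0n R 2)).
exists (maxn N N') => n; rewrite !geq_max => /andP[n1 n2].
rewrite opprD addrACA -scalerBr.
apply: le_lt_trans (pc_nmD (DZ _ (DB (hu _) (hu' _))) (DB (hv _) (hv' _))) _.
rewrite pc_nmZ; last exact: DB.
have h1 := hN _ n1; have h2 := hN' _ n2.
rewrite ltr_pdivlMr // in h1.
have : 0 <= p (u n - u' n) by apply: p_ge0; exact: DB.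
by move: h1 h2; nra.
Qed.

Lemma ceqvM u u' v v' : cseq u -> cseq u' -> cseq v -> cseq v' ->
  ceqv u u' -> ceqv v v' -> ceqv (fun n => u n ** v n) (fun n => u' n ** v' n).
Proof.
move=> [hu _] hu0 hv0 [hv' _] e1 e2 r r0.
have [a a0 ha] := cseq_bounded hu0.
have [b b0 hb] := cseq_bounded hv0; case: hu0 hv0 => [hu' _] [hv _].
have [N hN] := e1 _ (divr_gt0 (divr_gt0 r0 (ltr0n R 2)) b0).
have [N' hN'] := e2 _ (divr_gt0 (divr_gt0 r0 (ltr0n R 2)) a0).
exists (maxn N N') => n; rewrite !geq_max => /andP[n1 n2].
have Duu := DB (hu n) (hu' n); have Dvv := DB (hv n) (hv' n).
have -> : u n ** v n - u' n ** v' n = (u n - u' n) ** v n + u' n ** (v n - v' n).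
  have h1 := pc_mulLl (-1) (hu' n) (hu n) (hv n).
  have h2 := pc_mulLr (-1) (hv' n) (hv n) (hu' n).
  rewrite !scaleN1r in h1 h2; rewrite [u n - _]addrC [v n - _]addrC h1 h2.
  by lcomb R.
apply: le_lt_trans (pc_nmD (pc_domM Duu (hv n)) (pc_domM (hu' n) Dvv)) _.
apply: le_lt_trans (lerD (pc_nmM Duu (hv n)) (pc_nmM (hu' n) Dvv)) _.
have h1 := hN _ n1; have h2 := hN' _ n2.
rewrite ltr_pdivlMr // in h1; rewrite ltr_pdivlMr // in h2.
have : p (u n - u' n) * p (v n) <= p (u n - u' n) * b.
  by apply: ler_wpM2l => //; exact: p_ge0.
have : p (u' n) * p (v n - v' n) <= a * p (v n - v' n).
  by apply: ler_wpM2r => //; exact: p_ge0.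
by move: h1 h2; rewrite mulrC [_ * a]mulrC; lra.
Qed.

Lemma ceqv_star u u' : cseq u -> cseq u' -> ceqv u u' ->
  ceqv (fun n => st (u n)) (fun n => st (u' n)).
Proof.
move=> [hu _] [hu' _] e1 r /e1[N hN]; exists N => n /hN.
rewrite -p_star; last exact: DB.
have := pc_starL (-1) (hu' n) (hu n); rewrite scaleN1r [- _ + _]addrC => ->.
by rewrite rmorphN1 scaleN1r addrC.
Qed.

Lemma cseqD u v : cseq u -> cseq v -> cseq (fun n => u n + v n).
Proof.
move=> hu hv; have := cseqL 1 hu hv; congr cseq.
by apply/funext => n; rewrite scale1r.
Qed.

Lemma cseqZ k u : cseq u -> cseq (fun n => k *: u n).
Proof.
move=> hu; have := cseqL k hu (cseq_cst (pc_dom0 d)); congr cseq.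
by apply/funext => n; rewrite addr0.
Qed.

Definition c0 := cls (cseq_cst (pc_dom0 d)).
Definition cadd x y := cls (cseqD (rep_cseq x) (rep_cseq y)).
Definition cscale k x := cls (cseqZ k (rep_cseq x)).
Definition copp x := cscale (-1) x.
Definition ccmul x y := cls (cseqM (rep_cseq x) (rep_cseq y)).
Definition ccstar x := cls (cseq_star (rep_cseq x)).

Lemma cls_ext u v (hu : cseq u) (hv : cseq v) : u =1 v -> cls hu = cls hv.
Proof. by move=> h; apply: cls_eq; rewrite (funext h); exact: ceqv_refl. Qed.

Lemma cadd_cls u v (hu : cseq u) (hv : cseq v) :
  cadd (cls hu) (cls hv) = cls (cseqD hu hv).
Proof.
apply: cls_eq; have := ceqvL 1 (rep_cseq (cls hu)) hu (rep_cseq (cls hv)) hv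
  (rep_cls hu) (rep_cls hv).
by congr ceqv; apply/funext => n; rewrite scale1r.
Qed.

Lemma cscale_cls k u (hu : cseq u) : cscale k (cls hu) = cls (cseqZ k hu).
Proof.
have h0 := cseq_cst (pc_dom0 d).
apply: cls_eq; have := ceqvL k (rep_cseq (cls hu)) hu h0 h0
  (rep_cls hu) (ceqv_refl _).
by congr ceqv; apply/funext => n; rewrite addr0.
Qed.

Lemma ccmul_cls u v (hu : cseq u) (hv : cseq v) :
  ccmul (cls hu) (cls hv) = cls (cseqM hu hv).
Proof. by apply: cls_eq; apply: ceqvM => //; try exact: rep_cseq; exact: rep_cls. Qed.

Lemma ccstar_cls u (hu : cseq u) : ccstar (cls hu) = cls (cseq_star hu).
Proof. by apply: cls_eq; apply: ceqv_star => //; try exact: rep_cseq; exact: rep_cls. Qed.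

HB.instance Definition _ := gen_eqMixin completion.
HB.instance Definition _ := gen_choiceMixin completion.

Lemma caddA : associative cadd.
Proof.
move=> x y z; have [u [hu ->]] := clsP x; have [v [hv ->]] := clsP y.
have [w [hw ->]] := clsP z; rewrite !cadd_cls; apply: cls_ext => n; exact: addrA.
Qed.
Lemma caddC : commutative cadd.
Proof.
move=> x y; have [u [hu ->]] := clsP x; have [v [hv ->]] := clsP y.
by rewrite !cadd_cls; apply: cls_ext => n; exact: addrC.
Qed.
Lemma cadd0 : left_id c0 cadd.
Proof.
move=> x; have [u [hu ->]] := clsP x.
by rewrite !cadd_cls; apply: cls_ext => n; exact: add0r.
Qed.
Lemma caddN : left_inverse c0 copp cadd.
Proof.
move=> x; have [u [hu ->]] := clsP x.
by rewrite /copp cscale_cls cadd_cls; apply: cls_ext => n; rewrite scaleN1r addNr.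
Qed.
HB.instance Definition _ := GRing.isZmodule.Build completion caddA caddC cadd0 caddN.

Lemma cscaleA a b x : cscale a (cscale b x) = cscale (a * b) x.
Proof.
have [u [hu ->]] := clsP x.
by rewrite !cscale_cls; apply: cls_ext => n; exact: scalerA.
Qed.
Lemma cscale1 : left_id 1 cscale.
Proof.
move=> x; have [u [hu ->]] := clsP x.
by rewrite !cscale_cls; apply: cls_ext => n; exact: scale1r.
Qed.
Lemma cscaleDr : right_distributive cscale +%R.
Proof.
move=> k x y; have [u [hu ->]] := clsP x; have [v [hv ->]] := clsP y.
rewrite -[LHS]/(cscale k (cadd _ _)) -[RHS]/(cadd (cscale _ _) (cscale _ _)).
by rewrite !(cadd_cls, cscale_cls); apply: cls_ext => n; exact: scalerDr.
Qed.
Lemma cscaleDl x : {morph cscale^~ x : a b / a + b}.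
Proof.
move=> a b; have [u [hu ->]] := clsP x.
rewrite -[RHS]/(cadd (cscale _ _) (cscale _ _)).
by rewrite !(cadd_cls, cscale_cls); apply: cls_ext => n; exact: scalerDl.
Qed.
HB.instance Definition _ := GRing.Zmodule_isLmodule.Build R[i] completion
  cscaleA cscale1 cscaleDr cscaleDl.

Lemma addE u v (hu : cseq u) (hv : cseq v) : cls hu + cls hv = cls (cseqD hu hv).
Proof. exact: cadd_cls. Qed.
Lemma scaleE k u (hu : cseq u) : k *: cls hu = cls (cseqZ k hu).
Proof. exact: cscale_cls. Qed.

Lemma plim u v : cseq u -> cseq v -> ceqv u v ->
  exists r : R, (fun n => p (u n)) @ \oo --> r /\ (fun n => p (v n)) @ \oo --> r.
Proof.
move=> [hu cu] [hv cv] huv.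
have pd x y : D x -> D y -> `|p x - p y| <= p (x - y).
  move=> Dx Dy; rewrite ler_norml; apply/andP; split.
    rewrite lerNl opprB lerBlDr pBC //.
    by have := pc_nmD (DB Dy Dx) Dx; rewrite subrK.
  by rewrite lerBlDr; have := pc_nmD (DB Dx Dy) Dy; rewrite subrK.
have /cvg_ex[r hr] : cvg ((fun n => p (u n)) @ \oo).
  apply: cauchy_cvg; apply/cauchy_ballP => e e0; rewrite near_simpl.
  have [N hN] := cu _ e0.
  exists ([set n | N <= n]%N, [set n | N <= n]%N) => /=; first by split; exists N.
  move=> [m n] /= [hm hn]; rewrite -ball_normE /ball_ /=.
  exact: le_lt_trans (pd _ _ (hu m) (hu n)) (hN _ _ hm hn).
exists r; split => //; apply/cvgrPdist_lt => e e0.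
move/cvgrPdist_lt : hr => /(_ _ (divr_gt0 e0 (ltr0n R 2)))[N _ hN].
have [N' hN'] := huv _ (divr_gt0 e0 (ltr0n R 2)).
exists (maxn N N') => // n /=; rewrite geq_max => /andP[/hN /= h1 /hN' h2].
have h3 := pd _ _ (hu n) (hv n).
apply: le_lt_trans (ler_distD (p (u n)) _ _) _; lra.
Qed.

Definition cnm x : R := lim ((fun n => p (rep x n)) @ \oo).

Lemma cnm_cls u (hu : cseq u) : (fun n => p (u n)) @ \oo --> cnm (cls hu).
Proof.
have [r [h1 h2]] := plim (rep_cseq (cls hu)) hu (rep_cls hu).
by rewrite /cnm (cvg_lim _ h1).
Qed.

Arguments cnm_cls {u} hu.

Lemma cnm_le u (hu : cseq u) (c : R) : (forall n, p (u n) <= c) -> cnm (cls hu) <= c.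
Proof.
have hc : (fun _ : nat => c) @ \oo --> c by exact: cvg_cst.
by move=> h; exact: (seq_lim_le (cnm_cls hu) hc h).
Qed.

Lemma cnmD x y : cnm (x + y) <= cnm x + cnm y.
Proof.
have [u [hu ->]] := clsP x; have [v [hv ->]] := clsP y; rewrite addE.
apply: (seq_lim_le (cnm_cls (cseqD hu hv)) (cvgD (cnm_cls hu) (cnm_cls hv))) => n.
by apply: pc_nmD; [exact: (cseq_dom hu)|exact: (cseq_dom hv)].
Qed.

Lemma cnmZ k x : cnm (k *: x) = cabs k * cnm x.
Proof.
have [u [hu ->]] := clsP x; rewrite scaleE.
have h1 := cnm_cls (cseqZ k hu).
have h2 : (fun n => cabs k * p (u n)) @ \oo --> cabs k * cnm (cls hu).
  by apply: cvgMr; exact: cnm_cls.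
have h n : p (k *: u n) = cabs k * p (u n) by apply: pc_nmZ; exact: (cseq_dom hu).
by apply/eqP; rewrite eq_le (seq_lim_le h1 h2) ?(seq_lim_le h2 h1) // => n; rewrite h.
Qed.

Lemma cnm_eq0 x : cnm x = 0 -> x = 0.
Proof.
have [u [hu ->]] := clsP x => h; apply: cls_eq => r r0.
have := cnm_cls hu; rewrite h => /cvgrPdist_lt/(_ _ r0)[N _ hN].
exists N => n /hN /=; rewrite sub0r normrN subr0.
by apply: le_lt_trans; exact: ler_norm.
Qed.

Lemma cnorm_triangle x y : (cnm (x + y))%:C <= (cnm x)%:C + (cnm y)%:C.
Proof. by rewrite -real_complexD lecR cnmD. Qed.
Lemma cnorm_scale (k : R[i]) x : (cnm (k *: x))%:C = `|k| * (cnm x)%:C.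
Proof. by rewrite cnmZ real_complexM cabsE. Qed.
Lemma cnorm_eq0 x : (cnm x)%:C = 0 :> R[i] -> x = 0.
Proof. by move=> h; apply: cnm_eq0; exact: (@complexI R). Qed.
HB.instance Definition _ := Lmodule_isNormed.Build R[i] completion
  cnorm_triangle cnorm_scale cnorm_eq0.

Lemma nm_completion x : nm x = cnm x. Proof. by []. Qed.

(** Outside [pc_dom] the value 0 only serves to make the map total. *)
Definition cinj a : completion :=
  if pselect (D a) is left h then cls (cseq_cst h) else 0.

Lemma cinjE a (h : D a) : cinj a = cls (cseq_cst h).
Proof. by rewrite /cinj; case: pselect => // h'; apply: cls_ext. Qed.

Lemma nm_cinj a : D a -> nm (cinj a) = p a.
Proof.
move=> h; rewrite cinjE nm_completion.
have h1 := cnm_cls (cseq_cst h).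
have h2 : (fun _ : nat => p a) @ \oo --> p a by exact: cvg_cst.
by apply/eqP; rewrite eq_le (seq_lim_le h1 h2) // (seq_lim_le h2 h1).
Qed.

Lemma cinjL k a b : D a -> D b -> cinj (k *: a + b) = k *: cinj a + cinj b.
Proof.
move=> ha hb; rewrite (cinjE (pc_domL k ha hb)) (cinjE ha) (cinjE hb) scaleE addE.
exact: cls_ext.
Qed.

Lemma cinjB a b : D a -> D b -> cinj (a - b) = cinj a - cinj b.
Proof.
by move=> ha hb; rewrite addrC -scaleN1r cinjL // scaleN1r addrC.
Qed.

Lemma cinj_rep x : tendsto (fun n => cinj (rep x n)) x.
Proof.
move=> r r0; have [hu cu] := rep_cseq x.
have r2 := divr_gt0 r0 (ltr0n R 2).
have [N hN] := cu _ r2; exists N => n hn.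
rewrite -[x in _ - x]cls_rep (cinjE (hu n)) -scaleN1r scaleE addE nm_completion.
apply: le_lt_trans (_ : r / 2 < r); last by lra.
have h := cseqD (cseq_cst (hu n)) (cseqZ (-1) (rep_cseq x)).
(* The first N terms of the difference sequence are replaced by 0. This does not change the class,
   and makes the bound hold from the first term on, as [cnm_le] demands. *)
pose v m := if (m < N)%N then rep x N - rep x N else rep x n - rep x m.
have Dv m : D (v m) by rewrite /v; case: ifP => _; exact: DB.
have cv : cseq v.
  split => // s /cu[M hM]; exists (maxn N M) => i j; rewrite !geq_max.
  move=> /andP[i1 i2] /andP[j1 j2]; rewrite /v !ltnNge i1 j1 /=.
  by rewrite opprD opprK addrACA subrr add0r addrC; exact: hM.
have -> : cls (cseqD (cseq_cst (hu n)) (cseqZ (-1) (rep_cseq x))) = cls cv.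
  apply: cls_eq => s s0; exists N => m hm; rewrite /v ltnNge hm /= scaleN1r.
  by rewrite subrr p0.
apply: cnm_le => m; rewrite /v; case: ltnP => hm.
  by rewrite subrr p0 ltW.
by apply: ltW; exact: hN.
Qed.

Lemma cinj_dense x (r : R) : 0 < r -> exists2 a, D a & nm (x - cinj a) < r.
Proof.
move=> r0; have [N hN] := cinj_rep x r0; have [hu _] := rep_cseq x.
by exists (rep x N) => //; rewrite nmBC; exact: hN.
Qed.

(** Diagonal argument: elements of the dense subspace within 1 / (n + 1) of the n-th term form a
    Cauchy sequence, whose class is the limit. *)
Lemma completion_seq_complete (u : nat -> completion) :
  cauchy_nm u -> exists l, tendsto u l.
Proof.
move=> hu; have p2 n : 0 < (n.+1%:R : R)^-1 by rewrite invr_gt0.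
have /choice[a ha] : forall n, exists a, D a /\ nm (u n - cinj a) < n.+1%:R^-1.
  by move=> n; have [a] := cinj_dense (u n) (p2 n); exists a.
have small (r : R) : 0 < r -> exists N, (N.+1%:R : R)^-1 < r.
  move=> r0; exists (Num.truncn r^-1); rewrite invf_plt ?posrE //.
  exact: truncnS_gt.
have anti m n : (n <= m)%N -> (m.+1%:R : R)^-1 <= n.+1%:R^-1.
  by move=> h; rewrite lef_pV2 ?posrE // ler_nat.
have ca : cseq a.
  split=> [n|r r0]; first by case: (ha n).
  have r4 : 0 < r / 4 by rewrite divr_gt0.
  have [N hN] := hu _ r4; have [M hM] := small _ r4.
  exists (maxn N M) => m n; rewrite !geq_max => /andP[m1 m2] /andP[n1 n2].
  have [[Dm hm] [Dn hn]] := (ha m, ha n).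
  rewrite -nm_cinj; last exact: DB.
  rewrite cinjB //; apply: le_lt_trans (nm_dist (u m) _ _) _.
  rewrite (nmBC _ (u m)); apply: le_lt_trans (lerD (lexx _) (nm_dist (u n) _ _)) _.
  apply: lt_quarters => //; last 1 first.
  - exact: lt_trans hn (le_lt_trans (anti _ _ n2) hM).
  - exact: lt_trans hm (le_lt_trans (anti _ _ m2) hM).
  - exact: hN.
exists (cls ca) => r r0.
have r4 : 0 < r / 4 by rewrite divr_gt0.
have [N hN] := cinj_rep (cls ca) r4.
have [M hM] := small _ r4.
have [K hK] := rep_cls ca r4.
exists (maxn (maxn N M) K) => n; rewrite !geq_max => /andP[/andP[n1 n2] n3].
have [Dn hn] := ha n.
apply: le_lt_trans (nm_dist (cinj (a n)) _ _) _.
apply: le_lt_trans (lerD (lexx _) (nm_dist (cinj (rep (cls ca) n)) _ _)) _.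
have [Du _] := rep_cseq (cls ca).
apply: lt_quarters => //; last 1 first.
- exact: hN.
- exact: lt_trans hn (le_lt_trans (anti _ _ n2) hM).
- by rewrite nmBC -cinjB // nm_cinj; [exact: hK|exact: DB].
Qed.

HB.instance Definition _ := Uniform_isComplete.Build completion
  (seq_complete completion_seq_complete).

Lemma ccmulA : associative ccmul.
Proof.
move=> x y z; have [u [hu ->]] := clsP x; have [v [hv ->]] := clsP y.
have [w [hw ->]] := clsP z; rewrite !ccmul_cls; apply: cls_ext => n.
by apply: pc_mulA; [exact: (cseq_dom hu)|exact: (cseq_dom hv)|exact: (cseq_dom hw)].
Qed.
Lemma ccmul_linearl y : linear (fun x => ccmul x y).
Proof.
move=> k x z; have [u [hu ->]] := clsP x; have [v [hv ->]] := clsP y.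
have [w [hw ->]] := clsP z; rewrite (scaleE k hu) (addE _ hw) !ccmul_cls scaleE addE; apply: cls_ext => n.
by apply: pc_mulLl; [exact: (cseq_dom hu)|exact: (cseq_dom hw)|exact: (cseq_dom hv)].
Qed.
Lemma ccmul_linearr x : linear (ccmul x).
Proof.
move=> k y z; have [u [hu ->]] := clsP x; have [v [hv ->]] := clsP y.
have [w [hw ->]] := clsP z; rewrite (scaleE k hv) (addE _ hw) !ccmul_cls scaleE addE; apply: cls_ext => n.
by apply: pc_mulLr; [exact: (cseq_dom hv)|exact: (cseq_dom hw)|exact: (cseq_dom hu)].
Qed.
Lemma ccstar_antilinear (k : R[i]) x y :
  ccstar (k *: x + y) = conjc k *: ccstar x + ccstar y.
Proof.
have [u [hu ->]] := clsP x; have [v [hv ->]] := clsP y.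
rewrite (scaleE k hu) (addE _ hv) !ccstar_cls scaleE addE; apply: cls_ext => n.
by apply: pc_starL; [exact: (cseq_dom hu)|exact: (cseq_dom hv)].
Qed.
Lemma ccstarK : involutive ccstar.
Proof.
move=> x; have [u [hu ->]] := clsP x; rewrite !ccstar_cls; apply: cls_ext => n.
by apply: pc_starK; exact: (cseq_dom hu).
Qed.
Lemma ccstarM x y : ccstar (ccmul x y) = ccmul (ccstar y) (ccstar x).
Proof.
have [u [hu ->]] := clsP x; have [v [hv ->]] := clsP y.
rewrite (ccmul_cls hu hv) (ccstar_cls hu) (ccstar_cls hv) ccstar_cls ccmul_cls.
apply: cls_ext => n.
by apply: pc_starM; [exact: (cseq_dom hu)|exact: (cseq_dom hv)].
Qed.
Lemma ccnorm_mul x y : `|ccmul x y| <= `|x| * `|y|.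
Proof.
rewrite !nmE -real_complexM lecR !nm_completion.
have [u [hu ->]] := clsP x; have [v [hv ->]] := clsP y; rewrite ccmul_cls.
apply: (seq_lim_le (cnm_cls _) (cvgM (cnm_cls hu) (cnm_cls hv))) => n.
by apply: pc_nmM; [exact: (cseq_dom hu)|exact: (cseq_dom hv)].
Qed.
Lemma ccnorm_star_mul x : `|ccmul (ccstar x) x| = `|x| ^+ 2.
Proof.
rewrite !nmE -rmorphXn /=; congr (_%:C); rewrite !nm_completion.
have [u [hu ->]] := clsP x; rewrite ccstar_cls ccmul_cls expr2.
have h1 := cnm_cls (cseqM (cseq_star hu) hu).
have h2 : (fun n => p (u n) * p (u n)) @ \oo --> cnm (cls hu) * cnm (cls hu).
  by apply: cvgM; exact: cnm_cls.
have h n : p (st (u n) ** u n) = p (u n) * p (u n) by rewrite -expr2; apply: pc_nm_sq; exact: (cseq_dom hu).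
by apply/eqP; rewrite eq_le (seq_lim_le h1 h2) ?(seq_lim_le h2 h1) // => n; rewrite h.
Qed.
HB.instance Definition _ := isCStarAlgebra.Build R completion ccmulA
  ccmul_linearl ccmul_linearr ccstar_antilinear ccstarK ccstarM ccnorm_mul
  ccnorm_star_mul.

Lemma cinjM a b : D a -> D b -> cinj (a ** b) = cinj a *c cinj b.
Proof.
move=> ha hb; rewrite (cinjE (pc_domM ha hb)) (cinjE ha) (cinjE hb).
rewrite -[RHS]/(ccmul _ _) ccmul_cls; exact: cls_ext.
Qed.
Lemma cinj_star a : D a -> cinj (st a) = cstar (cinj a).
Proof.
move=> ha; rewrite (cinjE (pc_dom_star ha)) (cinjE ha).
rewrite -[RHS]/(ccstar _) ccstar_cls; exact: cls_ext.
Qed.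

(** Used where the given algebra is already complete: tensor products with a finite-dimensional
    algebra, and closed subalgebras. *)
Lemma cinj_onto :
  (forall u, cseq u -> exists2 l, D l & ceqv u (fun=> l)) ->
  forall x, exists2 a, D a & x = cinj a.
Proof.
move=> h x; have [u [hu ->]] := clsP x; have [l Dl hl] := h u hu.
by exists l => //; rewrite (cinjE Dl); exact: cls_eq.
Qed.

Lemma cinj_unit e : D e -> (forall a, D a -> e ** a = a /\ a ** e = a) ->
  is_one (cinj e).
Proof.
move=> De h x; have [u [hu ->]] := clsP x; rewrite (cinjE De).
rewrite -![_ *c _]/(ccmul _ _) !ccmul_cls.
by split; apply: cls_ext => n; case: (h (u n) _) => //; exact: (cseq_dom hu).
Qed.

End Completion.

(** * Positive functionals *)

Section HahnBanach.
Variables (R : realType) (V : lmodType R[i]).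

Definition sublinear (q : V -> R) :=
  (forall x y, q (x + y) <= q x + q y) /\
  (forall (r : R) x, 0 <= r -> q (r%:C *: x) = r * q x).

Lemma sublinear0 q : sublinear q -> q 0 = 0.
Proof. by move=> [_ /(_ 0 0 (lexx _))]; rewrite scaler0 mul0r. Qed.

Lemma sublinear_opp_ge q x : sublinear q -> - q (- x) <= q x.
Proof.
move=> hq; have := hq.1 x (- x); rewrite subrr (sublinear0 hq) => h.
by rewrite -subr_ge0 opprK.
Qed.

Lemma inf_exists (E : set R) (b : R) : E !=set0 -> lbound E b ->
  [/\ b <= inf E, lbound E (inf E) & forall d, 0 < d -> exists2 y, E y & y < inf E + d].
Proof.
move=> E0 Eb; split; first exact: lb_le_inf.
  by apply: ge_inf; exists b.
by move=> d d0; apply: inf_adherent => //; split => //; exists b.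
Qed.

(** The functional g(y) = inf over s >= 0 of q(y + s x0) - s q(x0) is again sublinear. A minimal q
    must equal it, and so must be odd. *)
Lemma sublinear_tilt (q : V -> R) (x0 : V) : sublinear q ->
  exists g, [/\ sublinear g, forall x, g x <= q x & g (- x0) <= - q x0].
Proof.
move=> hq; have [qD qZ] := hq.
pose E y : set R := [set z | exists2 s : R, 0 <= s & z = q (y + s%:C *: x0) - s * q x0].
have Elb y : lbound (E y) (- q (- y)).
  move=> _ [s s0 ->]; rewrite -qZ //.
  have := qD (y + s%:C *: x0) (- y); rewrite addrAC subrr add0r; lra.
have Eq y : E y (q y) by exists 0 => //; rewrite scale0r mul0r addr0 subr0.
have E0 y : E y !=set0 by exists (q y).
have hE y := inf_exists (E0 y) (@Elb y).
pose g y := inf (E y); exists g.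
have gq x : g x <= q x by have [_ h _] := hE x; apply: h.
have glb y s : 0 <= s -> g y <= q (y + s%:C *: x0) - s * q x0.
  by move=> s0; have [_ h _] := hE y; apply: h; exists s.
have gle0 x (r : R) : 0 < r -> g (r%:C *: x) <= r * g x.
  move=> r0; apply/ler_addgt0Pr => d d0.
  have [_ _ /(_ _ (divr_gt0 d0 r0))[_ [s s0 ->] hs]] := hE x.
  have rs : 0 <= r * s by rewrite mulr_ge0 // ltW.
  apply: (le_trans (glb _ _ rs)).
  rewrite real_complexM -scalerA -scalerDr qZ; last exact: ltW.
  have : r * (q (x + s%:C *: x0) - s * q x0 - inf (E x)) <= d.
    by rewrite mulrC ltW // -ltr_pdivlMr // ltrBlDl.
  by rewrite /g; lra.
split => //; first split.
- move=> x y; apply/ler_addgt0Pr => d d0.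
  have [_ _ /(_ _ (divr_gt0 d0 (ltr0n R 2)))[_ [s s0 ->] hs]] := hE x.
  have [_ _ /(_ _ (divr_gt0 d0 (ltr0n R 2)))[_ [t t0 ->] ht]] := hE y.
  apply: (le_trans (glb _ _ (addr_ge0 s0 t0))).
  rewrite real_complexD scalerDl addrACA.
  by have := qD (x + s%:C *: x0) (y + t%:C *: x0); rewrite /g; lra.
- move=> r x; rewrite le_eqVlt => /orP[/eqP <-|r0].
    rewrite scale0r mul0r; apply/eqP; rewrite eq_le.
    have := gq 0; rewrite (sublinear0 hq) => -> /=.
    by have [h _ _] := hE 0; rewrite oppr0 (sublinear0 hq) oppr0 in h.
  apply/eqP; rewrite eq_le gle0 //=.
  have ri : 0 < r^-1 by rewrite invr_gt0.
  have := gle0 (r%:C *: x) _ ri.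
  by rewrite scalerA -real_complexM mulVf ?gt_eqF // scale1r mulrC ler_pdivlMr // mulrC.
- have := glb (- x0) 1 ler01.
  by rewrite scale1r addNr (sublinear0 hq) mul1r sub0r.
Qed.

(** Zorn's lemma for the reversed order. The pointwise infimum of a chain is finite because -q(-x)
    bounds it from below; the empty chain is bounded by q itself. *)
Lemma sublinear_minimal (q : V -> R) : sublinear q ->
  exists f, [/\ sublinear f, forall x, f x <= q x &
    forall g, sublinear g -> (forall x, g x <= f x) -> g = f].
Proof.
move=> hq.
pose T := {g : V -> R | sublinear g /\ forall x, g x <= q x}.
pose below (g h : T) := `[< forall x, sval h x <= sval g x >].
have [||||f hf] := @Zorn T below.
- by move=> g; apply/asboolP.
- by move=> g h k /asboolP h1 /asboolP h2; apply/asboolP => x; exact: le_trans (h2 x) (h1 x).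
- move=> [g hg] [h hh] /asboolP h1 /asboolP h2.
  apply: eq_exist => /=; apply/funext => x; apply/eqP.
  by rewrite eq_le (h1 x) (h2 x).
- move=> A totA; case: (pselect (A !=set0)) => [[a0 Aa0]|nA]; last first.
    by exists (exist _ q (conj hq (fun x => lexx _))) => s As; case: nA; exists s.
  pose E x : set R := [set z | exists2 g : T, A g & z = sval g x].
  have E0 x : E x !=set0 by exists (sval a0 x); exists a0.
  have Elb x : lbound (E x) (- q (- x)).
    move=> _ [[g [hg gq]] Ag ->] /=.
    by apply: le_trans (sublinear_opp_ge _ hg); rewrite lerN2.
  have hE x := inf_exists (E0 x) (@Elb x).
  pose t x := inf (E x).
  have tle g x : A g -> t x <= sval g x.
    by move=> Ag; have [_ h _] := hE x; apply: h; exists g.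
  have tle0 x (r : R) : 0 < r -> t (r%:C *: x) <= r * t x.
    move=> r0; apply/ler_addgt0Pr => d d0.
    have [_ _ /(_ _ (divr_gt0 d0 r0))[_ [g Ag ->] hs]] := hE x.
    apply: (le_trans (tle _ _ Ag)); rewrite (svalP g).1.2; last exact: ltW.
    have : r * (sval g x - inf (E x)) <= d.
      by rewrite mulrC ltW // -ltr_pdivlMr // ltrBlDl.
    by rewrite /t; lra.
  have tq x : t x <= q x.
    by apply: le_trans (tle _ _ Aa0) _; case: (svalP a0) => _; apply.
  have ht : sublinear t.
    split=> [x y|r x].
      apply/ler_addgt0Pr => d d0.
      have [_ _ /(_ _ (divr_gt0 d0 (ltr0n R 2)))[_ [g Ag ->] hg]] := hE x.
      have [_ _ /(_ _ (divr_gt0 d0 (ltr0n R 2)))[_ [h Ah ->] hh]] := hE y.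
      have [/asboolP hgh|/asboolP hgh] := totA _ _ Ag Ah.
        have := tle _ (x + y) Ah; have := (svalP h).1.1 x y; have := hgh x.
        by rewrite /t; lra.
      have := tle _ (x + y) Ag; have := (svalP g).1.1 x y; have := hgh y.
      by rewrite /t; lra.
    rewrite le_eqVlt => /orP[/eqP <-|r0].
      rewrite scale0r mul0r; apply/eqP; rewrite eq_le.
      have := tq 0; rewrite (sublinear0 hq) => -> /=.
      by have [h _ _] := hE 0; rewrite oppr0 (sublinear0 hq) oppr0 in h.
    apply/eqP; rewrite eq_le tle0 //=.
    have ri : 0 < r^-1 by rewrite invr_gt0.
    have := tle0 (r%:C *: x) _ ri.
    by rewrite scalerA -real_complexM mulVf ?gt_eqF // scale1r mulrC ler_pdivlMr // mulrC.
  exists (exist _ t (conj ht tq)) => g Ag; apply/asboolP => x /=; exact: tle.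
exists (sval f); split; [exact: (svalP f).1|exact: (svalP f).2|move=> g hg gf].
have gq x : g x <= q x by apply: le_trans (gf x) _; exact: (svalP f).2.
have /(congr1 sval) // : exist _ g (conj hg gq) = f.
by apply: hf; apply/asboolP.
Qed.

(** A minimal sublinear functional is linear, so no partially defined functionals occur. Tilting q
    at x0 beforehand forces the value at x0 to be q(x0). *)
Lemma hahn_banach (q : V -> R) (x0 : V) : sublinear q ->
  exists f : V -> R, [/\ forall x y, f (x + y) = f x + f y,
    forall (r : R) x, f (r%:C *: x) = r * f x,
    forall x, f x <= q x & f x0 = q x0].
Proof.
move=> hq; have [g [hg gq g0]] := sublinear_tilt x0 hq.
have [f [hf fg fmin]] := sublinear_minimal hg.
have fN x : f (- x) = - f x.
  have [h [hh hf' h0]] := sublinear_tilt x hf; rewrite (fmin _ hh hf') in h0.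
  apply/eqP; rewrite eq_le h0 /= lerNl.
  by have := sublinear_opp_ge x hf.
have fD x y : f (x + y) = f x + f y.
  apply/eqP; rewrite eq_le hf.1 /=.
  by have := hf.1 (x + y) (- y); rewrite addrK fN lerBrDr.
exists f; split => //.
- move=> r x; case: (leP 0 r) => hr; first exact: hf.2.
  rewrite -[r]opprK mulNr -hf.2 ?oppr_ge0 ?ltW // -fN; congr f.
  by rewrite rmorphN /= !scaleNr.
- by move=> x; exact: le_trans (fg x) (gq x).
- apply/eqP; rewrite eq_le (le_trans (fg x0) (gq x0)) /=.
  by rewrite -lerN2 -fN; exact: le_trans (fg _) g0.
Qed.

End HahnBanach.

Section PositiveFunctionals.
Variables (R : realType) (A : cstarAlgType R).
Implicit Types (x y z a b : A) (F : A -> R[i]).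

Definition posfun F :=
  (forall k x y, F (k *: x + y) = k * F x + F y) /\
  (forall x, 0 <= F (cstar x *c x)).

Section Theory.
Variable F : A -> R[i].
Hypothesis hF : posfun F.

Lemma pfL k x y : F (k *: x + y) = k * F x + F y. Proof. exact: hF.1. Qed.
Lemma pfD x y : F (x + y) = F x + F y.
Proof. by have := pfL 1 x y; rewrite scale1r mul1r. Qed.
Lemma pf0 : F 0 = 0.
Proof. by apply: (@addrI _ (F 0)); rewrite -pfD !addr0. Qed.
Lemma pfZ k x : F (k *: x) = k * F x.
Proof. by have := pfL k x 0; rewrite !addr0 pf0 addr0. Qed.
Lemma pfN x : F (- x) = - F x.
Proof. by rewrite -scaleN1r pfZ mulN1r. Qed.
Lemma pfB x y : F (x - y) = F x - F y.
Proof. by rewrite pfD pfN. Qed.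
Lemma pf_sum I (r : seq I) (P : pred I) (G : I -> A) :
  F (\sum_(i <- r | P i) G i) = \sum_(i <- r | P i) F (G i).
Proof. exact: (big_morph F pfD pf0). Qed.

Lemma pf_pos a : pos a -> 0 <= F a.
Proof. by move=> [b hb ->]; rewrite -{1}hb; exact: hF.2. Qed.

Lemma pf_mono a b : pos (b - a) -> F a <= F b.
Proof. by move=> /pf_pos; rewrite pfB subr_ge0. Qed.

Variable e : A.
Hypothesis e1 : is_one e.

Lemma pf_real x : selfadj x -> F x = (complex.Re (F x))%:C.
Proof.
move=> /(selfadj_parts e1)[p [n [hp hn -> _ _]]].
have h1 := ge0_complexE (pf_pos hp); have h2 := ge0_complexE (pf_pos hn).
by rewrite pfB h1 h2 -rmorphB.
Qed.

Lemma pf_star x : F (cstar x) = conjc (F x).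
Proof.
have hr y : selfadj y -> conjc (F y) = F y by move=> /pf_real ->; rewrite conjc_real.
move: (hpart_selfadj x) (apart_selfadj x) (cartesian x).
move: (hpart x) (apart x) => h k hs ks ->.
rewrite cstarD cstarZ hs ks !pfD !pfZ.
by rewrite conjcD conjcM !hr.
Qed.

Lemma pf_conj a b :
  F (cstar b *c (cstar a *c a) *c b) <= (nm a ^+ 2)%:C * F (cstar b *c b).
Proof.
rewrite -pfZ; apply: pf_mono.
have := pos_conj e1 b (star_mul_le e1 a).
by rewrite cmulBr cmulBl cmulZr (cmul1r e1) cmulZl.
Qed.

Lemma pf_nm x : F (cstar x *c x) <= (nm x ^+ 2)%:C * F e.
Proof.
have := pf_conj x e; rewrite (cstar_one e1) (cmul1l e1) !(cmul1r e1); exact.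
Qed.

End Theory.

Variable e : A.
Hypothesis e1 : is_one e.

(* A form of the Riesz extension theorem: G is the graph of an upper bound, given
   on selfadjoint elements, for the functional to be found. *)
Lemma posfun_from_cone (G : A -> R -> Prop) (x0 : A) :
  G 0 0 ->
  (forall x y r s, G x r -> G y s -> G (x + y) (r + s)) ->
  (forall t x r, 0 <= t -> G x r -> G (t%:C *: x) (t * r)) ->
  (forall x, selfadj x -> exists y r, G y r /\ pos (y - x)) ->
  (forall x r, G x r -> selfadj x) ->
  (forall x r, G x r -> pos x -> 0 <= r) ->
  selfadj x0 ->
  exists F, [/\ posfun F, forall x r, G x r -> complex.Re (F x) <= r &
    forall c, (forall x r, G x r -> pos (x - x0) -> c <= r) -> c <= complex.Re (F x0)].
Proof.
move=> G0 GD GZ Gcof Gsa Gpos x0s.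
pose E x : set R := [set r | exists2 y, G y r & pos (y - hpart x)].
have E0 x : E x !=set0.
  by have [y [r [Gy hy]]] := Gcof _ (hpart_selfadj x); exists r; exists y.
have hlb x : exists c : R, lbound (E x) c.
  have [y [r [Gy hy]]] := Gcof _ (selfadjN (hpart_selfadj x)).
  exists (- r) => s [z Gz hz]; rewrite -subr_ge0 opprK.
  apply: (Gpos _ _ (GD _ _ _ _ Gz Gy)).
  by have := posD e1 hz hy; rewrite opprK addrACA addNr addr0.
have hE x : lbound (E x) (inf (E x)) /\
    forall d, 0 < d -> exists2 y, E x y & y < inf (E x) + d.
  by have [b hb] := hlb x; have [_ h1 h2] := inf_exists (E0 x) hb.
(* q(x) is the least bound that G grants to elements above x. A linear f <= q is positive, since
   f(-p) <= q(-p) <= 0 for positive p. *)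
pose q x := inf (E x).
have qle x y r : G y r -> pos (y - hpart x) -> q x <= r.
  by move=> Gy hy; have [h _] := hE x; apply: h; exists y.
have q00 : q 0 = 0.
  have h00 : hpart 0 = 0 :> A by rewrite /hpart cstar0 addr0 scaler0.
  apply/eqP; rewrite eq_le (qle _ 0) //=; last by rewrite h00 subr0; exact: pos0.
  apply: lb_le_inf => // r [y Gy]; rewrite h00 subr0; exact: Gpos.
have qle0 x (r : R) : 0 < r -> q (r%:C *: x) <= r * q x.
  move=> r0; apply/ler_addgt0Pr => d d0.
  have [_ /(_ _ (divr_gt0 d0 r0))[s [y Gy hy] hs]] := hE x.
  apply: le_trans (qle _ _ _ (GZ r _ _ (ltW r0) Gy) _) _.
    by rewrite hpartZ -scalerBr; apply: posZ => //; exact: ltW.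
  have : r * (s - inf (E x)) <= d by rewrite mulrC ltW // -ltr_pdivlMr // ltrBlDl.
  by rewrite /q; lra.
have hq : sublinear q.
  split=> [x y|r x].
    apply/ler_addgt0Pr => d d0.
    have [_ /(_ _ (divr_gt0 d0 (ltr0n R 2)))[s [z Gz hz] hs]] := hE x.
    have [_ /(_ _ (divr_gt0 d0 (ltr0n R 2)))[t [w Gw hw] ht]] := hE y.
    apply: le_trans (qle _ _ _ (GD _ _ _ _ Gz Gw) _) _.
      by rewrite hpartD opprD addrACA; exact: posD e1 _ _ hz hw.
    by rewrite /q; lra.
  rewrite le_eqVlt => /orP[/eqP <-|r0]; first by rewrite scale0r mul0r.
  apply/eqP; rewrite eq_le qle0 //=.
  have ri : 0 < r^-1 by rewrite invr_gt0.
  have := qle0 (r%:C *: x) _ ri.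
  by rewrite scalerA -real_complexM mulVf ?gt_eqF // scale1r mulrC ler_pdivlMr // mulrC.
have [f [fD fZ fq fx0]] := hahn_banach x0 hq.
have f0 : f 0 = 0 by have := fZ 0 0; rewrite mul0r scale0r.
have fpos p : pos p -> 0 <= f p.
  move=> hp; have := fZ (-1) p; rewrite rmorphN1 scaleN1r mulN1r => fN.
  rewrite -[f p]opprK -fN oppr_ge0; apply: (le_trans (fq _)).
  apply: (qle _ _ _ G0); rewrite hpart_id; last exact: selfadjN (pos_selfadj hp).
  by rewrite sub0r opprK.
(* [hahn_banach] yields a real-linear functional; its values on the real and imaginary parts give
   the complex-linear one. *)
pose F x := (f (hpart x))%:C + 'i * (f (apart x))%:C.
have hs0 x : selfadj x -> apart x = 0 by move=> h; rewrite /apart h subrr scaler0.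
have Fs x : selfadj x -> F x = (f x)%:C.
  by move=> h; rewrite /F hs0 // hpart_id // f0 mulr0 addr0.
have FD x y : F (x + y) = F x + F y.
  rewrite /F hpartD fD.
  have -> : apart (x + y) = apart x + apart y.
    by rewrite /apart cstarD opprD addrACA scalerDr.
  by rewrite fD !real_complexD; ring.
have hi x : hpart ('i *: x) = - apart x.
  rewrite /hpart /apart cstarZ conji scaleNr -scalerBr scalerA mulrC.
  by rewrite mulNr scaleNr opprK.
have ai x : apart ('i *: x) = hpart x.
  rewrite /hpart /apart cstarZ conji scaleNr opprK -scalerDr scalerA.
  by congr (_ *: _); rewrite mulrAC mulNr mulii opprK mul1r.
have FZr (r : R) x : F (r%:C *: x) = r%:C * F x.
  rewrite /F hpartZ fZ; have -> : apart (r%:C *: x) = r%:C *: apart x.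
    by rewrite /apart cstarZr -scalerBr !scalerA mulrC.
  by rewrite !fZ !real_complexM; ring.
have Fi x : F ('i *: x) = 'i * F x.
  rewrite /F hi ai; have := fZ (-1) (apart x); rewrite rmorphN1 scaleN1r mulN1r => ->.
  by rewrite rmorphN /= mulrDr mulrA mulii mulN1r addrC.
exists F; split.
- split=> [k x y|x].
    rewrite FD; congr (_ + _); rewrite [k]complexE scalerDl FD FZr -scalerA Fi FZr.
    by rewrite -[('i)%C]/('i : R[i]); ring.
  have hp := pos_star_mul e1 x.
  by rewrite Fs ?ler0c; [exact: fpos|exact: pos_selfadj].
- move=> x r Gx; rewrite Fs /=; last exact: Gsa Gx.
  apply: (le_trans (fq _)); apply: (qle _ _ _ Gx).
  by rewrite hpart_id ?subrr; [exact: pos0|exact: Gsa Gx].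
- move=> c hc; rewrite Fs //= fx0; apply: lb_le_inf => // r [y Gy hy].
  by apply: hc Gy _; rewrite -(hpart_id x0s).
Qed.

(** The cone consists of the multiples of the unit. Every t with t 1 >= h is at least |h|, so the
    functional can be chosen with F(h) >= |h|. *)
Lemma posfun_gt0 h : pos h -> h <> 0 -> exists2 F, posfun F & 0 < F h.
Proof.
move=> hp h0; have hn : 0 < nm h.
  by rewrite lt_def nm_ge0 andbT; apply/eqP => /nm0_eq0.
have t0 (t : R) : pos (t%:C *: e - h) -> 0 <= t.
  move=> ht; case: (leP 0 t) => // tn; case: h0.
  apply: (pos_antisym e1 hp); have ht' : pos ((- t)%:C *: e).
    by apply: posZ; [rewrite oppr_ge0 ltW|exact: pos_one].
  by have := posD e1 ht ht'; rewrite addrAC -scalerDl -real_complexD subrr scale0r add0r.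
have [|||||||F [hF F1 F2]] := @posfun_from_cone (fun y t => y = t%:C *: e) h.
- by rewrite scale0r.
- by move=> x y r s -> ->; rewrite -scalerDl -real_complexD.
- by move=> t x r _ ->; rewrite scalerA -real_complexM.
- move=> x xs; exists ((nm x)%:C *: e), (nm x); split => //.
  exact: selfadj_le_nm.
- by move=> x r ->; apply: selfadjZ; exact: selfadj_one.
- move=> x r -> hr; case: (leP 0 r) => // rn; case: h0.
  have hr' : pos (- (r%:C *: e)).
    rewrite -scaleNr -rmorphN /=; apply: posZ; last exact: pos_one.
    by rewrite oppr_ge0 ltW.
  have re := pos_antisym e1 hr hr'.
  rewrite -(cmul1l e1 h) -[e]scale1r -[1](_ : (r^-1)%:C * r%:C = _) -?scalerA ?re ?scaler0 ?cmul0l //.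
  by rewrite -real_complexM mulVf // lt_eqF.
- exact: pos_selfadj.
exists F => //; rewrite (pf_real hF e1 (pos_selfadj hp)) ltcR.
apply: lt_le_trans hn _; apply: F2 => x r -> hr.
by apply: (nm_le_of_pos e1) => //; exact: t0.
Qed.

End PositiveFunctionals.

(** G is the graph of F on the image of the selfadjoint elements. It is consistent with positivity
    by [hom_inj_pos] and cofinal thanks to the multiples of the unit; domination at both a and -a
    gives equality. *)
Lemma posfun_extension (R : realType) (A B : cstarAlgType R) (f : A -> B) (e : A)
    (F : A -> R[i]) :
  star_hom f -> is_one e -> is_one (f e) -> injective f -> posfun F ->
  exists2 F', posfun F' & forall a, F' (f a) = F a.
Proof.
move=> hf e1 fe1 finj hF.
pose G y r := exists a, [/\ selfadj a, y = f a & F a = r%:C].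
have [|||||||F' [hF' F1 _]] := @posfun_from_cone _ _ _ fe1 G 0.
- by exists 0; rewrite (hom0 hf) (pf0 hF); split => //; exact: selfadj0.
- move=> x y r s [a [ha -> Fa]] [b [hb -> Fb]]; exists (a + b).
  by rewrite (homD hf) (pfD hF) Fa Fb real_complexD; split => //; exact: selfadjD.
- move=> t x r t0 [a [ha -> Fa]]; exists (t%:C *: a).
  by rewrite (homZ hf) (pfZ hF) Fa real_complexM; split => //; exact: selfadjZ.
- move=> x xs; exists ((nm x)%:C *: f e), (nm x * complex.Re (F e)); split.
    exists ((nm x)%:C *: e); rewrite (homZ hf) (pfZ hF).
    rewrite real_complexM -(pf_real hF e1 (selfadj_one e1)).
    by split => //; apply: selfadjZ; exact: selfadj_one.
  exact: selfadj_le_nm.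
- by move=> x r [a [ha -> _]]; exact: hom_selfadj.
- move=> x r [a [ha -> Fa]] /(hom_inj_pos hf e1 fe1 finj ha) /(pf_pos hF).
  by rewrite Fa ler0c.
- exact: selfadj0.
exists F' => // a.
have hs h : selfadj h -> F' (f h) = F h.
  move=> hh; rewrite (pf_real hF e1 hh) (pf_real hF' fe1 (hom_selfadj hf hh)).
  congr (_%:C); apply/eqP; rewrite eq_le; apply/andP; split.
    by apply: F1; exists h; split => //; exact: pf_real.
  have := F1 (- f h) (- complex.Re (F h)).
  rewrite (pfN hF') raddfN lerN2; apply; exists (- h).
  by rewrite (homN hf) (pfN hF) {1}(pf_real hF e1 hh) -rmorphN; split => //; exact: selfadjN.
move: (hpart_selfadj a) (apart_selfadj a) (cartesian a).
move: (hpart a) (apart a) => h k hh hk ->.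
by rewrite (homD hf) (homZ hf) (pfD hF) (pfZ hF) (pfD hF') (pfZ hF') !hs.
Qed.

Lemma conjc_sum (R : realType) I (r : seq I) (P : pred I) (F : I -> R[i]) :
  conjc (\sum_(i <- r | P i) F i) = \sum_(i <- r | P i) conjc (F i).
Proof. exact: (big_morph _ (@conjcD R) (@conjc0 R)). Qed.

(** * Semi-inner products and operator norms *)

Section SemiInnerProduct.
Variables (R : realType) (W : lmodType R[i]).

(** Degenerate forms are allowed: the spaces are neither separated nor completed, and equality of
    vectors is replaced by distance 0. *)
Definition semi_inner (ip : W -> W -> R[i]) : Prop :=
  [/\ forall k x y z, ip x (k *: y + z) = k * ip x y + ip x z,
      forall x y, ip y x = conjc (ip x y) & forall x, 0 <= ip x x].

Variable ip : W -> W -> R[i].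
Hypothesis hip : semi_inner ip.

Definition sqnm x := complex.Re (ip x x).

Lemma ipLr k x y z : ip x (k *: y + z) = k * ip x y + ip x z.
Proof. by case: hip => h _ _; exact: h. Qed.
Lemma ipC x y : ip y x = conjc (ip x y).
Proof. by case: hip => _ h _; exact: h. Qed.
Lemma ipDr x y z : ip x (y + z) = ip x y + ip x z.
Proof. by have := ipLr 1 x y z; rewrite scale1r mul1r. Qed.
Lemma ip0r x : ip x 0 = 0.
Proof. by apply: (@addrI _ (ip x 0)); rewrite -ipDr !addr0. Qed.
Lemma ipZr k x y : ip x (k *: y) = k * ip x y.
Proof. by have := ipLr k x y 0; rewrite !addr0 ip0r addr0. Qed.
Lemma ipNr x y : ip x (- y) = - ip x y.
Proof. by rewrite -scaleN1r ipZr mulN1r. Qed.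
Lemma ipBr x y z : ip x (y - z) = ip x y - ip x z.
Proof. by rewrite ipDr ipNr. Qed.
Lemma ip_sumr I (r : seq I) (P : pred I) (F : I -> W) x :
  ip x (\sum_(i <- r | P i) F i) = \sum_(i <- r | P i) ip x (F i).
Proof. exact: (big_morph (ip x) (ipDr x) (ip0r x)). Qed.
Lemma ipDl x y z : ip (y + z) x = ip y x + ip z x.
Proof. by rewrite ipC ipDr conjcD -!ipC. Qed.
Lemma ip0l x : ip 0 x = 0.
Proof. by rewrite ipC ip0r conjc0. Qed.
Lemma ipZl k x y : ip (k *: y) x = conjc k * ip y x.
Proof. by rewrite ipC ipZr conjcM -ipC. Qed.
Lemma ipNl x y : ip (- y) x = - ip y x.
Proof. by rewrite ipC ipNr conjcN -ipC. Qed.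
Lemma ipBl x y z : ip (y - z) x = ip y x - ip z x.
Proof. by rewrite ipDl ipNl. Qed.
Lemma ip_suml I (r : seq I) (P : pred I) (F : I -> W) x :
  ip (\sum_(i <- r | P i) F i) x = \sum_(i <- r | P i) ip (F i) x.
Proof. by rewrite ipC ip_sumr conjc_sum; apply: eq_bigr => i _; rewrite -ipC. Qed.

Lemma sqnmE x : ip x x = (sqnm x)%:C.
Proof. by apply: ge0_complexE; case: hip. Qed.
Lemma sqnm_ge0 x : 0 <= sqnm x.
Proof. by rewrite -ler0c -sqnmE; case: hip. Qed.
Lemma sqnm0 : sqnm 0 = 0. Proof. by rewrite /sqnm ip0l. Qed.

Lemma sqnmD x y : sqnm (x + y) = sqnm x + sqnm y + 2 * complex.Re (ip x y).
Proof.
rewrite /sqnm ipDl !ipDr !raddfD /= (ipC x y).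
have -> : complex.Re (conjc (ip x y)) = complex.Re (ip x y) by case: (ip x y).
ring.
Qed.

Lemma sqnmZ (k : R[i]) x : sqnm (k *: x) = cabs k ^+ 2 * sqnm x.
Proof.
by rewrite /sqnm ipZr ipZl mulrA [k * _]mulrC -cabs_sqr sqnmE -rmorphM.
Qed.

Lemma sqnmZr (r : R) x : sqnm (r%:C *: x) = r ^+ 2 * sqnm x.
Proof. by rewrite sqnmZ cabs_real real_normK // num_real. Qed.

(** The Cauchy-Schwarz inequality with a free weight t, which avoids square roots; the later
    estimates choose t so that the two terms balance. *)
Lemma re_ip_le (t : R) x y : 0 < t -> 2 * complex.Re (ip x y) <= t * sqnm x + t^-1 * sqnm y.
Proof.
move=> t0; have := sqnm_ge0 ((- t)%:C *: x + y).
rewrite sqnmD sqnmZr ipZl conjc_real sqrrN.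
have -> : complex.Re ((- t)%:C * ip x y) = - t * complex.Re (ip x y).
  by case: (ip x y) => a b /=; rewrite mul0r subr0.
move=> h; have ti : 0 < t^-1 by rewrite invr_gt0.
have := mulr_ge0 (ltW ti) h.
have -> : t^-1 * (t ^+ 2 * sqnm x + sqnm y + 2 * (- t * complex.Re (ip x y))) =
  t * sqnm x + t^-1 * sqnm y - 2 * complex.Re (ip x y).
  by field; rewrite gt_eqF.
by lra.
Qed.

Lemma sqnm_sum_le n (v : 'I_n -> W) :
  sqnm (\sum_(i < n) v i) <= n%:R * \sum_(i < n) sqnm (v i).
Proof.
elim: n v => [|n ih] v; first by rewrite !big_ord0 sqnm0 mulr0.
rewrite !big_ord_recr /= sqnmD.
case: n ih v => [|n] ih v.
  by rewrite !big_ord0 sqnm0 ip0l !add0r mulr0 addr0 mul1r.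
set s := \sum_(i < _) v _; set w := v _.
have n0 : 0 < n.+1%:R :> R by rewrite ltr0n.
have := ih (fun i => v (widen_ord (leqnSn n.+1) i)); rewrite -/s.
set S := \sum_(i < _) sqnm _ => h.
have ni : 0 < n.+1%:R^-1 :> R by rewrite invr_gt0.
have h2 := @re_ip_le n.+1%:R^-1 s w ni; rewrite invrK in h2.
have h3 : n.+1%:R^-1 * sqnm s <= S by rewrite mulrC ler_pdivrMr // mulrC.
rewrite -[n.+2%:R]natr1 mulrDl mul1r.
move: h h2 h3; move: (sqnm w) (complex.Re _) (sqnm s) (n.+1%:R : R) => *; nra.
Qed.

End SemiInnerProduct.

(* A *-algebra acting by bounded adjointable operators on a space with a family of
   semi-inner products. *)
Record opdata (R : realType) := OpData {
  od_space : lmodType R[i];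
  od_dom : set od_space;
  od_mul : od_space -> od_space -> od_space;
  od_star : od_space -> od_space;
  od_dom0 : od_dom 0;
  od_domL : forall k x y, od_dom x -> od_dom y -> od_dom (k *: x + y);
  od_domM : forall x y, od_dom x -> od_dom y -> od_dom (od_mul x y);
  od_dom_star : forall x, od_dom x -> od_dom (od_star x);
  od_mulA : forall x y z, od_dom x -> od_dom y -> od_dom z ->
    od_mul x (od_mul y z) = od_mul (od_mul x y) z;
  od_mulLl : forall k x y z, od_dom x -> od_dom y -> od_dom z ->
    od_mul (k *: x + y) z = k *: od_mul x z + od_mul y z;
  od_mulLr : forall k x y z, od_dom x -> od_dom y -> od_dom z ->
    od_mul z (k *: x + y) = k *: od_mul z x + od_mul z y;
  od_starL : forall k x y, od_dom x -> od_dom y ->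
    od_star (k *: x + y) = conjc k *: od_star x + od_star y;
  od_starK : forall x, od_dom x -> od_star (od_star x) = x;
  od_starM : forall x y, od_dom x -> od_dom y ->
    od_star (od_mul x y) = od_mul (od_star y) (od_star x);
  od_vec : lmodType R[i];
  od_idx : Type;
  od_ip : od_idx -> od_vec -> od_vec -> R[i];
  od_ipP : forall i, semi_inner (od_ip i);
  od_act : od_space -> od_vec -> od_vec;
  od_actL : forall k a b x, od_dom a -> od_dom b ->
    od_act (k *: a + b) x = k *: od_act a x + od_act b x;
  od_actM : forall a b x, od_dom a -> od_dom b ->
    od_act (od_mul a b) x = od_act a (od_act b x);
  od_adj : forall i a x y, od_dom a ->
    od_ip i (od_act a x) y = od_ip i x (od_act (od_star a) y);
  od_bnd : forall a, od_dom a -> exists2 c : R, 0 <= c &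
    forall i x, sqnm (od_ip i) (od_act a x) <= c ^+ 2 * sqnm (od_ip i) x }.

Section OperatorNorm.
Variables (R : realType) (d : opdata R).
Notation D := (@od_dom R d).
Notation V := (od_space d).
Notation st := (@od_star R d).
Notation act := (@od_act R d).
Notation N i := (sqnm (@od_ip R d i)).

Definition op_bound a (c : R) :=
  0 <= c /\ forall i x, N i (act a x) <= c ^+ 2 * N i x.

Definition op_nm (a : V) : R := inf [set c | op_bound a c].

Lemma op_nm_le a c : op_bound a c -> op_nm a <= c.
Proof. by move=> h; apply: ge_inf => //; exists 0 => x []. Qed.

Lemma op_nm_ge0 a : D a -> 0 <= op_nm a.
Proof.
move=> Da; apply: lb_le_inf; last by move=> x [].
by have [c c0 hc] := od_bnd Da; exists c.
Qed.

Lemma op_nm_bound_gt a c : D a -> op_nm a < c -> op_bound a c.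
Proof.
move=> Da h; have [c' c0 hc'] := od_bnd Da.
have hne : [set c | op_bound a c] !=set0 by exists c'.
have [_ _ /(_ (c - op_nm a))] := inf_exists hne (b := 0) (fun x hx => hx.1).
rewrite subr_gt0 => /(_ h)[y [y0 hy]]; rewrite addrC subrK => yc.
have c0' : 0 <= c by apply: (le_trans y0); exact: ltW.
split=> // i x; apply: (le_trans (hy i x)); apply: ler_wpM2r.
  exact: sqnm_ge0 (od_ipP i) x.
by rewrite lerXn2r ?nnegrE // ltW.
Qed.

Lemma op_nmP a i x : D a -> N i (act a x) <= op_nm a ^+ 2 * N i x.
Proof.
move=> Da; have n0 := sqnm_ge0 (od_ipP i) x; have a0 := op_nm_ge0 Da.
apply/ler_addgt0Pr => e e0.
(* For t <= 1 the square of [op_nm a + t] exceeds that of [op_nm a] by at most t K, and M absorbs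
   the factor N(x); so t M <= e is enough. *)
pose K := 2 * op_nm a + 1; pose M := K * N i x + 1.
have K0 : 0 < K by rewrite /K; lra.
have M0 : 0 < M by rewrite /M ltr_wpDl // mulr_ge0 // ltW.
pose t := Num.min 1 (e / M).
have t0 : 0 < t by rewrite lt_min ltr01 divr_gt0.
have t1 : t <= 1 by rewrite ge_min lexx.
have tM : t * M <= e by rewrite -ler_pdivlMr // ge_min lexx orbT.
have [|_ h] := @op_nm_bound_gt a (op_nm a + t) Da; first by rewrite ltrDl.
apply: (le_trans (h i x)).
have : (op_nm a + t) ^+ 2 <= op_nm a ^+ 2 + t * K.
  by rewrite /K expr2; nra.
move=> /(ler_wpM2r n0) h1; apply: (le_trans h1); rewrite mulrDl lerD2l.
by apply: le_trans tM; rewrite /M -mulrA; apply: ler_wpM2l; [exact: ltW|rewrite lerDl].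
Qed.

Lemma op_nmD a b : D a -> D b -> op_nm (a + b) <= op_nm a + op_nm b.
Proof.
move=> Da Db; apply/ler_addgt0Pr => e e0.
set ca := op_nm a + e / 2; set cb := op_nm b + e / 2.
have e2 : 0 < e / 2 by rewrite divr_gt0.
have -> : op_nm a + op_nm b + e = ca + cb by rewrite /ca /cb; field.
have a0 := op_nm_ge0 Da; have b0 := op_nm_ge0 Db.
have ca0 : 0 < ca by rewrite /ca ltr_wpDl.
have cb0 : 0 < cb by rewrite /cb ltr_wpDl.
have [_ ha] : op_bound a ca by apply: op_nm_bound_gt => //; rewrite /ca ltrDl.
have [_ hb] : op_bound b cb by apply: op_nm_bound_gt => //; rewrite /cb ltrDl.
apply: op_nm_le; split=> [|i x]; first by rewrite addr_ge0 // ltW.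
have := od_actL 1 x Da Db; rewrite !scale1r => ->.
have hip := od_ipP i; rewrite (sqnmD hip).
(* This weight bounds both terms by ca cb N(x), so that the cross term completes the square of ca +
   cb. The slack e / 2 keeps ca and cb away from 0. *)
have := @re_ip_le _ _ _ hip (cb / ca) (act a x) (act b x) (divr_gt0 cb0 ca0).
have h1 : cb / ca * N i (act a x) <= cb * ca * N i x.
  apply: le_trans (ler_wpM2l _ (ha i x)) _; first by rewrite divr_ge0 // ltW.
  rewrite mulrA le_eqVlt; apply/orP; left; apply/eqP; congr (_ * _).
  by field; rewrite gt_eqF.
have h2 : (cb / ca)^-1 * N i (act b x) <= cb * ca * N i x.
  apply: le_trans (ler_wpM2l _ (hb i x)) _; first by rewrite invr_ge0 divr_ge0 // ltW.
  rewrite mulrA le_eqVlt; apply/orP; left; apply/eqP; congr (_ * _).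
  by field; rewrite !gt_eqF.
have h3 := ha i x; have h4 := hb i x.
have -> : (ca + cb) ^+ 2 * N i x = ca ^+ 2 * N i x + cb ^+ 2 * N i x +
   2 * (cb * ca * N i x) by ring.
by move: h1 h2 h3 h4; lra.
Qed.

Lemma op_nmZ_le k a : D a -> op_nm (k *: a) <= cabs k * op_nm a.
Proof.
move=> Da; apply: op_nm_le; split.
  by rewrite mulr_ge0 ?cabs_ge0 ?op_nm_ge0.
move=> i x; have := od_actL k x Da (od_dom0 d); rewrite addr0 => ->.
have -> : act 0 x = 0.
  have := od_actL 0 x (od_dom0 d) (od_dom0 d); rewrite scaler0 addr0.
  by rewrite scale0r add0r => _; have := od_actL (-1) x (od_dom0 d) (od_dom0 d);
    rewrite scaler0 addr0 scaleN1r addNr.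
rewrite addr0 (sqnmZ (od_ipP i)) exprMn -[leRHS]mulrA.
by apply: ler_wpM2l; [exact: sqr_ge0|exact: op_nmP].
Qed.

Lemma od_domZ k a : D a -> D (k *: a).
Proof. by move=> Da; have := od_domL k Da (od_dom0 d); rewrite addr0. Qed.

Lemma op_nmZ k a : D a -> op_nm (k *: a) = cabs k * op_nm a.
Proof.
move=> Da; apply/eqP; rewrite eq_le op_nmZ_le //=.
have [->|k0] := eqVneq k 0.
  by rewrite /cabs normr0 mul0r op_nm_ge0 //; exact: od_domZ.
have := @op_nmZ_le k^-1 (k *: a) (od_domZ _ Da); rewrite scalerA mulVf // scale1r.
have ck : cabs k^-1 = (cabs k)^-1.
  by apply: (@complexI R); rewrite -[LHS]cabsE normfV cabsE fmorphV.
have ck0 : 0 < cabs k.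
  by rewrite lt_def cabs_ge0 andbT; apply/eqP => h; case/eqP: k0; apply/eqP;
    rewrite -normr_eq0 cabsE h.
by rewrite ck mulrC ler_pdivlMr // mulrC.
Qed.

Lemma op_nmM a b : D a -> D b -> op_nm (od_mul a b) <= op_nm a * op_nm b.
Proof.
move=> Da Db; apply: op_nm_le; split; first by rewrite mulr_ge0 // op_nm_ge0.
move=> i x; rewrite od_actM //; apply: (le_trans (op_nmP _ _ Da)).
rewrite exprMn -[leRHS]mulrA; apply: ler_wpM2l; first exact: sqr_ge0.
exact: op_nmP.
Qed.

(** N(a^* x) = Re <x, a a^* x> is at most half of c^2 N(x) + c^-2 N(a a^* x), whose second term is
    at most N(a^* x) and is absorbed on the left. *)
Lemma op_nm_star a : D a -> op_nm (st a) <= op_nm a.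
Proof.
move=> Da; apply/ler_addgt0Pr => e e0; set c := op_nm a + e.
have c0 : 0 < c by rewrite /c ltr_wpDl // op_nm_ge0.
have [_ ha] : op_bound a c by apply: op_nm_bound_gt => //; rewrite /c ltrDl.
have Ds := od_dom_star Da.
apply: op_nm_le; split=> [|i x]; first exact: ltW.
have c2 : 0 < c ^+ 2 by rewrite exprn_gt0.
have hip := od_ipP i.
have h1 := @re_ip_le _ _ _ hip (c ^+ 2) x (act a (act (st a) x)) c2.
have h2 : (c ^+ 2)^-1 * N i (act a (act (st a) x)) <= N i (act (st a) x).
  by rewrite mulrC ler_pdivrMr // mulrC.
have h3 : N i (act (st a) x) = complex.Re (od_ip i x (act a (act (st a) x))).
  by rewrite /sqnm od_adj // od_starK.
by move: h1 h2; rewrite -h3; lra.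
Qed.

Lemma op_nm_sq a : D a -> op_nm (od_mul (st a) a) = op_nm a ^+ 2.
Proof.
move=> Da; have Ds := od_dom_star Da; have Dm := od_domM Ds Da.
apply/eqP; rewrite eq_le; apply/andP; split.
  apply: le_trans (op_nmM Ds Da) _; rewrite expr2; apply: ler_wpM2r.
    exact: op_nm_ge0.
  exact: op_nm_star.
apply/ler_addgt0Pr => e e0; set c := op_nm _ + e.
have c0 : 0 < c by rewrite /c ltr_wpDl // op_nm_ge0.
have [_ ha] : op_bound (od_mul (st a) a) c by apply: op_nm_bound_gt => //; rewrite /c ltrDl.
rewrite -(sqr_sqrtr (ltW c0)) lerXn2r ?nnegrE ?op_nm_ge0 ?sqrtr_ge0 //.
apply: op_nm_le; split=> [|i x]; first exact: sqrtr_ge0.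
rewrite (sqr_sqrtr (ltW c0)).
have hip := od_ipP i.
have h1 := @re_ip_le _ _ _ hip c x (act (od_mul (st a) a) x) c0.
have h2 : c^-1 * N i (act (od_mul (st a) a) x) <= c * N i x.
  by rewrite mulrC ler_pdivrMr // mulrAC -expr2.
have h3 : N i (act a x) = complex.Re (od_ip i x (act (od_mul (st a) a) x)).
  by rewrite od_actM // -od_adj.
by move: h1 h2; rewrite -h3; lra.
Qed.

Definition op_preCstar : preCstar R :=
  @PreCstar R V D (@od_mul R d) st op_nm (od_dom0 d) (@od_domL R d) (@od_domM R d)
  (@od_dom_star R d) (@od_mulA R d) (@od_mulLl R d) (@od_mulLr R d) (@od_starL R d)
  (@od_starK R d) (@od_starM R d) op_nmD op_nmZ op_nmM op_nm_sq.

End OperatorNorm.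

(** If q is the negative part of x, the functionals y |-> s(q y q) are positive and take the value -
    s(q^3) at x; hence s(q^3) is never positive and q = 0. *)
Lemma pos_of_posfun (R : realType) (A : cstarAlgType R) (e x : A) :
  is_one e -> selfadj x -> (forall s, posfun s -> 0 <= s x) -> pos x.
Proof.
move=> e1 xs h; have [p [q [hp hq ex pq qp]]] := selfadj_parts e1 xs.
have qs := pos_selfadj hq.
have q3 : pos (q *c q *c q).
  by apply: (posM e1) => //; [exists q|apply: comm_sym; exact: commM].
case: (pselect (q *c q *c q = 0)) => [/(selfadj_cube_eq0 qs) q0|/(posfun_gt0 e1 q3)[s hs s0]].
  by rewrite ex q0 subr0.
have hs' : posfun (fun y => s (q *c y *c q)).
  split=> [k y z|y]; first by rewrite cmulDr cmulDl cmulZr cmulZl (pfL hs).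
  have := hs.2 (y *c q); by rewrite cstarM qs !cmulA.
have := h _ hs'; rewrite ex cmulBr cmulBl qp cmul0l sub0r (pfN hs) oppr_ge0.
by move=> /(lt_le_trans s0); rewrite ltxx.
Qed.

(* A finite-dimensional *-algebra with a faithful positive trace and an orthonormal
   basis for it; no norm is needed. *)
Record talg (R : realType) := TAlg {
  ta_space : lmodType R[i];
  tmul : ta_space -> ta_space -> ta_space;
  tstar : ta_space -> ta_space;
  tone : ta_space;
  ttr : ta_space -> R[i];
  tdim : nat;
  tbas : 'I_tdim -> ta_space;
  tmulA : associative tmul;
  tmul1l : left_id tone tmul;
  tmul1r : right_id tone tmul;
  tmul_linl : forall y, linear (fun x => tmul x y);
  tmul_linr : forall x, linear (tmul x);
  tstar_antilin : forall k x y, tstar (k *: x + y) = conjc k *: tstar x + tstar y;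
  tstarK : involutive tstar;
  tstarM : forall x y, tstar (tmul x y) = tmul (tstar y) (tstar x);
  ttrL : forall k x y, ttr (k *: x + y) = k * ttr x + ttr y;
  ttrC : forall x y, ttr (tmul x y) = ttr (tmul y x);
  ttr_star : forall x, ttr (tstar x) = conjc (ttr x);
  tbas_span : forall x, x = \sum_k ttr (tmul (tstar (tbas k)) x) *: tbas k;
  tbas_orth : forall k l, ttr (tmul (tstar (tbas k)) (tbas l)) = (k == l)%:R }.

Section TraceAlgebra.
Variables (R : realType) (P : talg R).
Notation V := (ta_space P).
Notation n := (tdim P).
Notation "x ** y" := (tmul x y) (at level 40, left associativity).
Implicit Types (p q r : V).

Definition tcoord (p : V) (k : 'I_n) : R[i] := ttr (tstar (tbas k) ** p).

Lemma tcoordE p : p = \sum_k tcoord p k *: tbas k. Proof. exact: tbas_span. Qed.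
Lemma tcoord_bas k l : tcoord (tbas l) k = (k == l)%:R. Proof. exact: tbas_orth. Qed.

Lemma ttrD p q : ttr (p + q) = ttr p + ttr q.
Proof. by have := ttrL 1 p q; rewrite scale1r mul1r. Qed.
Lemma ttr0 : ttr (0 : V) = 0.
Proof. by apply: (@addrI _ (ttr (0 : V))); rewrite -ttrD !addr0. Qed.
Lemma ttrZ k p : ttr (k *: p) = k * ttr p.
Proof. by have := ttrL k p 0; rewrite !addr0 ttr0 addr0. Qed.
Lemma ttr_sum I (s : seq I) (Q : pred I) (F : I -> V) :
  ttr (\sum_(i <- s | Q i) F i) = \sum_(i <- s | Q i) ttr (F i).
Proof. exact: (big_morph (@ttr R P) ttrD ttr0). Qed.

Lemma tmulDr p q r : r ** (p + q) = r ** p + r ** q.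
Proof. exact: linD (tmul_linr r) _ _. Qed.
Lemma tmulZl k p r : (k *: p) ** r = k *: (p ** r).
Proof. exact: linZ (tmul_linl r) _ _. Qed.
Lemma tmulZr k p r : r ** (k *: p) = k *: (r ** p).
Proof. exact: linZ (tmul_linr r) _ _. Qed.
Lemma tmul_suml I (s : seq I) (Q : pred I) (F : I -> V) r :
  (\sum_(i <- s | Q i) F i) ** r = \sum_(i <- s | Q i) F i ** r.
Proof. exact: (lin_sum (tmul_linl r)). Qed.
Lemma tmul_sumr I (s : seq I) (Q : pred I) (F : I -> V) r :
  r ** (\sum_(i <- s | Q i) F i) = \sum_(i <- s | Q i) r ** F i.
Proof. exact: (lin_sum (tmul_linr r)). Qed.
Lemma tstarD p q : tstar (p + q) = tstar p + tstar q.
Proof. by have := tstar_antilin 1 p q; rewrite conjc1 !scale1r. Qed.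
Lemma tstar0 : tstar (0 : V) = 0.
Proof. by apply: (@addrI _ (tstar (0 : V))); rewrite -tstarD !addr0. Qed.
Lemma tstarZ k p : tstar (k *: p) = conjc k *: tstar p.
Proof. by have := tstar_antilin k p 0; rewrite !addr0 tstar0 addr0. Qed.
Lemma tstar_sum I (s : seq I) (Q : pred I) (F : I -> V) :
  tstar (\sum_(i <- s | Q i) F i) = \sum_(i <- s | Q i) tstar (F i).
Proof. exact: (big_morph (@tstar R P) tstarD tstar0). Qed.
Lemma tstar1 : tstar (tone P) = tone P.
Proof. by rewrite -[LHS]tmul1l -{1}(tstarK (tone P)) -tstarM tmul1l tstarK. Qed.

Lemma tcoordL c p q k : tcoord (c *: p + q) k = c * tcoord p k + tcoord q k.
Proof. by rewrite /tcoord tmulDr tmulZr ttrL. Qed.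

Lemma parseval p q : ttr (tstar p ** q) = \sum_k conjc (tcoord p k) * tcoord q k.
Proof.
rewrite {1}(tcoordE p) tstar_sum tmul_suml ttr_sum; apply: eq_bigr => k _.
by rewrite tstarZ tmulZl ttrZ.
Qed.

Lemma ttr_star_ge0 p : 0 <= ttr (tstar p ** p).
Proof. by rewrite parseval; apply: sumr_ge0 => k _; rewrite mulrC mulcJ_ge0. Qed.

Lemma tcoord_delta (W : lmodType R[i]) (F : 'I_n -> W) k :
  \sum_l tcoord (tbas l) k *: F l = F k.
Proof.
rewrite (bigD1 k) //= tcoord_bas eqxx scale1r big1 ?addr0 // => l /negPf h.
by rewrite tcoord_bas eq_sym h scale0r.
Qed.

(* The Casimir element [sum_k e_k (x) e_k^*]. *)
Lemma casimir (W : lmodType R[i]) (B : V -> V -> W) p :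
  (forall y, linear (fun x => B x y)) ->
  (forall x, linear (B x)) ->
  \sum_k B (tbas k ** p) (tstar (tbas k)) = \sum_k B (tbas k) (p ** tstar (tbas k)).
Proof.
move=> Bl Br.
have h1 k : B (tbas k ** p) (tstar (tbas k)) =
    \sum_l tcoord (tbas k ** p) l *: B (tbas l) (tstar (tbas k)).
  rewrite {1}[tbas k ** p]tcoordE (lin_sum (Bl _)); apply: eq_bigr => l _.
  exact: linZ (Bl _) _ _.
have h2 l : B (tbas l) (p ** tstar (tbas l)) =
    \sum_k tcoord (tbas k ** p) l *: B (tbas l) (tstar (tbas k)).
  rewrite -[p ** tstar (tbas l)]tstarK {1}[tstar (p ** _)]tcoordE tstar_sum.
  rewrite (lin_sum (Br _)); apply: eq_bigr => k _.
  rewrite tstarZ (linZ (Br _)); congr (_ *: _).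
  by rewrite /tcoord -ttr_star tstarM !tstarK ttrC tmulA [RHS]ttrC.
by rewrite (eq_bigr _ (fun k _ => h1 k)) exchange_big; apply: eq_bigr => l _.
Qed.

Section TensorAlgebra.
Variables (X : cstarAlgType R) (e : X).
Hypothesis e1 : is_one e.
(** The algebraic tensor product of P and X in coordinates: z stands for sum_k e_k (x) z_k. *)
Definition PX : Type := {ffun 'I_n -> X}.
HB.instance Definition _ := GRing.Lmodule.on PX.
Implicit Types (z w v : PX) (x y : X).

Definition pt p x : PX := [ffun k => tcoord p k *: x].
Definition pmul z w : PX := \sum_k \sum_l pt (tbas k ** tbas l) (z k *c w l).
Definition pstar z : PX := \sum_k pt (tstar (tbas k)) (cstar (z k)).

Lemma pt_linl x : linear (fun p => pt p x).
Proof. by move=> c p q; apply/ffunP => k; rewrite !ffunE tcoordL scalerDl scalerA. Qed.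
Lemma pt_linr p : linear (pt p).
Proof.
move=> c x y; apply/ffunP => k; rewrite !ffunE.
by rewrite scalerDr !scalerA mulrC.
Qed.

Lemma pt_expand z : z = \sum_k pt (tbas k) (z k).
Proof.
apply/ffunP => k; rewrite sum_ffunE -[LHS](@tcoord_delta X z).
by apply: eq_bigr => l _; rewrite ffunE.
Qed.

Lemma pmul_linl w : linear (fun z => pmul z w).
Proof.
move=> c z z'; rewrite /pmul scaler_sumr -big_split /=; apply: eq_bigr => k _.
rewrite scaler_sumr -big_split /=; apply: eq_bigr => l _.
by rewrite !ffunE cmulDl cmulZl pt_linr.
Qed.
Lemma pmul_linr z : linear (pmul z).
Proof.
move=> c w w'; rewrite /pmul scaler_sumr -big_split /=; apply: eq_bigr => k _.
rewrite scaler_sumr -big_split /=; apply: eq_bigr => l _.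
by rewrite !ffunE cmulDr cmulZr pt_linr.
Qed.

Lemma pstar_antilin c z w : pstar (c *: z + w) = conjc c *: pstar z + pstar w.
Proof.
rewrite /pstar scaler_sumr -big_split /=; apply: eq_bigr => k _.
by rewrite !ffunE cstarD cstarZ pt_linr.
Qed.

Lemma pmul_pt p q x y : pmul (pt p x) (pt q y) = pt (p ** q) (x *c y).
Proof.
rewrite [in RHS](tcoordE p) tmul_suml (lin_sum (pt_linl _)).
apply: eq_bigr => k _; rewrite tmulZl (linZ (pt_linl _)).
rewrite [in RHS](tcoordE q) tmul_sumr (lin_sum (pt_linl _)) scaler_sumr.
apply: eq_bigr => l _; rewrite tmulZr (linZ (pt_linl _)) scalerA.
by rewrite !ffunE cmulZl cmulZr scalerA (linZ (pt_linr _)).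
Qed.

Lemma pstar_pt p x : pstar (pt p x) = pt (tstar p) (cstar x).
Proof.
rewrite [in RHS](tcoordE p) tstar_sum (lin_sum (pt_linl _)); apply: eq_bigr => k _.
by rewrite tstarZ (linZ (pt_linl _)) ffunE cstarZ (linZ (pt_linr _)).
Qed.

Lemma pmul_suml I (s : seq I) (F : I -> PX) w :
  pmul (\sum_(i <- s) F i) w = \sum_(i <- s) pmul (F i) w.
Proof. exact: (lin_sum (pmul_linl w)). Qed.
Lemma pmul_sumr I (s : seq I) (F : I -> PX) w :
  pmul w (\sum_(i <- s) F i) = \sum_(i <- s) pmul w (F i).
Proof. exact: (lin_sum (pmul_linr w)). Qed.
Lemma pstarD z w : pstar (z + w) = pstar z + pstar w.
Proof. by have := pstar_antilin 1 z w; rewrite conjc1 !scale1r. Qed.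
Lemma pstar0 : pstar 0 = 0.
Proof. by apply: (@addrI _ (pstar 0)); rewrite -pstarD !addr0. Qed.
Lemma pstar_sum I (s : seq I) (F : I -> PX) :
  pstar (\sum_(i <- s) F i) = \sum_(i <- s) pstar (F i).
Proof. exact: (big_morph pstar pstarD pstar0). Qed.

Lemma pmulA : associative pmul.
Proof.
move=> z w v; rewrite (pt_expand z) (pt_expand w) (pt_expand v).
rewrite !pmul_suml; apply: eq_bigr => k _.
rewrite pmul_sumr [in RHS](pmul_sumr _ _ (pt _ _)) pmul_suml; apply: eq_bigr => l _.
rewrite !pmul_sumr; apply: eq_bigr => m _.
by rewrite !pmul_pt tmulA cmulA.
Qed.

Lemma pstarK : involutive pstar.
Proof.
move=> z; rewrite (pt_expand z) !pstar_sum; apply: eq_bigr => k _.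
by rewrite !pstar_pt tstarK cstarK.
Qed.

Lemma pstarM z w : pstar (pmul z w) = pmul (pstar w) (pstar z).
Proof.
rewrite (pt_expand z) (pt_expand w) pmul_suml !pstar_sum pmul_sumr.
apply: eq_bigr => k _; rewrite pmul_sumr pstar_sum pmul_suml.
by apply: eq_bigr => l _; rewrite pmul_pt !pstar_pt pmul_pt tstarM cstarM.
Qed.

Definition pone : PX := pt (tone P) e.
Lemma pone1l z : pmul pone z = z.
Proof.
rewrite (pt_expand z) pmul_sumr; apply: eq_bigr => k _.
by rewrite pmul_pt tmul1l (cmul1l e1).
Qed.
Lemma pone1r z : pmul z pone = z.
Proof.
rewrite (pt_expand z) pmul_suml; apply: eq_bigr => k _.
by rewrite pmul_pt tmul1r (cmul1r e1).
Qed.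

(** The form of the functional tr (x) s, computed in an orthonormal basis for tr. *)
Definition pip (s : X -> R[i]) z w : R[i] := \sum_k s (cstar (z k) *c w k).

Lemma pip_semi s : posfun s -> semi_inner (pip s).
Proof.
move=> hs; split=> [c z w v|z w|z].
- rewrite mulr_sumr -big_split /=; apply: eq_bigr => k _.
  by rewrite !ffunE cmulDr cmulZr (pfL hs).
- rewrite conjc_sum; apply: eq_bigr => k _.
  by rewrite -(pf_star hs e1) cstarM cstarK.
- by apply: sumr_ge0 => k _; exact: hs.2.
Qed.

Lemma pip_pt s p q x y : posfun s ->
  pip s (pt p x) (pt q y) = ttr (tstar p ** q) * s (cstar x *c y).
Proof.
move=> hs; rewrite parseval mulr_suml; apply: eq_bigr => k _.
by rewrite !ffunE cstarZ cmulZl cmulZr !(pfZ hs) mulrA.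
Qed.

Lemma pip_adj s a z w : posfun s -> pip s (pmul a z) w = pip s z (pmul (pstar a) w).
Proof.
move=> hs; have hip := pip_semi hs.
rewrite (pt_expand a) (pt_expand z) (pt_expand w) pmul_suml pstar_sum pmul_suml.
rewrite !(ip_suml hip) ; under eq_bigr do rewrite pmul_sumr (ip_suml hip).
under [RHS]eq_bigr do rewrite (ip_sumr hip).
rewrite exchange_big; apply: eq_bigr => k _; apply: eq_bigr => l _.
rewrite pmul_sumr !(ip_sumr hip); apply: eq_bigr => m _.
rewrite !pmul_pt !pstar_pt !pmul_pt !pip_pt //.
by rewrite tstarM cstarM !tmulA !cmulA.
Qed.

(** A crude constant: n comes twice from [sqnm_sum_le], once for each factor of a product, and the
    double sum from the multiplication table of the basis. *)
Definition pbnd2 : R :=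
  (n * n)%:R * \sum_(k < n) \sum_(l < n)
    complex.Re (ttr (tstar (tbas k ** tbas l) ** (@tbas R P k ** tbas l))).

Lemma pbnd2_ge0 : 0 <= pbnd2.
Proof.
rewrite mulr_ge0 // sumr_ge0 // => k _; rewrite sumr_ge0 // => l _.
by have := ttr_star_ge0 (tbas k ** tbas l); rewrite lecE => /andP[].
Qed.

Lemma pip_bound s a z : posfun s ->
  sqnm (pip s) (pmul a z) <=
  (Num.sqrt pbnd2 * \sum_k nm (a k)) ^+ 2 * sqnm (pip s) z.
Proof.
move=> hs; have hip := pip_semi hs.
rewrite exprMn sqr_sqrtr ?pbnd2_ge0 //.
set T := \sum_k nm (a k).
have aT k : nm (a k) <= T.
  by rewrite /T (bigD1 k) //= lerDl sumr_ge0 // => j _; exact: nm_ge0.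
have T2 : forall k, nm (a k) ^+ 2 <= T ^+ 2.
  by move=> k; rewrite lerXn2r ?nnegrE ?nm_ge0 // (le_trans (nm_ge0 (a k))).
move: {aT} (T ^+ 2) T2 => T2 aT.
apply: le_trans (sqnm_sum_le hip _) _.
rewrite /pbnd2 natrM -!mulrA; apply: ler_wpM2l => //.
have step k : sqnm (pip s) (\sum_l pt (tbas k ** tbas l) (a k *c z l)) <=
   n%:R * ((\sum_l complex.Re (ttr (tstar (tbas k ** tbas l) ** (tbas k ** tbas l)))) *
     (T2 * sqnm (pip s) z)).
  apply: le_trans (sqnm_sum_le hip _) _; apply: ler_wpM2l => //.
  rewrite mulr_suml; apply: ler_sum => l _.
  set t := ttr _; have t0 : 0 <= t by exact: ttr_star_ge0.
  have tr0 : 0 <= complex.Re t by rewrite -ler0c -ge0_complexE.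
  rewrite -lecR -(sqnmE hip) pip_pt // -/t rmorphM /= -(ge0_complexE t0).
  apply: ler_wpM2l => //.
  rewrite cstarM cmulA -[cstar (z l) *c _ *c a k]cmulA.
  apply: le_trans (pf_conj hs e1 _ _) _; rewrite [leRHS]real_complexM.
  apply: ler_pM.
  - by rewrite ler0c sqr_ge0.
  - exact: hs.2.
  - by rewrite lecR.
  - rewrite -(sqnmE hip) [leRHS](bigD1 l) //= lerDl; apply: sumr_ge0 => j _.
    exact: hs.2.
apply: le_trans (ler_sum _ (fun k _ => step k)) _.
by rewrite -mulr_sumr -mulr_suml.
Qed.

Lemma pip_one s : posfun s -> sqnm (pip s) pone = complex.Re (ttr (tone P) * s e).
Proof.
by move=> hs; rewrite /sqnm pip_pt // tstar1 tmul1l (cstar_one e1) (cmul1l e1).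
Qed.

Lemma pip_bounded a : exists2 c : R, 0 <= c &
  forall (s : {s : X -> R[i] | posfun s}) z,
    sqnm (pip (sval s)) (pmul a z) <= c ^+ 2 * sqnm (pip (sval s)) z.
Proof.
exists (Num.sqrt pbnd2 * \sum_k nm (a k)).
  by rewrite mulr_ge0 ?sqrtr_ge0 // sumr_ge0 // => k _; exact: nm_ge0.
by move=> s z; exact: pip_bound (svalP s).
Qed.

(** Multiplication operators, with one form for each positive functional s on X. Taking all the s at
    once stands in for a faithful representation of X. *)
Definition pt_opdata : opdata R := {|
  od_space := PX; od_dom := setT; od_mul := pmul; od_star := pstar;
  od_dom0 := I; od_domL := fun _ _ _ _ _ => I; od_domM := fun _ _ _ _ => I;
  od_dom_star := fun _ _ => I;
  od_mulA := fun a b c _ _ _ => pmulA a b c;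
  od_mulLl := fun k a b c _ _ _ => pmul_linl c k a b;
  od_mulLr := fun k a b c _ _ _ => pmul_linr c k a b;
  od_starL := fun k a b _ _ => pstar_antilin k a b;
  od_starK := fun a _ => pstarK a;
  od_starM := fun a b _ _ => pstarM a b;
  od_vec := PX; od_idx := {s : X -> R[i] | posfun s};
  od_ip := fun s => pip (sval s);
  od_ipP := fun s => pip_semi (svalP s);
  od_act := pmul;
  od_actL := fun k a b c _ _ => pmul_linl c k a b;
  od_actM := fun a b c _ _ => esym (pmulA a b c);
  od_adj := fun s a b c _ => pip_adj a b c (svalP s);
  od_bnd := fun a _ => pip_bounded a |}.

Definition ptensor : cstarAlgType R := completion (op_preCstar pt_opdata).
Definition ptj (z : PX) : ptensor := @cinj R (op_preCstar pt_opdata) z.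
Definition ptens p x : ptensor := ptj (pt p x).

Lemma ptj_lin : linear ptj.
Proof. by move=> k z w; exact: (@cinjL R (op_preCstar pt_opdata)). Qed.
Lemma ptjM z w : ptj (pmul z w) = ptj z *c ptj w.
Proof. exact: (@cinjM R (op_preCstar pt_opdata)). Qed.
Lemma ptj_star z : ptj (pstar z) = cstar (ptj z).
Proof. exact: (@cinj_star R (op_preCstar pt_opdata)). Qed.
Lemma nm_ptj z : nm (ptj z) = @op_nm R pt_opdata z.
Proof. exact: (@nm_cinj R (op_preCstar pt_opdata)). Qed.

Lemma ptj_one : is_one (ptj pone).
Proof.
apply: (@cinj_unit R (op_preCstar pt_opdata)) => // a _.
by split; [exact: pone1l|exact: pone1r].
Qed.

Lemma nm_ptj_le z : nm (ptj z) <= Num.sqrt pbnd2 * \sum_k nm (z k).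
Proof.
rewrite nm_ptj; apply: op_nm_le; split.
  by rewrite mulr_ge0 ?sqrtr_ge0 // sumr_ge0 // => k _; exact: nm_ge0.
by move=> s x; exact: pip_bound (svalP s).
Qed.

(** Apply z to the vector 1 (x) 1, whose square norm for tr (x) s is tr(1) s(1). The resulting bound
    on s(z_k^* z_k) holds for all s, hence in X by [pos_of_posfun]. *)
Lemma coef_le_nm_ptj z k :
  nm (z k) ^+ 2 <= nm (ptj z) ^+ 2 * complex.Re (ttr (tone P)).
Proof.
have t0 : 0 <= ttr (tone P) by have := ttr_star_ge0 (tone P); rewrite tstar1 tmul1l.
have tr0 : 0 <= complex.Re (ttr (tone P)) by rewrite -ler0c -ge0_complexE.
set c := _ * complex.Re _; have c0 : 0 <= c by rewrite mulr_ge0 // sqr_ge0.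
rewrite -nm_sq; apply: (nm_le_of_pos e1) => //; first exact: pos_star_mul e1 _.
apply: (pos_of_posfun e1).
  apply: selfadjB; last exact: selfadj_sq.
  by apply: selfadjZ; exact: selfadj_one.
move=> s hs; rewrite (pfB hs) (pfZ hs) subr_ge0.
have hip := pip_semi hs.
have := @op_nmP R pt_opdata z (exist _ s hs) pone I; rewrite /= pone1r pip_one //.
rewrite -nm_ptj => h.
have h1 : s (cstar (z k) *c z k) <= (sqnm (pip s) z)%:C.
  rewrite -(sqnmE hip) [leRHS](bigD1 k) //= lerDl; apply: sumr_ge0 => j _.
  exact: hs.2.
apply: (le_trans h1); rewrite /c real_complexM -mulrA -(ge0_complexE t0).
rewrite [ttr (tone P) * _]ge0_complexE.
  by rewrite -real_complexM lecR.
by apply: mulr_ge0 => //; have := hs.2 e; rewrite (cstar_one e1) (cmul1l e1).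
Qed.

Lemma ptj_inj z : ptj z = 0 -> z = 0.
Proof.
move=> h; apply/ffunP => k; rewrite ffunE; apply: nm_le0.
have := coef_le_nm_ptj z k; rewrite h nm0 expr0n mul0r => h2.
have : nm (z k) ^+ 2 == 0 by rewrite eq_le h2 sqr_ge0.
by rewrite sqrf_eq0 => /eqP ->.
Qed.

(** Coordinates are continuous by [coef_le_nm_ptj], and finitely many convergent coordinates give
    convergence by [nm_ptj_le]; so completing adds nothing. *)
Lemma ptj_onto (t : ptensor) : exists z, t = ptj z.
Proof.
have tr0 : 0 <= complex.Re (ttr (tone P)).
  rewrite -ler0c -ge0_complexE; have := ttr_star_ge0 (tone P);
  by rewrite tstar1 tmul1l.
have [|z _ ->] := @cinj_onto R (op_preCstar pt_opdata) _ t; last by exists z.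
move=> u [_ cu].
(* Adding 1 makes tau positive even if P = 0, and makes tau^2 at least tr(1). *)
pose tau := complex.Re (ttr (tone P)) + 1.
have tau0 : 0 < tau by rewrite /tau ltr_wpDl.
have hk k : exists l : X, tendsto (fun m => u m k) l.
  apply: cauchy_nm_tendsto => r r0.
  have [N hN] := cu _ (divr_gt0 r0 tau0); exists N => i j hi hj.
  have h1 := coef_le_nm_ptj (u i - u j) k; rewrite nm_ptj !ffunE in h1.
  have h2 := hN i j hi hj; rewrite /= ltr_pdivlMr // in h2.
  set q := op_nm _ in h1 h2; have q0 : 0 <= q by exact: (@op_nm_ge0 R pt_opdata).
  rewrite -(ltr_pXn2r (ltn0Sn 1)) ?nnegrE ?nm_ge0 ?ltW //.
  apply: (le_lt_trans h1); apply: (le_lt_trans (_ : _ <= (q * tau) ^+ 2)).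
    rewrite exprMn; apply: ler_wpM2l; first exact: sqr_ge0.
    by rewrite /tau expr2; nra.
  by rewrite ltr_pXn2r ?nnegrE ?mulr_ge0 ?(ltW tau0) ?(ltW r0).
have /choice[l hl] := hk.
exists [ffun k => l k] => // r r0.
pose K := Num.sqrt pbnd2 * n%:R + 1.
have K0 : 0 < K by rewrite /K ltr_wpDl // mulr_ge0 // sqrtr_ge0.
have rK : 0 < r / K by rewrite divr_gt0.
have /choice[N hN] : forall k, exists N, forall m, (N <= m)%N -> nm (u m k - l k) < r / K.
  by move=> k; exact: hl.
exists (\max_k N k) => m hm.
rewrite -[X in X < _](@nm_ptj (u m - [ffun k => l k])).
apply: le_lt_trans (nm_ptj_le _) _.
have : \sum_k nm ((u m - [ffun k => l k]) k) <= n%:R * (r / K).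
  rewrite -[n in n%:R]card_ord mulr_natl -sumr_const; apply: ler_sum => k _.
  by rewrite !ffunE ltW //; apply: hN; apply: leq_trans hm; exact: leq_bigmax.
move=> /(ler_wpM2l (sqrtr_ge0 pbnd2)) h; apply: (le_lt_trans h).
rewrite !mulrA ltr_pdivrMr // mulrC ltr_pM2l // /K; lra.
Qed.

End TensorAlgebra.
End TraceAlgebra.

(** * Finite-dimensional C*-algebras *)

Section FiniteDimension.
Variables (R : realType) (P : cstarAlgType R).
Hypothesis findim : finite_dimensional P.

Lemma lin_indep_bounded : exists n, forall r (a : 'I_r -> P), lin_indep a -> (r <= n)%N.
Proof.
have [n [e he]] := findim; exists n => r a ha; rewrite leqNgt; apply/negP => hr.
have /choice[c hc] := fun i => he (a i).
pose M : 'M[R[i]]_(r, n) := \matrix_(i, j) c i j.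
have /rowV0Pn[v vM v0] : kermx M != 0.
  by rewrite -mxrank_eq0 mxrank_ker subn_eq0 -ltnNge (leq_ltn_trans (rank_leq_col _)).
case/eqP: v0; apply/rowP => i; rewrite mxE; apply: (ha (fun i => v 0 i)).
have vM0 : v *m M = 0 by apply/sub_kermxP.
under eq_bigr => j _ do rewrite hc scaler_sumr.
rewrite exchange_big big1 // => k _.
under eq_bigr => j _ do rewrite scalerA.
rewrite -scaler_suml; have /rowP/(_ k) := vM0; rewrite !mxE => h.
rewrite [X in X *: _](_ : _ = 0) ?scale0r // -[RHS]h.
by apply: eq_bigr => j _; rewrite mxE.
Qed.

Definition subsp (U : P -> Prop) :=
  U 0 /\ forall k x y, U x -> U y -> U (k *: x + y).

Lemma subsp_sum U n (c : 'I_n -> R[i]) (a : 'I_n -> P) : subsp U ->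
  (forall i, U (a i)) -> U (\sum_i c i *: a i).
Proof.
move=> [U0 UL] h; apply: (big_ind U) => //.
  by move=> x y hx hy; rewrite -[x]scale1r; exact: UL.
by move=> i _; rewrite -[_ *: _]addr0; exact: UL.
Qed.

Definition has_indep (U : P -> Prop) r :=
  exists2 a : 'I_r -> P, lin_indep a & forall i, U (a i).

Lemma dim_exists U : exists r, has_indep U r /\ forall r', has_indep U r' -> (r' <= r)%N.
Proof.
have [n hn] := lin_indep_bounded.
have h0 : `[< has_indep U 0 >].
  by apply/asboolP; exists (fun i : 'I_0 => 0) => [c _ []|[]].
have hb r : `[< has_indep U r >] -> (r <= n)%N.
  by move=> /asboolP[a /hn].
have hex : exists r, `[< has_indep U r >] by exists 0%N.
case: (ex_maxnP hex hb) => r /asboolP hr hmax; exists r; split => // r' hr'.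
by apply: hmax; apply/asboolP.
Qed.

Definition sdim U : nat := projT1 (cid (dim_exists U)).
Lemma sdimP U : has_indep U (sdim U) /\ forall r, has_indep U r -> (r <= sdim U)%N.
Proof. exact: (projT2 (cid (dim_exists U))). Qed.

Lemma sdim_lt U U' x : subsp U -> (forall y, U y -> U' y) -> U' x -> ~ U x ->
  (sdim U < sdim U')%N.
Proof.
move=> sU UU' U'x nUx; have [[a ia Ua] _] := sdimP U; have [_ hmax] := sdimP U'.
apply: hmax; exists (fun i => if unlift ord_max i is Some j then a j else x); last first.
  by move=> i; case: unliftP => [j _|_] //; exact: UU'.
move=> c; rewrite big_ord_recr /= unlift_none => h.
have hw (i : 'I_(sdim U)) : unlift ord_max (widen_ord (leqnSn _) i) = Some i.
  by rewrite (_ : widen_ord _ i = lift ord_max i) ?liftK //; apply: val_inj;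
    rewrite /= /bump leqNgt ltn_ord.
have {}h : \sum_(i < sdim U) c (widen_ord (leqnSn _) i) *: a i + c ord_max *: x = 0.
  by rewrite -[RHS]h; congr (_ + _); apply: eq_bigr => i _; rewrite hw.
have c0 : c ord_max = 0.
  apply/eqP/negPn/negP => cn0; apply: nUx.
  have -> : x = (- (c ord_max)^-1) *: \sum_(i < sdim U) c (widen_ord (leqnSn _) i) *: a i.
    have /eqP := h; rewrite addr_eq0 => /eqP ->.
    by rewrite scaleNr scalerN opprK scalerA mulVf // scale1r.
  rewrite -[_ *: _]addr0; apply: sU.2 (sU.1); exact: subsp_sum.
move: h; rewrite c0 scale0r addr0 => /ia hc i.
case: (unliftP ord_max i) => [j ->|->] //; rewrite -(hc j); congr c.
by apply: val_inj; rewrite /= /bump leqNgt ltn_ord.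
Qed.

Lemma nat_minimal (T : Type) (Q : T -> Prop) (mu : T -> nat) : (exists x, Q x) ->
  exists2 x, Q x & forall y, Q y -> (mu x <= mu y)%N.
Proof.
move=> [x0 Qx0].
have hex : exists m, `[< exists2 x, Q x & mu x = m >].
  by exists (mu x0); apply/asboolP; exists x0.
case: (ex_minnP hex) => m /asboolP[x Qx <-] hm; exists x => // y Qy.
by apply: hm; apply/asboolP; exists y.
Qed.

Variable u : P.
Hypothesis u1 : is_one u.

Lemma posfunD (s s' : P -> R[i]) : posfun s -> posfun s' -> posfun (fun x => s x + s' x).
Proof.
move=> hs hs'; split=> [k x y|x]; last by rewrite addr_ge0 // ?hs.2 ?hs'.2.
by rewrite (pfL hs) (pfL hs') mulrDr addrACA.
Qed.

Definition pf_ip (s : P -> R[i]) x y := s (cstar x *c y).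

Lemma pf_semi (s : P -> R[i]) : posfun s -> semi_inner (pf_ip s).
Proof.
move=> hs; rewrite /pf_ip; split=> [k x y z|x y|x]; last exact: hs.2.
- by rewrite cmulDr cmulZr (pfL hs).
- by rewrite -(pf_star hs u1) cstarM cstarK.
Qed.

End FiniteDimension.

Section SemiInnerNull.
Variables (R : realType) (W : lmodType R[i]) (ip : W -> W -> R[i]).
Hypothesis hip : semi_inner ip.

(** The weighted inequality with a small weight gives Re <y, z> <= 0 for every y; -y and i y give
    the rest. *)
Lemma ip_null x z : sqnm ip z = 0 -> ip x z = 0.
Proof.
move=> hz.
have hre y : complex.Re (ip y z) <= 0.
  apply/ler_addgt0Pr => e e0; rewrite add0r.
  pose t := e / (sqnm ip y + 1).
  have n0 := sqnm_ge0 hip y.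
  have d0 : 0 < sqnm ip y + 1 by rewrite ltr_wpDl.
  have t0 : 0 < t by rewrite divr_gt0.
  have := re_ip_le hip y z t0; rewrite hz mulr0 addr0 => h.
  have : t * sqnm ip y <= e.
    by rewrite /t mulrAC ler_pdivrMr // ler_pM2l // lerDl.
  by lra.
have hre0 y : complex.Re (ip y z) = 0.
  apply/eqP; rewrite eq_le hre /=; have := hre (- y).
  by rewrite (ipNl hip) raddfN /= oppr_le0.
have h1 := hre0 x; have := hre0 ('i *: x).
rewrite (ipZl hip); move: h1; case: (ip x z) => a b /= ->.
by rewrite mulr0 sub0r mulN1r opprK => ->.
Qed.

Lemma sqnm_null_sum n (k : 'I_n -> R[i]) (z : 'I_n -> W) :
  (forall i, sqnm ip (z i) = 0) -> sqnm ip (\sum_i k i *: z i) = 0.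
Proof.
move=> h; apply/eqP; rewrite eq_le (sqnm_ge0 hip) andbT.
apply: le_trans (sqnm_sum_le hip _) _.
by rewrite big1 ?mulr0 // => i _; rewrite (sqnmZ hip) h mulr0.
Qed.

(** As the form may be degenerate, a vector whose remainder is null is dropped, and the given
    vectors are spanned only up to null vectors. *)
Lemma gram_schmidt m (v : 'I_m -> W) :
  exists r (w : 'I_r -> W), (forall i j, ip (w i) (w j) = (i == j)%:R) /\
    forall i, sqnm ip (v i - \sum_k ip (w k) (v i) *: w k) = 0.
Proof.
elim: m v => [|m ih] v; first by exists 0%N, (fun=> 0); split=> [[]|[]].
have [r [w [hw hv]]] := ih (fun i => v (lift ord_max i)).
pose x := v ord_max; pose y := x - \sum_k ip (w k) x *: w k.
have wy j : ip (w j) y = 0.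
  rewrite /y (ipBr hip) (ip_sumr hip) (bigD1 j) //= (ipZr hip) hw eqxx mulr1.
  rewrite big1 ?addr0 ?subrr // => k hk.
  by rewrite (ipZr hip) hw eq_sym (negPf hk) mulr0.
case: (eqVneq (sqnm ip y) 0) => hy.
  by exists r, w; split => // i; case: (unliftP ord_max i) => [j ->|->].
have y0 : 0 < sqnm ip y by rewrite lt_def hy (sqnm_ge0 hip).
pose c := (Num.sqrt (sqnm ip y))^-1.
have cc : c * c * sqnm ip y = 1.
  rewrite /c -invfM -expr2 sqr_sqrtr ?mulVf //; exact: ltW.
pose z := c%:C *: y.
pose w' i := if unlift ord_max i is Some j then w j else z.
have w'l (j : 'I_r) : w' (widen_ord (leqnSn _) j) = w j.
  rewrite /w' (_ : widen_ord _ j = lift ord_max j) ?liftK //; apply: val_inj.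
  by rewrite /= /bump leqNgt ltn_ord.
have w'm : w' ord_max = z by rewrite /w' unlift_none.
have wz j : ip (w j) z = 0 by rewrite (ipZr hip) wy mulr0.
have zw j : ip z (w j) = 0 by rewrite (ipC hip) wz conjc0.
exists r.+1, w'; split.
  move=> i j; rewrite /w'.
  case: (unliftP ord_max i) => [i' ->|->]; case: (unliftP ord_max j) => [j' ->|->] /=.
  - by rewrite hw (inj_eq (lift_inj (h := ord_max))).
  - by rewrite wz eq_sym (negPf (neq_lift _ _)).
  - by rewrite zw (negPf (neq_lift _ _)).
  - rewrite (ipZl hip) (ipZr hip) conjc_real (sqnmE hip) -!real_complexM.
    by rewrite mulrA cc eqxx.
move=> i; rewrite big_ord_recr /= w'm; under eq_bigr do rewrite w'l.
case: (unliftP ord_max i) => [j ->|->].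
  set q := v (lift ord_max j); set S := \sum_k _.
  have -> : ip z q = 0.
    have -> : q = S + (q - S) by rewrite addrCA subrr addr0.
    rewrite (ipDr hip) (ip_null _ (hv j)) addr0 /S (ip_sumr hip) big1 // => k _.
    by rewrite (ipZr hip) zw mulr0.
  by rewrite scale0r addr0 hv.
rewrite -/x opprD addrA -/y.
have -> : ip z x = ip z y.
  rewrite /y (ipBr hip) (ip_sumr hip) big1 ?subr0 // => k _.
  by rewrite (ipZr hip) zw mulr0.
have -> : ip z y *: z = y.
  by rewrite /z (ipZl hip) conjc_real (sqnmE hip) scalerA -!real_complexM mulrAC cc scale1r.
by rewrite subrr (sqnm0 hip).
Qed.

End SemiInnerNull.

(** * The regular trace of a finite-dimensional C*-algebra *)

Section RegularTrace.
Variables (R : realType) (P : cstarAlgType R).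
Hypothesis findim : finite_dimensional P.
Variable u : P.
Hypothesis u1 : is_one u.
Implicit Types (s : P -> R[i]) (x y : P).

Definition faithful s := posfun s /\ forall x, s (cstar x *c x) = 0 -> x = 0.

Lemma pf_null_subsp s : posfun s -> subsp (fun x => s (cstar x *c x) = 0).
Proof.
move=> hs; have hip := pf_semi u1 hs; split; first by rewrite cmul0r (pf0 hs).
move=> k x y hx hy.
have nx : sqnm (pf_ip s) (k *: x) = 0 by rewrite (sqnmZ hip) /sqnm /pf_ip hx mulr0.
have ny : sqnm (pf_ip s) y = 0 by rewrite /sqnm /pf_ip hy.
rewrite -[LHS]/(pf_ip s (k *: x + y) (k *: x + y)) (sqnmE hip) (sqnmD hip) nx ny.
by rewrite (ip_null hip _ ny) mulr0 !addr0.
Qed.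

(** Take a positive functional whose null space has the least dimension. If x were a nonzero null
    vector, adding a functional positive at x^* x would shrink the null space strictly. *)
Lemma faithful_exists : exists s, faithful s.
Proof.
pose mu s := sdim findim (fun x => s (cstar x *c x) = 0).
have [|s hs smin] := @nat_minimal _ (fun s => posfun s) mu.
  by exists (fun=> 0); split=> [k x y|x //]; rewrite mulr0 addr0.
exists s; split => // x hx; apply: contrapT => x0.
have x20 : cstar x *c x <> 0 by move=> /cstar_mul_eq0.
have [s' hs' sx] := posfun_gt0 u1 (pos_star_mul u1 x) x20.
have hss := posfunD hs hs'; have := smin _ hss; rewrite leqNgt => /negP; apply.
apply: (@sdim_lt _ _ findim _ _ x) => //=.
- exact: (pf_null_subsp hss).
- move=> y /eqP; rewrite paddr_eq0 ?hs.2 ?hs'.2 // => /andP[/eqP //].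
- by rewrite hx add0r => h; rewrite h ltxx in sx.
Qed.

Lemma orthonormal_basis s : faithful s ->
  exists r (w : 'I_r -> P), (forall i j, s (cstar (w i) *c w j) = (i == j)%:R) /\
    forall x, x = \sum_k s (cstar (w k) *c x) *: w k.
Proof.
move=> [hs sf]; have hip := pf_semi u1 hs; have [m [v hv]] := findim.
have [r [w [hw hn]]] := gram_schmidt hip v; exists r, w; split => // x.
have ev i : v i = \sum_k s (cstar (w k) *c v i) *: w k.
  apply/eqP; rewrite -subr_eq0; apply/eqP; apply: sf.
  by have := hn i; set z := _ - _ => hz; rewrite -[LHS]/(pf_ip s z z) (sqnmE hip) hz.
have [c ->] := hv x; under [RHS]eq_bigr do rewrite cmul_sumr (pf_sum hs) scaler_suml.
rewrite exchange_big; apply: eq_bigr => i _; rewrite {1}(ev i) scaler_sumr.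
by apply: eq_bigr => k _; rewrite cmulZr (pfZ hs) scalerA.
Qed.

Definition base_state : P -> R[i] := projT1 (cid faithful_exists).
Lemma base_state_faithful : faithful base_state.
Proof. exact: (projT2 (cid faithful_exists)). Qed.

(** When w is an orthonormal basis for s, this is the trace of left multiplication by x; hence it
    does not depend on s, as [trace_from_basis] shows. *)
Definition trace_from s r (w : 'I_r -> P) x := \sum_k s (cstar (w k) *c x *c w k).

Lemma trace_from_posfun s r (w : 'I_r -> P) : posfun s -> posfun (trace_from s w).
Proof.
move=> hs; split=> [k x y|x].
  rewrite mulr_sumr -big_split; apply: eq_bigr => i _.
  by rewrite cmulDr cmulDl cmulZr cmulZl (pfL hs).
apply: sumr_ge0 => k _; have := hs.2 (x *c w k).
by rewrite cstarM !cmulA.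
Qed.

Section Bases.
Variables (s : P -> R[i]) (r : nat) (w : 'I_r -> P).
Hypotheses (hs : posfun s) (hw : forall x, x = \sum_k s (cstar (w k) *c x) *: w k).

Lemma trace_fromC x y : trace_from s w (x *c y) = trace_from s w (y *c x).
Proof.
have h a b : trace_from s w (a *c b) =
    \sum_k \sum_l s (cstar (w l) *c b *c w k) * s (cstar (w k) *c a *c w l).
  apply: eq_bigr => k _; rewrite -!cmulA {1}[b *c w k]hw !cmul_sumr (pf_sum hs).
  by apply: eq_bigr => l _; rewrite !cmulZr (pfZ hs) !cmulA.
rewrite !h exchange_big; apply: eq_bigr => k _; apply: eq_bigr => l _.
by rewrite mulrC.
Qed.

Lemma trace_from_faithful : (forall x, s (cstar x *c x) = 0 -> x = 0) ->
  faithful (trace_from s w).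
Proof.
move=> sf; split; first exact: trace_from_posfun.
move=> x /eqP; rewrite psumr_eq0; last first.
  move=> k _; have := hs.2 (x *c w k); by rewrite cstarM !cmulA.
move=> /allP h; have xw k : x *c w k = 0.
  apply: sf; rewrite cstarM !cmulA; apply/eqP.
  by have := h k (mem_index_enum k); rewrite cmulA.
by rewrite -[x](cmul1r u1) [u]hw cmul_sumr big1 // => k _; rewrite cmulZr xw scaler0.
Qed.

(* Both sides are the trace of left multiplication by x. *)
Lemma trace_from_basis t n (e : 'I_n -> P) : posfun t ->
  (forall x, x = \sum_k t (cstar (e k) *c x) *: e k) ->
  forall x, trace_from t e x = trace_from s w x.
Proof.
move=> ht he x; symmetry.
transitivity (\sum_k \sum_l t (cstar (e l) *c x *c w k) * s (cstar (w k) *c e l)).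
  apply: eq_bigr => k _; rewrite -cmulA {1}[x *c w k]he cmul_sumr (pf_sum hs).
  by apply: eq_bigr => l _; rewrite cmulZr (pfZ hs) cmulA.
rewrite exchange_big; apply: eq_bigr => l _.
rewrite [X in _ = t (_ *c X)]hw cmul_sumr (pf_sum ht); apply: eq_bigr => k _.
by rewrite cmulZr (pfZ ht) mulrC.
Qed.

End Bases.

Let bs := base_state_faithful.
Definition base_rank : nat := projT1 (cid (orthonormal_basis bs)).
Definition base_vec : 'I_base_rank -> P :=
  projT1 (cid (projT2 (cid (orthonormal_basis bs)))).
Lemma base_vec_span x : x = \sum_k base_state (cstar (base_vec k) *c x) *: base_vec k.
Proof. exact: (projT2 (cid (projT2 (cid (orthonormal_basis bs))))).2. Qed.

Definition ftrace := trace_from base_state base_vec.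
Lemma ftrace_faithful : faithful ftrace.
Proof. by apply: trace_from_faithful; [exact: bs.1|exact: base_vec_span|exact: bs.2]. Qed.

(** The basis is now orthonormal for the regular trace itself, not for [base_state], from which that
    trace was computed. *)
Definition fdim : nat := projT1 (cid (orthonormal_basis ftrace_faithful)).
Definition fbas : 'I_fdim -> P :=
  projT1 (cid (projT2 (cid (orthonormal_basis ftrace_faithful)))).
Lemma fbas_orth i j : ftrace (cstar (fbas i) *c fbas j) = (i == j)%:R.
Proof. exact: (projT2 (cid (projT2 (cid (orthonormal_basis ftrace_faithful))))).1. Qed.
Lemma fbas_span x : x = \sum_k ftrace (cstar (fbas k) *c x) *: fbas k.
Proof. exact: (projT2 (cid (projT2 (cid (orthonormal_basis ftrace_faithful))))).2. Qed.

Lemma ftraceC x y : ftrace (x *c y) = ftrace (y *c x).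
Proof. by apply: trace_fromC; [exact: bs.1|exact: base_vec_span]. Qed.

Definition fin_talg : talg R := {|
  ta_space := P; tmul := @cmul R P; tstar := @cstar R P; tone := u; ttr := ftrace;
  tdim := fdim; tbas := fbas; tmulA := @cmulA R P;
  tmul1l := cmul1l u1; tmul1r := cmul1r u1;
  tmul_linl := @cmul_linearl R P; tmul_linr := @cmul_linearr R P;
  tstar_antilin := @cstar_antilinear R P; tstarK := @cstarK R P;
  tstarM := @cstarM R P; ttrL := pfL ftrace_faithful.1; ttrC := ftraceC;
  ttr_star := pf_star ftrace_faithful.1 u1;
  tbas_span := fbas_span; tbas_orth := fbas_orth |}.

Lemma ftrace_regular x : ftrace x = \sum_k ftrace (cstar (fbas k) *c x *c fbas k).
Proof.
have h := trace_from_basis bs.1 base_vec_span ftrace_faithful.1 fbas_span x.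
by rewrite -[LHS]h.
Qed.

Lemma sum_fbas_mul_star : \sum_k fbas k *c cstar (fbas k) = u.
Proof.
have ht := ftrace_faithful.1.
apply/eqP; rewrite -subr_eq0; apply/eqP; apply: ftrace_faithful.2.
set z := _ - u; rewrite {2}/z cmulBr (pfB ht) (cmul1r u1) [X in _ - X]ftrace_regular.
rewrite cmul_sumr (pf_sum ht) -sumrB big1 // => k _.
by rewrite cmulA ftraceC cmulA subrr.
Qed.

Lemma sum_star_fbas_mul : \sum_k cstar (fbas k) *c fbas k = u.
Proof.
rewrite -sum_fbas_mul_star.
have ht := ftrace_faithful.1.
under eq_bigr do rewrite [cstar (fbas _)]fbas_span cmul_suml.
rewrite exchange_big; apply: eq_bigr => l _.
rewrite [in RHS](fbas_span (cstar (fbas l))) cmul_sumr; apply: eq_bigr => k _.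
by rewrite cmulZl cmulZr -cstarM -[in RHS]cstarM !(pf_star ht u1) ftraceC.
Qed.

End RegularTrace.

(** * Tensor products with a finite-dimensional C*-algebra *)

Section SubCstarAlgebra.
Variables (R : realType) (T : cstarAlgType R) (D : set T).
Hypothesis D0 : D 0.
Hypothesis DL : forall k x y, D x -> D y -> D (k *: x + y).
Hypothesis DM : forall x y, D x -> D y -> D (x *c y).
Hypothesis Ds : forall x, D x -> D (cstar x).

Definition sub_preCstar : preCstar R := {|
  pc_space := T; pc_dom := D; pc_mul := @cmul R T; pc_star := @cstar R T;
  pc_nm := @nm R T; pc_dom0 := D0; pc_domL := DL; pc_domM := DM; pc_dom_star := Ds;
  pc_mulA := fun x y z _ _ _ => cmulA x y z;
  pc_mulLl := fun k x y z _ _ _ => cmul_linearl z k x y;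
  pc_mulLr := fun k x y z _ _ _ => cmul_linearr z k x y;
  pc_starL := fun k x y _ _ => cstar_antilinear k x y;
  pc_starK := fun x _ => cstarK x;
  pc_starM := fun x y _ _ => cstarM x y;
  pc_nmD := fun x y _ _ => nmD x y;
  pc_nmZ := fun k x _ => nmZ k x;
  pc_nmM := fun x y _ _ => nmM x y;
  pc_nm_sq := fun x _ => nm_sq x |}.

(** Completing turns a *-subalgebra D into a type with C*-algebra structure; for closed D nothing is
    added, by [sub_in_onto]. *)
Definition sub_alg : cstarAlgType R := completion sub_preCstar.
Definition sub_in (x : T) : sub_alg := @cinj R sub_preCstar x.

Lemma sub_inL k x y : D x -> D y -> sub_in (k *: x + y) = k *: sub_in x + sub_in y.
Proof. exact: (@cinjL R sub_preCstar). Qed.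
Lemma sub_inM x y : D x -> D y -> sub_in (x *c y) = sub_in x *c sub_in y.
Proof. exact: (@cinjM R sub_preCstar). Qed.
Lemma sub_in_star x : D x -> sub_in (cstar x) = cstar (sub_in x).
Proof. exact: (@cinj_star R sub_preCstar). Qed.
Lemma nm_sub_in x : D x -> nm (sub_in x) = nm x.
Proof. exact: (@nm_cinj R sub_preCstar). Qed.
Lemma sub_in_unit q : D q -> (forall x, D x -> q *c x = x /\ x *c q = x) ->
  is_one (sub_in q).
Proof. exact: (@cinj_unit R sub_preCstar). Qed.

Lemma sub_in_onto : (forall (v : nat -> T) l, (forall n, D (v n)) -> tendsto v l -> D l) ->
  forall x : sub_alg, exists2 a, D a & x = sub_in a.
Proof.
move=> cD; apply: (@cinj_onto R sub_preCstar) => v [Dv cv].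
have [l hl] := @cauchy_nm_tendsto R T v cv.
by exists l; [exact: cD Dv hl|exact: hl].
Qed.

End SubCstarAlgebra.

Section StarHomIsometry.
Variables (R : realType) (A B : cstarAlgType R) (f : A -> B) (e : A).
Hypotheses (hf : star_hom f) (e1 : is_one e) (finj : injective f).

(** Here f(e) need not be a unit of B, so f is viewed as a map into the corner of f(e), where it is
    unital and [nm_hom_inj] applies. *)
Lemma nm_star_hom_inj x : nm (f x) = nm x.
Proof.
pose q := f e.
have qf y : q *c f y = f y by rewrite -(homM hf) (cmul1l e1).
have fq y : f y *c q = f y by rewrite -(homM hf) (cmul1r e1).
have qs : cstar q = q by rewrite -(hom_star hf) (cstar_one e1).
pose D : set B := [set y | q *c y = y /\ y *c q = y].
have D0 : D 0 by rewrite /D /= cmul0l cmul0r.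
have DL k y z : D y -> D z -> D (k *: y + z).
  by move=> [a b] [c d]; rewrite /D /= cmulDl cmulDr cmulZl cmulZr a b c d.
have DM y z : D y -> D z -> D (y *c z).
  by move=> [a b] [c d]; rewrite /D /= cmulA a -cmulA d.
have Ds y : D y -> D (cstar y).
  move=> [a b]; split.
    by transitivity (cstar (y *c q)); [rewrite cstarM qs|rewrite b].
  by transitivity (cstar (q *c y)); [rewrite cstarM qs|rewrite a].
have Df y : D (f y) by rewrite /D /= qf fq.
pose j := sub_in D0 DL DM Ds.
have hg : star_hom (j \o f).
  split=> [k y z|y z|y] /=.
  - by rewrite (hom_linear hf); exact: sub_inL (Df y) (Df z).
  - by rewrite (homM hf); exact: sub_inM (Df y) (Df z).
  - by rewrite (hom_star hf); exact: sub_in_star (Df y).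
have g1 : is_one ((j \o f) e).
  apply: sub_in_unit; first exact: Df.
  by move=> y [].
rewrite -[RHS](nm_hom_inj hg e1 g1) /= ?nm_sub_in //.
apply: (hom_inj hg) => y /= h; apply: finj; rewrite (hom0 hf); apply: nm0_eq0.
by rewrite -(nm_sub_in D0 DL DM Ds (Df y)) -/j h nm0.
Qed.

End StarHomIsometry.

(** The algebraic part of [tensor_pairing], which also covers pairings such as (p, x) |-> rho(p) (x)
    x that may have a kernel. *)
Definition star_pairing (R : realType) (A B T : cstarAlgType R) (t : A -> B -> T) :=
  [/\ forall b, linear (fun a => t a b), forall a, linear (t a),
      forall a a' b b', t a b *c t a' b' = t (a *c a') (b *c b')
    & forall a b, cstar (t a b) = t (cstar a) (cstar b)].

Lemma tensor_star_pairing (R : realType) (A B T : cstarAlgType R) (t : A -> B -> T) :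
  tensor_pairing t -> star_pairing t.
Proof. by case. Qed.

Section FiniteTensor.
Variables (R : realType) (P X : cstarAlgType R) (u : P) (e : X).
Hypotheses (findim : finite_dimensional P) (u1 : is_one u) (e1 : is_one e).
Notation PT := (fin_talg findim u1).
Notation n := (fdim findim u1).
Notation bas := (@fbas R P findim u u1).
Notation T0 := (ptensor PT e1).
Notation j0 := (@ptj R PT X e e1).
Notation t0 := (@ptens R PT X e e1).

Lemma bas_indep : lin_indep bas.
Proof.
have ht := (ftrace_faithful findim u1).1.
move=> c h k; have := congr1 (fun x => ftrace findim u1 (cstar (bas k) *c x)) h.
rewrite /= cmul0r (pf0 ht) cmul_sumr (pf_sum ht) (bigD1 k) //= big1 ?addr0.
  by rewrite cmulZr (pfZ ht) fbas_orth eqxx mulr1.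
by move=> l /negPf hl; rewrite cmulZr (pfZ ht) fbas_orth eq_sym hl mulr0.
Qed.

Section StarPairing.
Variables (T : cstarAlgType R) (t : P -> X -> T).
Hypothesis hs : star_pairing t.

Let tl b : linear (fun a => t a b). Proof. by case: hs. Qed.
Let tr a : linear (t a). Proof. by case: hs. Qed.
Let tM a b a' b' : t a b *c t a' b' = t (a *c a') (b *c b').
Proof. by case: hs => _ _ h _; exact: h. Qed.
Let ts a b : cstar (t a b) = t (cstar a) (cstar b).
Proof. by case: hs => _ _ _ h; exact: h. Qed.

Definition palg (z : PX PT X) : T := \sum_k t (bas k) (z k).

Lemma palg_lin : linear palg.
Proof.
move=> k z w; rewrite /palg scaler_sumr -big_split; apply: eq_bigr => i _.
by rewrite !ffunE tr.
Qed.

Lemma palg_pt p x : palg (@pt R PT X p x) = t p x.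
Proof.
rewrite {2}(@tcoordE R PT p) (lin_sum (tl x)); apply: eq_bigr => k _.
by rewrite ffunE (linZ (tr _)) (linZ (tl _)).
Qed.

Lemma palg_sum I (r : seq I) (F : I -> PX PT X) :
  palg (\sum_(i <- r) F i) = \sum_(i <- r) palg (F i).
Proof. exact: (lin_sum palg_lin). Qed.

Lemma palgM z w : palg (pmul z w) = palg z *c palg w.
Proof.
rewrite /pmul palg_sum cmul_suml; apply: eq_bigr => k _.
rewrite palg_sum cmul_sumr; apply: eq_bigr => l _.
by rewrite palg_pt tM.
Qed.

Lemma palg_star z : palg (pstar z) = cstar (palg z).
Proof.
rewrite /pstar palg_sum cstar_sum; apply: eq_bigr => k _.
by rewrite palg_pt ts.
Qed.

End StarPairing.

Section Pairing.
Variables (T : cstarAlgType R) (t : P -> X -> T).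
Hypothesis ht : tensor_pairing t.
Let hs := tensor_star_pairing ht.
Let tM a b a' b' : t a b *c t a' b' = t (a *c a') (b *c b').
Proof. by case: hs => _ _ h _; exact: h. Qed.
Notation palg := (palg t).

Lemma palg_inj z : palg z = 0 -> z = 0.
Proof.
by move=> h; apply/ffunP => k; rewrite ffunE; by case: ht => _ _ _ _ ti; exact: (ti _ _ _ bas_indep h).
Qed.

Definition tcoefs (y : T0) : PX PT X := projT1 (cid (ptj_onto y)).
Lemma tcoefsE y : y = j0 (tcoefs y).
Proof. exact: (projT2 (cid (ptj_onto y))). Qed.
Lemma tcoefs_j z : tcoefs (j0 z) = z.
Proof.
apply/eqP; rewrite -subr_eq0; apply/eqP; apply: (@ptj_inj R PT X e e1).
by rewrite (linB (@ptj_lin R PT X e e1)) -tcoefsE subrr.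
Qed.

Definition pairing_hom (y : T0) : T := palg (tcoefs y).

Lemma pairing_hom_j z : pairing_hom (j0 z) = palg z.
Proof. by rewrite /pairing_hom tcoefs_j. Qed.

Lemma pairing_star_hom : star_hom pairing_hom.
Proof.
split=> [k y z|y z|y].
- have [a ->] := ptj_onto y; have [b ->] := ptj_onto z.
  transitivity (pairing_hom (j0 (k *: a + b))).
    congr pairing_hom; symmetry; exact: (@ptj_lin R PT X e e1).
  transitivity (palg (k *: a + b)); first exact: pairing_hom_j.
  by rewrite (palg_lin hs); congr (_ *: _ + _); symmetry; exact: pairing_hom_j.
- have [a ->] := ptj_onto y; have [b ->] := ptj_onto z.
  transitivity (pairing_hom (j0 (pmul a b))); first by congr pairing_hom; rewrite ptjM.
  transitivity (palg (pmul a b)); first exact: pairing_hom_j.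
  by rewrite (palgM hs); congr (_ *c _); symmetry; exact: pairing_hom_j.
- have [a ->] := ptj_onto y.
  transitivity (pairing_hom (j0 (pstar a))); first by congr pairing_hom; rewrite ptj_star.
  transitivity (palg (pstar a)); first exact: pairing_hom_j.
  by rewrite (palg_star hs); congr cstar; symmetry; exact: pairing_hom_j.
Qed.

Lemma pairing_hom_inj : injective pairing_hom.
Proof.
apply: (hom_inj pairing_star_hom) => y; rewrite (tcoefsE y) pairing_hom_j.
by move=> /palg_inj ->; exact: lin0 (@ptj_lin R PT X e e1).
Qed.

(** The algebraic tensor product is already a C*-algebra, and injective homomorphisms are isometric;
    so all pairings induce one and the same norm. *)
Lemma nm_palg z : nm (palg z) = nm (j0 z).
Proof.
transitivity (nm (pairing_hom (j0 z))); first by congr nm; symmetry; exact: pairing_hom_j.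
exact: (nm_star_hom_inj pairing_star_hom (@ptj_one R PT X e e1) pairing_hom_inj (j0 z)).
Qed.

Lemma pairing_sum m (a : 'I_m -> P) (b : 'I_m -> X) :
  \sum_i t (a i) (b i) = palg (\sum_i @pt R PT X (a i) (b i)).
Proof. by rewrite (palg_sum hs); apply: eq_bigr => i _; rewrite (palg_pt hs). Qed.

(** The image of P (x) X is dense by hypothesis, which makes [t u e] a unit, and closed by
    [hom_closed_range]. Hence every model of the tensor product is algebraic. *)
Lemma pairing_dense_onto :
  closure [set z : T | exists (m : nat) (a : 'I_m -> P) (b : 'I_m -> X),
                 z = \sum_(i < m) t (a i) (b i)] = setT ->
  is_one (t u e) /\ forall z, exists w, z = palg w.
Proof.
move=> cl; have hcl z (d : R) : 0 < d -> exists w, nm (z - palg w) < d.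
  have : (setT : set T) z by [].
  rewrite -cl => /closureE h d0; have [y [m [a [b ->]]] hy] := h d d0.
  by exists (\sum_i @pt R PT X (a i) (b i)); rewrite -pairing_sum.
have h1l w : t u e *c palg w = palg w.
  rewrite cmul_sumr; apply: eq_bigr => k _.
  by rewrite tM (cmul1l u1) (cmul1l e1).
have h1r w : palg w *c t u e = palg w.
  rewrite cmul_suml; apply: eq_bigr => k _.
  by rewrite tM (cmul1r u1) (cmul1r e1).
have one : is_one (t u e).
  move=> z; have c0 : 0 < nm (t u e) + 1 by rewrite ltr_wpDl // nm_ge0.
  split; apply: eq_of_nm_le => d d0; have [w hw] := hcl z _ (divr_gt0 d0 c0);
    apply: le_trans (nm_dist (palg w) _ _) _; rewrite (nmBC (palg w)).
    rewrite -[X in nm (_ - X) + _]h1l -cmulBr.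
    have := nmM (t u e) (z - palg w); rewrite ltr_pdivlMr // in hw.
    by move: hw; move: (nm (z - _)) (nm (_ *c _)) (nm (t u e)) => *; lra.
  rewrite -[X in nm (_ - X) + _]h1r -cmulBl.
  have := nmM (z - palg w) (t u e); rewrite ltr_pdivlMr // in hw.
  by move: hw; move: (nm (z - _)) (nm (_ *c _)) (nm (t u e)) => *; lra.
split => // z.
have q1 : is_one (pairing_hom (j0 (@pone R PT X e))).
  suff -> : pairing_hom (j0 (@pone R PT X e)) = t u e by exact: one.
  transitivity (palg (@pone R PT X e)); first exact: pairing_hom_j.
  exact: (palg_pt hs).
have [|y <-] := hom_closed_range pairing_star_hom (@ptj_one R PT X e e1) q1 (b := z).
  move=> d d0; have [w hw] := hcl z d d0; exists (j0 w).
  suff -> : pairing_hom (j0 w) = palg w by exact: hw.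
  exact: pairing_hom_j.
by exists (tcoefs y).
Qed.

End Pairing.

Lemma ptens_min_tensor : min_tensor t0.
Proof.
have jl := @ptj_lin R PT X e e1.
split.
- split.
  + move=> b k a a'; rewrite /ptens (@pt_linl R PT X); exact: jl.
  + move=> a k b b'; rewrite /ptens (@pt_linr R PT X); exact: jl.
  + by move=> a a' b b'; rewrite -ptjM pmul_pt.
  + by move=> a b; rewrite -ptj_star pstar_pt.
  + move=> m a b ia; rewrite -(lin_sum jl) => /ptj_inj h i.
    apply: contrapT => bi0.
    have b20 : cstar (b i) *c b i <> 0 by move=> /cstar_mul_eq0.
    have [s hs] := posfun_gt0 e1 (pos_star_mul e1 (b i)) b20.
    suff -> : s (cstar (b i) *c b i) = 0 by rewrite ltxx.
    (* The functional s(b_i^* .) on the second leg turns the tensor relation into a scalar relation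
       between the a_j. *)
    apply: (ia (fun j => s (cstar (b i) *c b j))).
    transitivity (\sum_k s (cstar (b i) *c (\sum_j @pt R PT X (a j) (b j)) k) *: bas k).
      under [RHS]eq_bigr => k _.
        rewrite sum_ffunE cmul_sumr (pf_sum hs) scaler_suml; over.
      rewrite exchange_big; apply: eq_bigr => j _.
      rewrite {1}[a j](@tcoordE R PT) scaler_sumr; apply: eq_bigr => k _.
      by rewrite ffunE cmulZr (pfZ hs) scalerA mulrC.
    by rewrite h big1 // => k _; rewrite ffunE cmul0r (pf0 hs) scale0r.
- apply/seteqP; split => // y _; apply/closureE => d d0.
  exists y; last by rewrite subrr nm0.
  have [z ->] := ptj_onto y; exists n, bas, z.
  by rewrite {1}(@pt_expand R PT X z) (lin_sum jl).
- move=> T' t' ht' m a b; rewrite !nmE lecR (pairing_sum ht') (nm_palg ht').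
  by rewrite (lin_sum jl).
Qed.

Definition fin_tensor : tensorProduct P X := TensorProduct ptens_min_tensor.

Lemma tens_one (T : tensorProduct P X) : is_one (tens T u e).
Proof. by case: (tensP T) => h cl _; case: (pairing_dense_onto h cl). Qed.

Lemma tens_onto (T : tensorProduct P X) (z : T) :
  exists x : 'I_n -> X, z = \sum_k tens T (bas k) (x k).
Proof.
case: (tensP T) => h cl _; have [_ /(_ z)[w ->]] := pairing_dense_onto h cl.
by exists w.
Qed.

End FiniteTensor.

Section CoordinateMap.
Variables (R : realType) (Q : talg R) (X Y : cstarAlgType R) (f : X -> Y).

Definition pmap (z : PX Q X) : PX Q Y := [ffun k => f (z k)].

Hypothesis hf : star_hom f.

Lemma pmap_lin : linear pmap.
Proof. by move=> k z w; apply/ffunP => i; rewrite !ffunE (homD hf) (homZ hf). Qed.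

Lemma pmap_pt p x : pmap (pt p x) = pt p (f x).
Proof. by apply/ffunP => i; rewrite !ffunE (homZ hf). Qed.

Lemma pmapM z w : pmap (pmul z w) = pmul (pmap z) (pmap w).
Proof.
rewrite /pmul (lin_sum pmap_lin); apply: eq_bigr => k _.
rewrite (lin_sum pmap_lin); apply: eq_bigr => l _.
by rewrite pmap_pt (homM hf) !ffunE.
Qed.

Lemma pmap_star z : pmap (pstar z) = pstar (pmap z).
Proof.
rewrite /pstar (lin_sum pmap_lin); apply: eq_bigr => k _.
by rewrite pmap_pt (hom_star hf) !ffunE.
Qed.

End CoordinateMap.

Section TensorMap.
Variables (R : realType) (P : cstarAlgType R) (u : P).
Hypotheses (findim : finite_dimensional P) (u1 : is_one u).
Notation PT := (fin_talg findim u1).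
Notation n := (fdim findim u1).
Notation bas := (@fbas R P findim u u1).

Lemma tens_star_pairing (X : cstarAlgType R) (T : tensorProduct P X) : star_pairing (tens T).
Proof. by case: (tensP T) => /tensor_star_pairing. Qed.

Lemma tens_pairing (X : cstarAlgType R) (T : tensorProduct P X) : tensor_pairing (tens T).
Proof. by case: (tensP T). Qed.

Section Coordinates.
Variables (X : cstarAlgType R) (e : X) (T : tensorProduct P X).
Hypothesis e1 : is_one e.

Lemma tens_coord_subproof (z : T) : exists w : PX PT X, z = palg (tens T) w.
Proof.
have [x ->] := tens_onto findim u1 e1 z; exists [ffun k => x k].
by apply: eq_bigr => k _; rewrite ffunE.
Qed.

Definition tens_coord (z : T) : PX PT X := projT1 (cid (tens_coord_subproof z)).

Lemma tens_coordE z : z = palg (tens T) (tens_coord z).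
Proof. exact: (projT2 (cid (tens_coord_subproof z))). Qed.

Lemma palg_injective (z w : PX PT X) : palg (tens T) z = palg (tens T) w -> z = w.
Proof.
move=> h; apply/eqP; rewrite -subr_eq0; apply/eqP; apply: (palg_inj (tens_pairing T)).
have hl := palg_lin (tens_star_pairing T).
transitivity (palg (tens T) z - palg (tens T) w); last by rewrite h subrr.
exact: (linB (hl u findim u1)).
Qed.

Lemma tens_coord_palg w : tens_coord (palg (tens T) w) = w.
Proof. by apply: palg_injective; rewrite -tens_coordE. Qed.

Lemma palg_star_hom (B : cstarAlgType R) (t : P -> X -> B) : star_pairing t ->
  star_hom (fun z => palg t (tens_coord z)).
Proof.
move=> ht; have hs := tens_star_pairing T.
split=> [k y z|y z|y].
- rewrite (tens_coordE y) (tens_coordE z).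
  transitivity (palg t (tens_coord (palg (tens T) (k *: tens_coord y + tens_coord z)))).
    by congr (palg t (tens_coord _)); symmetry; exact: (palg_lin hs).
  by rewrite !tens_coord_palg; exact: (palg_lin ht).
- rewrite (tens_coordE y) (tens_coordE z).
  transitivity (palg t (tens_coord (palg (tens T) (pmul (tens_coord y) (tens_coord z))))).
    by congr (palg t (tens_coord _)); symmetry; exact: (palgM hs).
  by rewrite !tens_coord_palg; exact: (palgM ht).
- rewrite (tens_coordE y).
  transitivity (palg t (tens_coord (palg (tens T) (pstar (tens_coord y))))).
    by congr (palg t (tens_coord _)); symmetry; exact: (palg_star hs).
  by rewrite !tens_coord_palg; exact: (palg_star ht).
Qed.

Lemma palg_coord_tens (B : cstarAlgType R) (t : P -> X -> B) p x : star_pairing t ->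
  palg t (tens_coord (tens T p x)) = t p x.
Proof.
move=> ht; rewrite -(@palg_pt _ _ _ _ findim u1 _ _ (tens_star_pairing T)).
by rewrite tens_coord_palg; exact: (palg_pt ht).
Qed.

End Coordinates.

Section Map.
Variables (X Y : cstarAlgType R) (e : X) (T : tensorProduct P X) (T' : tensorProduct P Y).
Hypothesis e1 : is_one e.
Variable f : X -> Y.
Hypothesis hf : star_hom f.

Definition tmap (z : T) : T' := palg (fun p x => tens T' p (f x)) (tens_coord e1 z).

Lemma tmap_palg (w : PX PT X) : tmap (palg (tens T) w) = palg (tens T') (pmap f w).
Proof.
rewrite /tmap tens_coord_palg; by apply: eq_bigr => k _; rewrite ffunE.
Qed.

Let hfT : star_pairing (fun p x => tens T' p (f x)).
Proof.
have [h1 h2 h3 h4] := tens_star_pairing T'; split=> [b|a k x y|a a' b b'|a b].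
- exact: h1.
- by rewrite (homD hf) (homZ hf) h2.
- by rewrite h3 (homM hf).
- by rewrite h4 (hom_star hf).
Qed.

Lemma tmap_star_hom : star_hom tmap. Proof. exact: palg_star_hom. Qed.

Lemma tmap_tens p x : tmap (tens T p x) = tens T' p (f x).
Proof. exact: (palg_coord_tens T e1 p x hfT). Qed.

Lemma tmap_inj : injective f -> injective tmap.
Proof.
move=> fi; apply: (hom_inj tmap_star_hom) => z; rewrite (tens_coordE e1 z) tmap_palg.
move=> /(palg_inj (tens_pairing T')) h.
have -> : tens_coord e1 z = 0; last exact: (lin0 (palg_lin (tens_star_pairing T))).
apply/ffunP => k; apply: fi; rewrite ffunE (hom0 hf).
by have := congr1 (fun w : {ffun _ -> Y} => w k) h; rewrite !ffunE.
Qed.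

End Map.
End TensorMap.

Lemma hom_lift_inj (R : realType) (A B O : cstarAlgType R) (f : A -> B) (g : O -> B) :
  star_hom f -> injective f -> star_hom g -> (forall a, exists x, f x = g a) ->
  exists2 h : O -> A, star_hom h & forall a, f (h a) = g a.
Proof.
move=> hf fi hg /choice[h fh]; exists h => //; split=> [k x y|x y|x]; apply: fi.
- by rewrite (homD hf) (homZ hf) !fh (homD hg) (homZ hg).
- by rewrite (homM hf) !fh (homM hg).
- by rewrite (hom_star hf) !fh (hom_star hg).
Qed.

(** * Universal families *)

Section Multipliers.
Variables (R : realType).
Implicit Types A B X : cstarAlgType R.

Lemma cmul_star_cancel B (x y : B) : (forall z, cstar z *c x = cstar z *c y) -> x = y.
Proof.
move=> h; apply/eqP; rewrite -subr_eq0; apply/eqP; apply: cstar_mul_eq0.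
by rewrite cmulBr h subrr.
Qed.

Lemma multM B (f : multiplier B) x y : f (x *c y) = f x *c y.
Proof.
have h z w : cstar w *c f z = cstar (mult_adj f w) *c z.
  by rewrite -[LHS]cstarK cstarM cstarK mult_adjP cstarM cstarK.
by apply: cmul_star_cancel => z; rewrite h !cmulA h.
Qed.

Lemma left_mult_mor A B (eA : A) (eB : B) (f : A -> B) : is_one eA -> is_one eB ->
  unital_star_hom f -> is_mor (fun a => left_mult (f a)).
Proof.
move=> hA hB [hf fu]; split=> [k x y b|x y b|x b|] /=.
- by rewrite (homD hf) (homZ hf) cmulDl cmulZl.
- by rewrite (homM hf) cmulA.
- by rewrite (hom_star hf).
- apply/seteqP; split => // b _; apply: subset_closure.
  exists 1%N, (fun=> eA), (fun=> b); rewrite big_ord1.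
  by have [-> _] := fu _ hA b.
Qed.

(** Evaluation at the unit of B identifies multipliers with elements of B. Nondegeneracy enters
    through the unit: F(eA) is the identity on the span of F(A) B, which is dense. *)
Lemma mor_unital_hom A B (eA : A) (eB : B) (F : A -> multiplier B) :
  is_one eA -> is_one eB -> is_mor F -> unital_star_hom (fun a => F a eB).
Proof.
move=> hA hB [FL FM Fs Fd].
have FE a b : F a b = F a eB *c b by rewrite -multM (cmul1l hB).
have hF : star_hom (fun a => F a eB).
  split=> [k x y|x y|x]; [exact: FL|by rewrite FM FE|].
  by rewrite Fs -[RHS](cmul1r hB) mult_adjP (cstar_one hB) (cmul1l hB).
split=> // e e1; have -> : e = eA by rewrite -[e](cmul1l hA) (cmul1r e1).
have hl b : F eA eB *c b = b.
  apply: eq_of_nm_le => d d0.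
  have : [set: B] b by [].
  rewrite -Fd => /closureE h.
  have c0 : 0 < nm (F eA eB) + 1 by rewrite ltr_wpDl ?nm_ge0.
  have [z [m [x [y zE]]] hz] := h _ (divr_gt0 d0 c0).
  have hz1 : F eA eB *c z = z.
    rewrite zE cmul_sumr; apply: eq_bigr => i _.
    by rewrite -FE -FM (cmul1l hA).
  apply: le_trans (nm_dist z _ _) _; rewrite -[X in nm (_ - X) + _]hz1 -cmulBr (nmBC z).
  have := nmM (F eA eB) (b - z); rewrite ltr_pdivlMr // in hz.
  by move: hz; move: (nm (b - _)) (nm (_ *c _)) (nm (F eA eB)) => *; lra.
move=> b; split=> //.
have s : cstar (F eA eB) = F eA eB by rewrite -(hom_star hF) (cstar_one hA).
by rewrite -[LHS]cstarK cstarM s hl cstarK.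
Qed.

End Multipliers.

Section UnitalHom.
Variables (R : realType).
Implicit Types A B : cstarAlgType R.

Lemma is_one_unique A (e e' : A) : is_one e -> is_one e' -> e = e'.
Proof. by move=> h h'; rewrite -[e](cmul1l h') (cmul1r h). Qed.

Lemma unital_star_homI A B (f : A -> B) e : star_hom f -> is_one e -> is_one (f e) ->
  unital_star_hom f.
Proof. by move=> hf e1 fe1; split=> // e' /(is_one_unique e1) <-. Qed.

Lemma unital_star_hom_comp A B C (f : A -> B) (g : B -> C : cstarAlgType R) :
  unital_star_hom f -> unital_star_hom g -> unital_star_hom (g \o f).
Proof.
move=> [hf fu] [hg gu]; split=> [|e e1]; last exact/gu/fu.
split=> [k x y|x y|x] /=.
- by rewrite (homD hf) (homZ hf) (homD hg) (homZ hg).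
- by rewrite (homM hf) (homM hg).
- by rewrite (hom_star hf) (hom_star hg).
Qed.

End UnitalHom.

Section UniversalFamily.
Variables (R : realType) (P O : cstarAlgType R) (u : P) (eO : O).
Hypotheses (findim : finite_dimensional P) (u1 : is_one u) (eO1 : is_one eO).
Notation PT := (fin_talg findim u1).
Notation n := (fdim findim u1).
Notation bas := (@fbas R P findim u u1).
Variable M : qmaps P O.

Definition qunit : M := projT1 (cid (@qmaps_compact _ _ _ M)).
Lemma qunitP : is_one qunit. Proof. exact: (projT2 (cid (@qmaps_compact _ _ _ M))). Qed.

Notation Phi := (@qmaps_Phi _ _ _ M).
Notation T := (qmaps_tensor M).

(** The slices of Phi(a) by the functionals tr(e_k^* .), which suffice as generators. *)
Definition qcoef (a : O) : PX PT M := tens_coord findim u1 qunitP (Phi a).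

Lemma qcoefE a : Phi a = palg (tens T) (qcoef a).
Proof. exact: tens_coordE. Qed.

Lemma tmap_unital (X Y : cstarAlgType R) (e : X) (e1 : is_one e)
    (T1 : tensorProduct P X) (T2 : tensorProduct P Y) (f : X -> Y) :
  unital_star_hom f -> unital_star_hom (@tmap R P u findim u1 X Y e T1 T2 e1 f).
Proof.
move=> [hf fu]; apply: (@unital_star_homI _ _ _ _ (tens T1 u e)).
- exact: tmap_star_hom.
- exact: tens_one.
- by rewrite tmap_tens //; apply: tens_one => //; exact: fu.
Qed.

Section IntoUnital.
Variables (X : cstarAlgType R) (e : X).
Hypothesis e1 : is_one e.

(** The existence half of the universal property, freed from multipliers by evaluating at units. *)
Lemma qmaps_lift (TX : tensorProduct P X) (psi : O -> TX) : unital_star_hom psi ->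
  exists2 lam : M -> X, unital_star_hom lam &
    forall a, psi a = palg (tens TX) (pmap lam (qcoef a)).
Proof.
move=> hpsi; have t1 : is_one (tens TX u e) by exact: tens_one.
have hmor := left_mult_mor eO1 t1 hpsi.
have [Lam [[hLam [idL [[hid hidT] hE]]] _]] := @qmaps_universal _ _ _ M X TX _ hmor.
exists (fun m => Lam m e); first exact: mor_unital_hom qunitP e1 hLam.
move=> a; have hL (x y : T) : idL (x + y) (tens TX u e) =
    idL x (tens TX u e) + idL y (tens TX u e).
  by have [h _ _ _] := hid; have := h 1 x y (tens TX u e); rewrite !scale1r.
have h0 : idL 0 (tens TX u e) = 0.
  by apply: (@addrI _ (idL 0 (tens TX u e))); rewrite -hL !addr0.
transitivity (idL (Phi a) (tens TX u e)).
  by have := congr1 (fun F => F a) hE => /= <- /=; rewrite (cmul1r t1).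
rewrite qcoefE /palg (big_morph (fun x => idL x (tens TX u e)) hL h0).
by apply: eq_bigr => k _; rewrite hidT /= (cmul1r u1) ffunE.
Qed.

(** The uniqueness half: both homomorphisms solve the universal problem of the same map O -> P (x)
    X. *)
Lemma qmaps_hom_eq (f g : M -> X) : unital_star_hom f -> unital_star_hom g ->
  (forall a, pmap f (qcoef a) = pmap g (qcoef a)) -> f = g.
Proof.
move=> hf hg hfg.
pose TX := fin_tensor findim u1 e1.
have t1 : is_one (tens TX u e) by exact: tens_one.
pose tm f0 : T -> TX := @tmap R P u findim u1 M X qunit T TX qunitP f0.
have tu f0 : unital_star_hom f0 -> unital_star_hom (tm f0) by exact: tmap_unital.
have tE f0 a : tm f0 (Phi a) = palg (tens TX) (pmap f0 (qcoef a)).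
  by rewrite {1}qcoefE; exact: tmap_palg.
have hmor : is_mor (fun a => left_mult (tm f (Phi a))).
  apply: left_mult_mor eO1 t1 _.
  exact: (unital_star_hom_comp (@qmaps_Phi_hom _ _ _ M) (tu _ hf)).
have [Lam [_ hU]] := @qmaps_universal _ _ _ M X TX _ hmor.
have hc f0 : unital_star_hom f0 -> (forall a, pmap f0 (qcoef a) = pmap f (qcoef a)) ->
    Lam = (fun m => left_mult (f0 m)).
  move=> hf0 h0; apply: hU; split; first exact: left_mult_mor qunitP e1 hf0.
  exists (fun t => left_mult (tm f0 t)); split.
    split; first exact: left_mult_mor (tens_one findim u1 qunitP (T := T)) t1 (tu _ hf0).
    move=> a b a' b' /=; rewrite /tm tmap_tens ?hf0.1 //; last by case: hf0.
    by have [_ _ h _ _] := tens_pairing TX; rewrite h.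
  by apply: funext => a /=; rewrite !tE h0.
apply: funext => m.
have E : (fun m => left_mult (f m)) = (fun m => left_mult (g m)).
  by rewrite -(hc f hf) // -(hc g hg).
have := congr1 (fun F : M -> multiplier X => F m e) E.
by rewrite /= !(cmul1r e1).
Qed.

End IntoUnital.

(** An induction principle for M. Phi factors through P (x) D, so the universal property gives M ->
    D; followed by the inclusion it fixes the coordinates of Phi, hence is the identity by
    [qmaps_hom_eq]. *)
Lemma qmaps_generated (D : set M) : D qunit ->
  (forall k x y, D x -> D y -> D (k *: x + y)) ->
  (forall x y, D x -> D y -> D (x *c y)) ->
  (forall x, D x -> D (cstar x)) ->
  (forall (v : nat -> M) l, (forall i, D (v i)) -> tendsto v l -> D l) ->
  (forall a k, D (qcoef a k)) -> forall m, D m.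
Proof.
move=> D1 DL DM Ds Dc Dq.
have D0 : D 0 by have := DL (-1) _ _ D1 D1; rewrite scaleN1r addNr.
pose X := sub_alg D0 DL DM Ds; pose j : M -> X := sub_in D0 DL DM Ds.
have e1 : is_one (j qunit).
  apply: sub_in_unit => // x _; split; [exact: cmul1l qunitP _|exact: cmul1r qunitP _].
have /choice[i hi] : forall x : X, exists a, D a /\ x = j a.
  by move=> x; have [a Da xE] := sub_in_onto Dc x; exists a.
have Di x : D (i x) by case: (hi x).
have ji x : j (i x) = x by case: (hi x).
have jinj a b : D a -> D b -> j a = j b -> a = b.
  move=> Da Db h; apply/eqP; rewrite -subr_eq0; apply/eqP; apply: nm0_eq0.
  have Dab : D (a - b) by rewrite addrC -scaleN1r; exact: (DL _ _ _ Db Da).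
  rewrite -(nm_sub_in D0 DL DM Ds Dab) -/j.
  have -> : j (a - b) = 0; last by rewrite nm0.
  by rewrite addrC -scaleN1r /j sub_inL // -/j h scaleN1r addNr.
have hI : star_hom i.
  split=> [k x y|x y|x]; apply: jinj; rewrite ?ji //; try solve [exact: (DL _ _ _ (Di _) (Di _))|exact: (DM _ _ (Di _) (Di _))|exact: (Ds _ (Di _))].
  - by rewrite /j sub_inL // -/j !ji.
  - by rewrite /j sub_inM // -/j !ji.
  - by rewrite /j sub_in_star // -/j !ji.
have iI : injective i by move=> x y h; rewrite -(ji x) -(ji y) h.
have iu : unital_star_hom i.
  apply: (unital_star_homI hI e1); suff -> : i (j qunit) = qunit by exact: qunitP.
  exact: jinj.
pose TX := fin_tensor findim u1 e1.
pose ti : TX -> T := @tmap R P u findim u1 X M _ TX T e1 i.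
have hti : unital_star_hom ti by exact: tmap_unital.
have tiI : injective ti by exact: tmap_inj.
have [psi hpsi hE] : exists2 psi : O -> TX, star_hom psi & forall a, ti (psi a) = Phi a.
  apply: hom_lift_inj => //; [exact: hti.1|exact: (@qmaps_Phi_hom _ _ _ M).1|].
  move=> a; exists (palg (tens TX) [ffun k => j (qcoef a k)]).
  rewrite /ti tmap_palg // qcoefE; congr palg; apply/ffunP => k; rewrite !ffunE.
  by apply: jinj; rewrite ?ji.
have hpsiu : unital_star_hom psi.
  have t1 := tens_one findim u1 e1 (T := TX).
  apply: (unital_star_homI hpsi eO1).
  suff -> : psi eO = tens TX u (j qunit) by [].
  apply: tiI; rewrite hE; apply: is_one_unique; first exact: (@qmaps_Phi_hom _ _ _ M).2.
  exact: hti.2.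
have [lam hlam psiE] := qmaps_lift e1 hpsiu.
have E : i \o lam = id.
  apply: (qmaps_hom_eq qunitP).
  - exact: unital_star_hom_comp.
  - by split.
  - move=> a; apply: (palg_injective (T := T)); rewrite -[RHS]/(palg (tens T) _).
    transitivity (ti (psi a)).
      by rewrite psiE /ti tmap_palg //; congr palg; apply/ffunP => k; rewrite !ffunE.
    rewrite hE qcoefE; congr palg; apply/ffunP => k; by rewrite ffunE.
by move=> m; have <- : i (lam m) = m by exact: (congr1 (fun F : M -> M => F m) E).
Qed.

End UniversalFamily.

(** * Surjectivity *)

Section QmapsMap.
Variables (R : realType) (P1 P2 O1 O2 : cstarAlgType R) (u1 : P1) (u2 : P2).
Hypotheses (fin1 : finite_dimensional P1) (fin2 : finite_dimensional P2).
Hypotheses (hu1 : is_one u1) (hu2 : is_one u2).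
Variables (M1 : qmaps P1 O1) (M2 : qmaps P2 O2).
Variables (rho : P2 -> P1) (pi : O1 -> O2) (Lam : M1 -> M2).
Hypothesis hLam : is_qmaps_map rho pi Lam.
Notation bas1 := (@fbas R P1 fin1 u1 hu1).
Notation bas2 := (@fbas R P2 fin2 u2 hu2).
Notation q1 := (qcoef fin1 hu1 M1).
Notation q2 := (qcoef fin2 hu2 M2).

(** The coefficients form the matrix of rho in the two bases. Comparing coordinates is legitimate
    because those of P1 (x) M2 are unique. *)
Lemma qmaps_map_coef a l :
  Lam (q1 a l) = \sum_k ftrace fin1 hu1 (cstar (bas1 l) *c rho (bas2 k)) *: q2 (pi a) k.
Proof.
have [[hL _] [T [idL [rid [[hid hidE] [hrid hridE] E]]]]] := hLam.
have /= := congr1 (fun F => F a) E.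
rewrite (qcoefE fin1 hu1 M1 a) (qcoefE fin2 hu2 M2 (pi a)) /palg (hom_sum hid) (hom_sum hrid).
have [tl tr _ _] := tens_star_pairing T.
move=> h0.
have h : \sum_k tens T (bas1 k) (Lam (q1 a k)) = \sum_k tens T (rho (bas2 k)) (q2 (pi a) k).
  transitivity (\sum_k idL (tens (qmaps_tensor M1) (bas1 k) (q1 a k))).
    by apply: eq_bigr => k _; rewrite hidE.
  by rewrite h0; apply: eq_bigr => k _; rewrite hridE.
pose z : PX (fin_talg fin1 hu1) M2 := [ffun k => Lam (q1 a k)].
pose w : PX (fin_talg fin1 hu1) M2 :=
  [ffun l => \sum_k ftrace fin1 hu1 (cstar (bas1 l) *c rho (bas2 k)) *: q2 (pi a) k].
have : z = w; last by move=> /(congr1 (fun F : {ffun _ -> M2} => F l)); rewrite !ffunE.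
apply: (palg_injective (T := T)); rewrite /palg.
transitivity (\sum_k tens T (bas1 k) (Lam (q1 a k))).
  by apply: eq_bigr => k _; rewrite ffunE.
rewrite h; transitivity (\sum_k \sum_l tens T (bas1 l)
    (ftrace fin1 hu1 (cstar (bas1 l) *c rho (bas2 k)) *: q2 (pi a) k)).
  apply: eq_bigr => k _; rewrite {1}(fbas_span fin1 hu1 (rho (bas2 k))).
  rewrite (lin_sum (tl _)); apply: eq_bigr => j _.
  by rewrite (linZ (tl _)) (linZ (tr _)).
rewrite exchange_big; apply: eq_bigr => j _.
by rewrite ffunE (lin_sum (tr _)).
Qed.

End QmapsMap.

Section HomRange.
Variables (R : realType) (P O : cstarAlgType R) (u : P) (eO : O).
Hypotheses (findim : finite_dimensional P) (u1 : is_one u) (eO1 : is_one eO).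
Variables (M : qmaps P O) (A : cstarAlgType R) (eA : A) (f : A -> M).
Hypotheses (eA1 : is_one eA) (hf : unital_star_hom f).

Lemma qmaps_range_onto : (forall a k, exists x, f x = qcoef findim u1 M a k) ->
  surjective f.
Proof.
have [hs hu] := hf; have f1 := hu _ eA1.
apply: (@qmaps_generated _ _ _ _ _ findim u1 eO1 M (fun y => exists x, f x = y)).
- by exists eA; apply: is_one_unique f1 _; exact: qunitP.
- by move=> k x y [a <-] [b <-]; exists (k *: a + b); rewrite (homD hs) (homZ hs).
- by move=> x y [a <-] [b <-]; exists (a *c b); rewrite (homM hs).
- by move=> x [a <-]; exists (cstar a); rewrite (hom_star hs).
- move=> v l hv hl; apply: (hom_closed_range hs eA1 f1) => d d0.
  have [N hN] := hl d d0; have [x hx] := hv N; exists x; rewrite hx nmBC.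
  exact: hN.
Qed.

End HomRange.

Section Surjectivity.
Variables (R : realType).
Implicit Types P O : cstarAlgType R.

Lemma qmaps_map_id_coef P O1 O2 (u : P) (findim : finite_dimensional P) (u1 : is_one u)
    (M1 : qmaps P O1) (M2 : qmaps P O2) (pi : O1 -> O2) (Lam : M1 -> M2) a l :
  is_qmaps_map id pi Lam ->
  Lam (qcoef findim u1 M1 a l) = qcoef findim u1 M2 (pi a) l.
Proof.
move=> h; rewrite (qmaps_map_coef findim u1 h) (bigD1 l) //= big1 ?addr0.
  by rewrite fbas_orth eqxx scale1r.
by move=> k /negPf hk; rewrite fbas_orth eq_sym hk scale0r.
Qed.

Lemma qmaps_map_id_onto P O1 O2 (M1 : qmaps P O1) (M2 : qmaps P O2) (pi : O1 -> O2)
    (Lam : M1 -> M2) : finite_qspace P -> compact_qspace O2 -> is_qmaps_map id pi Lam ->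
  surjective pi -> surjective Lam.
Proof.
move=> [[u u1] findim] [eO eO1] h pis; have [hL _] := h.
apply: (qmaps_range_onto (findim := findim) (u1 := u1) eO1 (@qunitP _ _ _ M1) hL) => a k.
have [b <-] := pis a; exists (qcoef findim u1 M1 b k).
exact: qmaps_map_id_coef.
Qed.

(** As rho is injective, its matrix A has a right inverse B, and B expresses the generators of the
    second algebra through the images of those of the first. *)
Lemma qmaps_map_rho_onto P1 P2 O (M1 : qmaps P1 O) (M2 : qmaps P2 O) (rho : P2 -> P1)
    (Lam : M1 -> M2) : finite_qspace P1 -> finite_qspace P2 -> compact_qspace O ->
    star_hom rho -> is_qmaps_map rho id Lam ->
  injective rho -> surjective Lam.
Proof.
move=> [[u1 hu1] fin1] [[u2 hu2] fin2] [eO eO1] hr h ri; have [hL _] := h.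
apply: (qmaps_range_onto (findim := fin2) (u1 := hu2) eO1 (@qunitP _ _ _ M1) hL) => a k.
have ht := (ftrace_faithful fin1 hu1).1.
pose A : 'M[R[i]]_(fdim fin2 hu2, fdim fin1 hu1) :=
  \matrix_(k, l) ftrace fin1 hu1 (cstar (fbas (u1 := hu1) l) *c rho (fbas (u1 := hu2) k)).
have Af : row_free A.
  apply: inj_row_free => v vA.
  have h0 : \sum_k v 0 k *: fbas (u1 := hu2) k = 0.
    apply: ri; rewrite (hom0 hr) (hom_sum hr) [LHS](fbas_span fin1 hu1) big1 // => l _.
    have := congr1 (fun B : 'rV_(fdim fin1 hu1) => B 0 l) vA; rewrite !mxE => vl.
    rewrite -[RHS](scale0r (fbas (u1 := hu1) l)); congr (_ *: _); rewrite -[RHS]vl.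
    rewrite cmul_sumr (pf_sum ht); apply: eq_bigr => j _.
    by rewrite (homZ hr) cmulZr (pfZ ht) mxE.
  by apply/rowP => j; rewrite mxE (bas_indep h0).
have [B AB] := row_freeP Af.
exists (\sum_l B l k *: qcoef fin1 hu1 M1 a l).
rewrite (hom_sum hL.1).
transitivity (\sum_l \sum_j (A j l * B l k) *: qcoef fin2 hu2 M2 a j).
  apply: eq_bigr => l _; rewrite (homZ hL.1) (qmaps_map_coef fin2 hu2 h) scaler_sumr.
  by apply: eq_bigr => j _; rewrite scalerA mxE mulrC.
transitivity (\sum_j (j == k)%:R *: qcoef fin2 hu2 M2 a j).
  rewrite exchange_big; apply: eq_bigr => j _; rewrite -scaler_suml; congr (_ *: _).
  by have := congr1 (fun Q : 'M[R[i]]_(fdim fin2 hu2, fdim fin2 hu2) => Q j k) AB; rewrite !mxE.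
rewrite (bigD1 k) //= eqxx scale1r big1 ?addr0 // => j /negPf ->.
exact: scale0r.
Qed.

End Surjectivity.

(** * Injectivity for surjective rho *)

Section FiniteLinear.
Variables (R : realType) (P : cstarAlgType R) (u : P).
Hypotheses (findim : finite_dimensional P) (u1 : is_one u).
Notation bas := (@fbas R P findim u u1).
Notation tr := (ftrace findim u1).

Lemma fin_linear_onto (f : P -> P) : linear f -> (forall x, f x = 0 -> x = 0) ->
  forall y, exists x, f x = y.
Proof.
move=> fl fi y; have ht := (ftrace_faithful findim u1).1.
pose F : 'M[R[i]]_(fdim findim u1) := \matrix_(k, l) tr (cstar (bas l) *c f (bas k)).
pose vec (v : 'rV[R[i]]_(fdim findim u1)) := \sum_k v 0 k *: bas k.
have fvec v : f (vec v) = vec (v *m F).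
  rewrite (lin_sum fl) [LHS](fbas_span findim u1); apply: eq_bigr => l _; congr (_ *: _).
  rewrite cmul_sumr (pf_sum ht) mxE; apply: eq_bigr => k _.
  by rewrite (linZ fl) cmulZr (pfZ ht) mxE.
have Ff : row_free F.
  apply: inj_row_free => v vF.
  have /bas_indep v0 : vec v = 0.
    by apply: fi; rewrite fvec vF /vec big1 // => k _; rewrite mxE scale0r.
  by apply/rowP => j; rewrite mxE v0.
have [B BF] : exists B, B *m F = 1%:M.
  by apply/row_fullP; rewrite row_full_unit -row_free_unit.
exists (vec ((\row_k tr (cstar (bas k) *c y)) *m B)).
rewrite fvec -mulmxA BF mulmx1 [RHS](fbas_span findim u1).
by apply: eq_bigr => k _; rewrite mxE.
Qed.

End FiniteLinear.

Section StarHomSection.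
Variables (R : realType) (P1 P2 : cstarAlgType R) (u1 : P1) (u2 : P2).
Hypotheses (fin1 : finite_dimensional P1) (fin2 : finite_dimensional P2).
Hypotheses (hu1 : is_one u1) (hu2 : is_one u2).
Variable rho : P2 -> P1.
Hypotheses (hr : star_hom rho) (ru : rho u2 = u1) (rs : surjective rho).
Notation e2 := (@fbas R P2 fin2 u2 hu2).
Notation tr1 := (ftrace fin1 hu1).
Notation tr2 := (ftrace fin2 hu2).
Let h1 := (ftrace_faithful fin1 hu1).1.
Let h2 := (ftrace_faithful fin2 hu2).1.

Definition trace_adj y := \sum_k tr1 (cstar (rho (e2 k)) *c y) *: e2 k.

Lemma trace_adj_lin : linear trace_adj.
Proof.
move=> k x y; rewrite scaler_sumr -big_split; apply: eq_bigr => j _.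
by rewrite cmulDr cmulZr (pfL h1) scalerDl scalerA.
Qed.

Lemma trace_adjE x y : tr2 (cstar x *c trace_adj y) = tr1 (cstar (rho x) *c y).
Proof.
rewrite [in RHS](fbas_span fin2 hu2 x) (hom_sum hr) cstar_sum cmul_suml (pf_sum h1).
rewrite cmul_sumr (pf_sum h2); apply: eq_bigr => k _.
rewrite (homZ hr) cstarZ cmulZl cmulZr (pfZ h1) (pfZ h2) mulrC; congr (_ * _).
by rewrite -(pf_star h2 hu2) cstarM cstarK.
Qed.

(** If the image of y vanishes, then |rho^* y|^2 = <rho rho^* y, y> = 0 with rho^* the trace
    adjoint, and writing y = rho(x) gives |y|^2 = <x, rho^* y> = 0. *)
Lemma rho_trace_adj_inj y : rho (trace_adj y) = 0 -> y = 0.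
Proof.
move=> h; have [x xE] := rs y.
apply: (ftrace_faithful fin1 hu1).2.
rewrite -{1}xE -trace_adjE; suff -> : trace_adj y = 0 by rewrite cmul0r (pf0 h2).
by apply: (ftrace_faithful fin2 hu2).2; rewrite trace_adjE h cstar0 cmul0l (pf0 h1).
Qed.

(* The orthogonal complement of the ideal ker rho is the range of the trace
   adjoint of rho; z is its unit, and rho is an isomorphism on z P2. *)
Lemma star_hom_section : exists2 s : P1 -> P2, star_hom s & forall y, rho (s y) = y.
Proof.
have fl : linear (fun y => rho (trace_adj y)).
  by move=> k x y; rewrite trace_adj_lin (homD hr) (homZ hr).
have [w hw] := fin_linear_onto fin1 hu1 fl rho_trace_adj_inj u1.
pose z := trace_adj w.
(* Traciality moves z to the right end of |z k|^2, where it is paired with an element of the ideal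
   ker rho, to which it is orthogonal. *)
have zk k : rho k = 0 -> z *c k = 0.
  move=> k0; apply: (ftrace_faithful fin2 hu2).2.
  have -> : cstar (z *c k) *c (z *c k) = cstar k *c (cstar z *c z *c k).
    by rewrite cstarM !cmulA.
  rewrite ftraceC.
  have -> : cstar z *c z *c k *c cstar k = cstar z *c (z *c (k *c cstar k)) by rewrite !cmulA.
  rewrite ftraceC.
  have -> : z *c (k *c cstar k) *c cstar z = z *c (k *c cstar k *c cstar z) by rewrite !cmulA.
  rewrite ftraceC -{1}[k *c _ *c _]cstarK trace_adjE (hom_star hr) !(homM hr) k0.
  by rewrite !cmul0l cstar0 cstar0 cmul0l (pf0 h1).
have kz k : rho k = 0 -> k *c z = 0.
  move=> k0; apply: (ftrace_faithful fin2 hu2).2.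
  have -> : cstar (k *c z) *c (k *c z) = cstar (cstar k *c (k *c z)) *c z.
    by rewrite !cstarM cstarK !cmulA.
  by rewrite trace_adjE !(homM hr) k0 cmul0l cmul0r cstar0 cmul0l (pf0 h1).
have zE x y : rho x = rho y -> z *c x = z *c y.
  move=> h; apply/eqP; rewrite -subr_eq0 -cmulBr; apply/eqP/zk.
  by rewrite (homB hr) h subrr.
have Ez x y : rho x = rho y -> x *c z = y *c z.
  move=> h; apply/eqP; rewrite -subr_eq0 -cmulBl; apply/eqP/kz.
  by rewrite (homB hr) h subrr.
have zz x : z *c x = x *c z.
  transitivity (z *c x *c z).
    by rewrite -cmulA; apply: zE; rewrite (homM hr) hw (cmul1r hu1).
  by apply: Ez; rewrite (homM hr) hw (cmul1l hu1).
have zs : cstar z = z.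
  have E : z *c cstar z = z.
    rewrite -[RHS](cmul1r hu2); apply: zE.
    by rewrite (hom_star hr) hw (cstar_one hu1) ru.
  by rewrite -[in LHS]E cstarM cstarK.
(* The preimages are arbitrary; by [zE] the product z g(y) depends on y only, and this yields
   linearity and multiplicativity. *)
have /choice[g gE] := rs.
exists (fun y => z *c g y); last by move=> y; rewrite (homM hr) hw gE (cmul1l hu1).
split=> [k x y|x y|x].
- rewrite -cmulZr -cmulDr; apply: zE.
  by rewrite (homD hr) (homZ hr) !gE.
- transitivity (z *c (g x *c (z *c g y))); last by rewrite cmulA.
  by apply: zE; rewrite !(homM hr) !gE hw (cmul1l hu1).
- rewrite cstarM zs -zz; apply: zE.
  by rewrite (hom_star hr) !gE.
Qed.

End StarHomSection.

Lemma orthogonal_hom_sum (R : realType) (A B : cstarAlgType R) (f g : A -> B) :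
  star_hom f -> star_hom g -> (forall a b, f a *c g b = 0) -> (forall a b, g a *c f b = 0) ->
  star_hom (fun a => f a + g a).
Proof.
move=> hf hg fg gf; split=> [k x y|x y|x].
- by rewrite (homD hf) (homZ hf) (homD hg) (homZ hg) scalerDr addrACA.
- by rewrite (homM hf) (homM hg) cmulDl !cmulDr fg gf addr0 add0r.
- by rewrite (hom_star hf) (hom_star hg) cstarD.
Qed.

Section RhoInjective.
Variables (R : realType) (P1 P2 O : cstarAlgType R) (u1 : P1) (u2 : P2) (eO : O).
Hypotheses (fin1 : finite_dimensional P1) (fin2 : finite_dimensional P2).
Hypotheses (hu1 : is_one u1) (hu2 : is_one u2) (eO1 : is_one eO).
Variable rho : P2 -> P1.
Hypotheses (hr : star_hom rho) (ru : rho u2 = u1) (rs : surjective rho).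
Variables (M1 : qmaps P1 O) (M2 : qmaps P2 O) (Lam : M1 -> M2).
Hypothesis hLam : is_qmaps_map rho id Lam.
Notation e1 := (@fbas R P1 fin1 u1 hu1).
Notation e2 := (@fbas R P2 fin2 u2 hu2).
Notation q1 := (qcoef fin1 hu1 M1).
Notation q2 := (qcoef fin2 hu2 M2).
Notation X := (tensor_alg (qmaps_tensor M1)).
Notation Phi := (@qmaps_Phi R P1 O M1).
Notation one1 := (@qunit R P1 O M1).

Lemma qmaps_map_rho_inj_nz : u1 <> 0 -> injective Lam.
Proof.
move=> u1n; have m1 : is_one one1 by exact: qunitP.
have [s hs rsK] := star_hom_section fin1 fin2 hu1 hu2 hr ru rs.
have [xl xr xM xS] := tens_star_pairing (qmaps_tensor M1).
pose tau (m : M1) : X := tens (qmaps_tensor M1) u1 m.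
have htau : star_hom tau.
  split=> [k x y|x y|x]; first exact: xr.
  - by rewrite xM (cmul1l hu1).
  - by rewrite xS (cstar_one hu1).
have taui : injective tau.
  apply: (hom_inj htau) => m m0.
  have ind : lin_indep (fun _ : 'I_1 => u1).
    move=> c; rewrite big_ord1 => h i; rewrite (ord1 i).
    apply/eqP/negPn/negP => c0; apply: u1n.
    by rewrite -[u1]scale1r -(mulVf c0) -scalerA h scaler0.
  case: (tens_pairing (qmaps_tensor M1)) => _ _ _ _ /(_ 1%N _ (fun=> m) ind).
  by rewrite big_ord1 => /(_ m0 ord0).
have x1 : is_one (tau one1) by exact: tens_one.
have utau : unital_star_hom tau by apply: unital_star_homI m1 x1.
pose TX := fin_tensor fin2 hu2 x1.
have [tl tr tM tS] := tens_star_pairing TX.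
have t1 : is_one (tens TX u2 (tau one1)) by exact: tens_one.
pose z := s u1.
have zu : z + (u2 - z) = u2 by rewrite addrC subrK.
have zs : cstar z = z by rewrite -(hom_star hs) (cstar_one hu1).
have zz : z *c z = z by rewrite -(homM hs) (cmul1l hu1).
have zl y : z *c s y = s y by rewrite -(homM hs) (cmul1l hu1).
have zr y : s y *c z = s y by rewrite -(homM hs) (cmul1r hu1).
have hsp : star_pairing (fun p m => tens TX (s p) (tau m)).
  split=> [b k p q|a k x y|a a' b b'|a b].
  - by rewrite (homD hs) (homZ hs) tl.
  - by rewrite (homD htau) (homZ htau) tr.
  - by rewrite tM -(homM hs) -(homM htau).
  - by rewrite tS -(hom_star hs) -(hom_star htau).
have [Phih Phiu] := @qmaps_Phi_hom R P1 O M1.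
pose al a : TX := palg (fun p m => tens TX (s p) (tau m)) (q1 a).
pose be a : TX := tens TX (u2 - z) (Phi a).
have al_hom : star_hom al.
  have h := palg_star_hom fin1 hu1 (qmaps_tensor M1) (@qunitP R P1 O M1) hsp.
  split=> [k x y|x y|x]; rewrite /al /qcoef.
  - by rewrite (homD Phih) (homZ Phih) (homD h) (homZ h).
  - by rewrite (homM Phih) (homM h).
  - by rewrite (hom_star Phih) (hom_star h).
have y2 : (u2 - z) *c (u2 - z) = u2 - z.
  by rewrite cmulBl (cmul1l hu2) cmulBr (cmul1r hu2) zz subrr subr0.
have ys : cstar (u2 - z) = u2 - z by rewrite cstarB (cstar_one hu2) zs.
have be_hom : star_hom be.
  split=> [k x y|x y|x]; rewrite /be.
  - by rewrite (homD Phih) (homZ Phih) tr.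
  - by rewrite (homM Phih) tM y2.
  - by rewrite (hom_star Phih) tS ys.
have albe a b : al a *c be b = 0.
  transitivity (\sum_k tens TX (s (e1 k)) (tau (q1 a k)) *c be b); first exact: cmul_suml.
  apply: big1 => k _.
  by rewrite tM cmulBr (cmul1r hu2) zr subrr (lin0 (tl _)).
have beal a b : be a *c al b = 0.
  transitivity (\sum_k be a *c tens TX (s (e1 k)) (tau (q1 b k))); first exact: cmul_sumr.
  apply: big1 => k _.
  by rewrite tM cmulBl (cmul1l hu2) zl subrr (lin0 (tl _)).
pose psi a := al a + be a.
have psi_hom : star_hom psi by exact: (orthogonal_hom_sum al_hom be_hom albe beal).
have PhiO : Phi eO = tau one1 by exact: is_one_unique (Phiu _ eO1) x1.
have psi_u : unital_star_hom psi.
  apply: (unital_star_homI psi_hom eO1).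
  suff -> : psi eO = tens TX u2 (tau one1) by [].
  have alO : al eO = tens TX z (tau one1).
    rewrite -(palg_coord_tens fin1 hu1 (qmaps_tensor M1) (@qunitP R P1 O M1) u1 one1 hsp).
    by rewrite /al /qcoef PhiO.
  rewrite /psi alO /be PhiO; transitivity (tens TX (z + (u2 - z)) (tau one1)).
    by symmetry; exact: (linD (tl (tau one1))).
  exact: (congr1 (fun p => tens TX p (tau one1)) zu).
have [lam hlam psiE] := qmaps_lift fin2 hu2 eO1 M2 x1 psi_u.
pose T1 := fin_tensor fin1 hu1 x1.
have [sl sr sM sS] := tens_star_pairing T1.
have hrp : star_pairing (fun p x => tens T1 (rho p) x).
  split=> [b k p q|a k x y|a a' b b'|a b].
  - by rewrite (homD hr) (homZ hr) sl.
  - exact: sr.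
  - by rewrite sM (homM hr).
  - by rewrite sS (hom_star hr).
pose h (y : TX) : T1 := palg (fun p x => tens T1 (rho p) x) (tens_coord fin2 hu2 x1 y).
have hh : star_hom h by exact: palg_star_hom.
have hE p x : h (tens TX p x) = tens T1 (rho p) x.
  exact: (palg_coord_tens fin2 hu2 TX x1 p x hrp).
(* Coordinates are compared after applying rho (x) id to psi: this undoes s on the first summand and
   kills the second, as rho(1 - s(1)) = 0. *)
have E : lam \o Lam = tau.
  apply: (qmaps_hom_eq (findim := fin1) (u1 := hu1) eO1 x1).
  - exact: unital_star_hom_comp hLam.1 hlam.
  - exact: utau.
  move=> a; apply: (palg_injective (T := T1)).
  transitivity (h (psi a)).
    rewrite psiE /palg (hom_sum hh); symmetry.
    transitivity (\sum_k \sum_l tens T1 (e1 l)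
        (ftrace fin1 hu1 (cstar (e1 l) *c rho (e2 k)) *: lam (q2 a k))).
      apply: eq_bigr => k _; rewrite hE ffunE {1}(fbas_span fin1 hu1 (rho (e2 k))).
      rewrite (lin_sum (sl _)); apply: eq_bigr => j _.
      by rewrite (linZ (sl _)) (linZ (sr _)).
    rewrite exchange_big; apply: eq_bigr => l _.
    transitivity (tens T1 (e1 l)
        (\sum_k ftrace fin1 hu1 (cstar (e1 l) *c rho (e2 k)) *: lam (q2 a k))).
      by symmetry; exact: (lin_sum (sr _)).
    congr (tens T1 _ _); rewrite ffunE /= (qmaps_map_coef fin2 hu2 hLam) (hom_sum hlam.1).
    by apply: eq_bigr => k _; rewrite (homZ hlam.1).
  have ru0 : rho (u2 - z) = 0 by rewrite (homB hr) rsK ru subrr.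
  rewrite (homD hh) /be hE ru0 (lin0 (sl _)) addr0 /al /palg (hom_sum hh).
  by apply: eq_bigr => k _; rewrite hE rsK ffunE.
move=> x y xy; apply: taui.
by rewrite -E /= xy.
Qed.

End RhoInjective.

Lemma cabsM (R : realType) (k l : R[i]) : cabs (k * l) = cabs k * cabs l.
Proof. by apply: (@complexI R); rewrite -cabsE normrM !cabsE rmorphM. Qed.

Lemma pf_bounded (R : realType) (A : cstarAlgType R) (F : A -> R[i]) (e : A) x :
  posfun F -> is_one e -> cabs (F x) <= complex.Re (F e) * nm x.
Proof.
move=> hF e1; have hip := pf_semi e1 hF.
have r0 : 0 <= complex.Re (F e).
  by have := sqnm_ge0 hip e; rewrite /sqnm /pf_ip (cstar_one e1) (cmul1l e1).
have [->|x0] := eqVneq x 0.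
  by rewrite (pf0 hF) cabs_real normr0 mulr_ge0 // nm_ge0.
have n0 : 0 < nm x.
  by rewrite lt_neqAle nm_ge0 andbT eq_sym; apply: contra_neq x0 => /nm0_eq0.
have := cabs_ge0 (F x); rewrite le_eqVlt => /orP[/eqP <-|a0].
  by rewrite mulr_ge0 // nm_ge0.
(* With this weight the two terms of [re_ip_le] get the same upper bound |F x| |x| F(1). *)
have t0 : 0 < cabs (F x) * nm x by rewrite mulr_gt0.
have := re_ip_le hip e (conjc (F x) *: x) t0.
rewrite (ipZr hip) sqnmZ // {1}/pf_ip (cstar_one e1) (cmul1l e1) -cabs_sqr /=.
have -> : sqnm (pf_ip F) e = complex.Re (F e).
  by rewrite /sqnm /pf_ip (cstar_one e1) (cmul1l e1).
have -> : cabs (conjc (F x)) = cabs (F x).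
  by apply/eqP; rewrite -(@eqrXn2 _ 2) ?cabs_ge0 //; apply/eqP/(@complexI R);
    rewrite !cabs_sqr conjcK mulrC.
have hx : sqnm (pf_ip F) x <= nm x ^+ 2 * complex.Re (F e).
  have := pf_nm hF e1 x; rewrite lecE => /andP[_ h]; apply: le_trans h _.
  by case: (F e) => a b /=; rewrite mul0r subr0.
move: hx r0 a0 n0 t0; rewrite -/(pf_ip F x x).
move: (sqnm _ x) (complex.Re (F e)) (cabs (F x)) (nm x) => w r a n hw r0 a0 n0 t0 h.
have h2 : 2 * a ^+ 2 <= a * n * r + (a * n)^-1 * (a ^+ 2 * (n ^+ 2 * r)).
  apply: le_trans h _; rewrite lerD2l ler_wpM2l ?invr_ge0 ?(ltW t0) //.
  by rewrite ler_wpM2l ?exprn_ge0 ?(ltW a0).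
have E : (a * n)^-1 * (a ^+ 2 * (n ^+ 2 * r)) = a * n * r by field; rewrite !gt_eqF.
by rewrite -(ler_pM2l a0); move: h2; rewrite E => ?; lra.
Qed.

(** * The case P = 0 *)

Section ZeroDomain.
Variables (R : realType) (P O : cstarAlgType R) (eO : O).
Hypotheses (findim : finite_dimensional P) (u1 : is_one (0 : P)) (eO1 : is_one eO).
Variable M : qmaps P O.

Lemma fdim_zero (k : 'I_(fdim findim u1)) : False.
Proof.
have b0 : fbas (u1 := u1) k = 0 by rewrite -[LHS](cmul1l u1) cmul0l.
have := fbas_orth k k.
rewrite b0 cmul0r (pf0 (ftrace_faithful findim u1).1) eqxx => /eqP.
by rewrite eq_sym oner_eq0.
Qed.

Lemma zero_tens_one (X : cstarAlgType R) (e : X) (e1 : is_one e) (TX : tensorProduct P X) :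
  is_one (0 : TX).
Proof.
have [tl _ _ _] := tens_star_pairing TX.
suff <- : tens TX 0 e = 0 by exact: tens_one.
exact: (lin0 (tl e)).
Qed.

Lemma qmaps_zero_hom (X : cstarAlgType R) (e : X) : is_one e ->
  exists f : M -> X, unital_star_hom f.
Proof.
move=> e1; pose TX := fin_tensor findim u1 e1.
have h1 : is_one (0 : TX) by exact: zero_tens_one.
have hpsi : unital_star_hom (fun _ : O => 0 : TX).
  apply: (unital_star_homI _ eO1 h1); split=> [k x y|x y|x].
  - by rewrite scaler0 addr0.
  - by rewrite cmul0l.
  - by rewrite cstar0.
by have [f hf _] := qmaps_lift findim u1 eO1 M e1 hpsi; exists f.
Qed.

Lemma qmaps_zero_hom_eq (X : cstarAlgType R) (e : X) (f g : M -> X) : is_one e ->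
  unital_star_hom f -> unital_star_hom g -> f = g.
Proof.
move=> e1 hf hg; apply: (qmaps_hom_eq (findim := findim) (u1 := u1) eO1 e1 hf hg) => a.
by apply/ffunP => k; case: (fdim_zero k).
Qed.

(** The basis of P is empty, so there are no generators besides the unit. The multiples of the unit
    are closed: a functional positive at a nonzero unit recovers the limit coefficient. *)
Lemma qmaps_zero_scalar (m : M) : exists c, m = c *: @qunit R P O M.
Proof.
have q1 : is_one (@qunit R P O M) by exact: qunitP.
move: (qunit M) q1 => q q1; move: m.
apply: (qmaps_generated (findim := findim) (u1 := u1) eO1
          (D := fun m => exists c, m = c *: q)).
- by exists 1; rewrite scale1r; apply: is_one_unique; [exact: qunitP|].
- by move=> k _ _ [c ->] [d ->]; exists (k * c + d); rewrite scalerA scalerDl.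
- by move=> _ _ [c ->] [d ->]; exists (c * d); rewrite cmulZl cmulZr (cmul1l q1) scalerA.
- by move=> _ [c ->]; exists (conjc c); rewrite cstarZ (cstar_one q1).
- move=> v l /choice[c vE] hl.
  have [q0|q0] := pselect (q = 0).
    exists 0; rewrite scale0r; apply: (tendsto_unique hl) => d d0.
    by exists 0%N => i _; rewrite vE q0 scaler0 subrr nm0.
  have [s hs sq] := posfun_gt0 q1 (pos_one q1) q0.
  have sq0 : s q != 0 by rewrite gt_eqF.
  exists (s l / s q); apply: (tendsto_unique hl).
  pose C := complex.Re (s q) * (cabs (s q)^-1 * nm q).
  have C0 : 0 <= C.
    by rewrite !mulr_ge0 ?cabs_ge0 ?nm_ge0 // -ler0c -(@ge0_complexE R) ltW.
  move=> d d0; have C1 : 0 < C + 1 by rewrite ltr_wpDl.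
  have [N hN] := hl _ (divr_gt0 d0 C1); exists N => i /hN.
  rewrite ltr_pdivlMr // => hi; apply: le_lt_trans _ hi.
  have -> : v i - (s l / s q) *: q = (s (v i - l) / s q) *: q.
    by rewrite (pfB hs) mulrBl scalerBl {2}vE (pfZ hs) mulfK // -vE.
  rewrite nmZ cabsM.
  have := pf_bounded (v i - l) hs q1; rewrite mulrDr mulr1.
  have := nm_ge0 (v i - l); have := nm_ge0 q; have := cabs_ge0 (s q)^-1.
  rewrite /C; move: (nm (v i - l)) (nm q) (cabs (s q)^-1) (cabs (s _)) (complex.Re _).
  move=> x y w z r w0 y0 x0 h.
  apply: (@le_trans _ _ (r * x * w * y)); last first.
    have -> : x * (r * (w * y)) = r * x * w * y by ring.
    by rewrite lerDl.
  by rewrite !ler_wpM2r.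
- by move=> a k; case: (fdim_zero k).
Qed.

End ZeroDomain.

Section Injectivity.
Variable R : realType.
Implicit Types P O : cstarAlgType R.

Lemma qmaps_map_rho_inj P1 P2 O (M1 : qmaps P1 O) (M2 : qmaps P2 O) (rho : P2 -> P1)
    (Lam : M1 -> M2) : finite_qspace P1 -> finite_qspace P2 -> compact_qspace O ->
    unital_star_hom rho -> is_qmaps_map rho id Lam ->
  surjective rho -> nonzero P1 \/ nonzero O -> injective Lam.
Proof.
move=> [[u1 hu1] fin1] [[u2 hu2] fin2] [eO eO1] [hr ru] h rs nz.
have ru2 : rho u2 = u1 by exact: is_one_unique (ru _ hu2) hu1.
have [u0|u0] := pselect (u1 = 0); last first.
  exact: (qmaps_map_rho_inj_nz fin1 fin2 hu1 hu2 eO1 hr ru2 rs h u0).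
have On : eO <> 0.
  move=> eO0; case: nz => -[x xn]; apply: xn.
    by rewrite -[x](cmul1l hu1) u0 cmul0l.
  by rewrite -[x](cmul1l eO1) eO0 cmul0l.
move: hu1; rewrite u0 => hu1.
have [hL Lu] := h.1; apply: (hom_inj hL) => x Lx.
have [c xE] := qmaps_zero_scalar fin1 hu1 eO1 x.
have [c0|c0] := eqVneq c 0; first by rewrite xE c0 scale0r.
exfalso; apply: On.
(* The map a |-> 1 (x) a gives a unital homomorphism from the second algebra to O. If [Lam] killed a
   nonzero multiple of the unit, the second algebra would have unit 0, and so would O. *)
pose TO := fin_tensor fin2 hu2 eO1.
have [_ tr tM tS] := tens_star_pairing TO.
have hpsi : unital_star_hom (tens TO u2).
  apply: (unital_star_homI _ eO1); last exact: tens_one.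
  split=> [k y z|y z|y]; first exact: tr.
  - by rewrite tM (cmul1l hu2).
  - by rewrite tS (cstar_one hu2).
have [f [hf fu] _] := qmaps_lift fin2 hu2 eO1 M2 eO1 hpsi.
have q0 : Lam (qunit M1) = 0.
  have := Lx; rewrite xE (homZ hL) => /eqP; rewrite scaler_eq0 (negPf c0) /= => /eqP.
  by [].
have M1u := Lu _ (@qunitP _ _ _ M1).
rewrite -(is_one_unique (fu _ M1u) eO1) q0; exact: (hom0 hf).
Qed.

(** Any two unital homomorphisms out of such an algebra agree, so every unital homomorphism from
    [M2] back to [M1] is a left inverse. *)
Lemma qmaps_map_pi_inj_zero P O1 O2 (M1 : qmaps P O1) (M2 : qmaps P O2) (pi : O1 -> O2)
    (Lam : M1 -> M2) : finite_dimensional P -> is_one (0 : P) ->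
    compact_qspace O1 -> compact_qspace O2 -> is_qmaps_map id pi Lam ->
  injective Lam.
Proof.
move=> findim u1 [e1 e11] [e2 e21] h.
have q1 : is_one (qunit M1) by exact: qunitP.
have [f hf] := qmaps_zero_hom findim u1 e21 M2 q1.
have E : f \o Lam = id.
  apply: (qmaps_zero_hom_eq findim u1 e11 q1); last by split.
  exact: unital_star_hom_comp h.1 hf.
by move=> x y xy; have := congr1 (fun F => F x) E; rewrite /= xy => <-;
  exact: (congr1 (fun F : M1 -> M1 => F y) E).
Qed.

End Injectivity.

Lemma cabs_conjc (R : realType) (k : R[i]) : cabs (conjc k) = cabs k.
Proof.
apply/eqP; rewrite -(@eqrXn2 _ 2) ?cabs_ge0 //; apply/eqP/(@complexI R).
by rewrite !cabs_sqr conjcK mulrC.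
Qed.

(** The weight a / X balances the two terms, where a = |<x, y>|^2 and X = |x|^2; if X = 0, the
    weight |y|^2 + 1 contradicts a > 0. *)
Lemma ip_cauchy (R : realType) (W : lmodType R[i]) (ip : W -> W -> R[i]) x y :
  semi_inner ip -> cabs (ip x y) ^+ 2 <= sqnm ip x * sqnm ip y.
Proof.
move=> hip.
have h t : 0 < t -> 2 * cabs (ip x y) ^+ 2 <= t * sqnm ip x + t^-1 * (cabs (ip x y) ^+ 2 * sqnm ip y).
  move=> t0; have := re_ip_le hip x (conjc (ip x y) *: y) t0.
  by rewrite (ipZr hip) (sqnmZ hip) cabs_conjc -cabs_sqr.
have := sqnm_ge0 hip x; have := sqnm_ge0 hip y; have := sqr_ge0 (cabs (ip x y)).
move: h; move: (cabs _ ^+ 2) (sqnm ip x) (sqnm ip y) => a X Y h a0 Y0 X0.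
have [->|an] := eqVneq a 0; first exact: mulr_ge0.
have ap : 0 < a by rewrite lt_neqAle eq_sym an.
move: X0; rewrite le_eqVlt => /orP[/eqP X0|X0].
  exfalso; have Y1 : 0 < Y + 1 by rewrite ltr_wpDl.
  have := h _ Y1; rewrite -X0 mulr0 add0r [_^-1 * _]mulrC ler_pdivlMr //.
  by move: ap Y0; nra.
have := h _ (divr_gt0 ap X0).
have -> : a / X * X + (a / X)^-1 * (a * Y) = a + X * Y by field; rewrite !gt_eqF.
lra.
Qed.

(** * Operators on a semi-inner product space *)

Section AdjointableOperators.
Variables (R : realType) (K : lmodType R[i]) (ip : K -> K -> R[i]).
Hypothesis hip : semi_inner ip.

Definition bounded_map (T : K -> K) : Prop :=
  exists2 c : R, 0 <= c & forall x, sqnm ip (T x) <= c ^+ 2 * sqnm ip x.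

(* An operator together with a formal adjoint, on which scalars act by
   conjugation: on a degenerate K the adjoint is not unique as a function. *)
Definition oppair : Type := ((K -> K) * (K -> K))%type.
HB.instance Definition _ := GRing.Zmodule.on oppair.

Definition opscale (k : R[i]) (p : oppair) : oppair := (k *: p.1, conjc k *: p.2).

Lemma opscaleA a b p : opscale a (opscale b p) = opscale (a * b) p.
Proof. by rewrite /opscale /= !scalerA conjcM. Qed.
Lemma opscale1 : left_id 1 opscale.
Proof. by move=> [p q]; rewrite /opscale conjc1 !scale1r. Qed.
Lemma opscaleDr : right_distributive opscale +%R.
Proof. by move=> k p q; rewrite /opscale /= !scalerDr. Qed.
Lemma opscaleDl p : {morph opscale^~ p : a b / a + b}.
Proof. by move=> a b; rewrite /opscale /= conjcD !scalerDl. Qed.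

HB.instance Definition _ := GRing.Zmodule_isLmodule.Build R[i] oppair
  opscaleA opscale1 opscaleDr opscaleDl.

Definition adjoint_pair (p : oppair) : Prop :=
  [/\ linear p.1, linear p.2, forall x y, ip (p.1 x) y = ip x (p.2 y),
      bounded_map p.1 & bounded_map p.2].

Definition opmul (p q : oppair) : oppair := (p.1 \o q.1, q.2 \o p.2).
Definition opstar (p : oppair) : oppair := (p.2, p.1).

Lemma bounded_mapL k S T : bounded_map S -> bounded_map T -> bounded_map (k *: S + T).
Proof.
move=> [c c0 hc] [d d0 hd]; exists (2 * (cabs k * c + d)).
  by rewrite mulr_ge0 // addr_ge0 // mulr_ge0 // cabs_ge0.
move=> x; have k0 := cabs_ge0 k.
have h : sqnm ip (k *: S x + T x) <= 2 * (cabs k ^+ 2 * sqnm ip (S x) + sqnm ip (T x)).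
  rewrite (sqnmD hip) (sqnmZ hip).
  by have := re_ip_le hip (k *: S x) (T x) ltr01; rewrite (sqnmZ hip) invr1; lra.
apply: le_trans h _; have := hc x; have := hd x; have := sqnm_ge0 hip x.
move: (sqnm ip x) (sqnm ip (S x)) (sqnm ip (T x)) (cabs k) k0 => n s t r r0 n0 ht hs.
have h1 : r ^+ 2 * s <= (r * c) ^+ 2 * n.
  by rewrite exprMn -[leRHS]mulrA ler_wpM2l // sqr_ge0.
have h2 : 0 <= r * c * d * n by rewrite !mulr_ge0.
have h3 : 0 <= (r * c) ^+ 2 * n by rewrite mulr_ge0 // sqr_ge0.
have h4 : 0 <= d ^+ 2 * n by rewrite mulr_ge0 // sqr_ge0.
by move: h1 h2 h3 h4 ht; rewrite !expr2; lra.
Qed.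

Lemma bounded_map_comp S T : bounded_map S -> bounded_map T -> bounded_map (S \o T).
Proof.
move=> [c c0 hc] [d d0 hd]; exists (c * d); first exact: mulr_ge0.
move=> x /=; apply: le_trans (hc _) _; rewrite exprMn -[leRHS]mulrA ler_wpM2l ?sqr_ge0 //.
Qed.

Lemma adjoint_pair0 : adjoint_pair 0.
Proof.
have l0 : linear (0 : K -> K) by move=> k x y; rewrite /= scaler0 addr0.
have b0 : bounded_map (0 : K -> K).
  by exists 0 => // x; rewrite /= (sqnm0 hip) expr0n mul0r.
split=> // x y; by rewrite /= (ip0l hip) (ip0r hip).
Qed.

Lemma adjoint_pairL k p q : adjoint_pair p -> adjoint_pair q -> adjoint_pair (k *: p + q).
Proof.
have ll S T c : linear S -> linear T -> linear (c *: S + T : K -> K).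
  move=> hS hT a x y; rewrite -![(_ + _ : K -> K) _]/(c *: S _ + T _) hS hT.
  by rewrite !scalerDr !scalerA [c * a]mulrC addrACA.
move=> [p1 p2 pa pb pc] [q1 q2 qa qb qc]; split.
- exact: ll.
- exact: ll.
- move=> x y; rewrite -[X in ip X _]/(k *: p.1 x + q.1 x).
  rewrite -[RHS]/(ip x (conjc k *: p.2 y + q.2 y)).
  by rewrite (ipDl hip) (ipDr hip) (ipZl hip) (ipZr hip) pa qa.
- exact: bounded_mapL.
- exact: bounded_mapL.
Qed.

Lemma adjoint_pairM p q : adjoint_pair p -> adjoint_pair q -> adjoint_pair (opmul p q).
Proof.
move=> [p1 p2 pa pb pc] [q1 q2 qa qb qc]; split.
- by move=> k x y /=; rewrite q1 p1.
- by move=> k x y /=; rewrite p2 q2.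
- by move=> x y /=; rewrite pa qa.
- exact: bounded_map_comp.
- exact: bounded_map_comp.
Qed.

Lemma adjoint_pair_star p : adjoint_pair p -> adjoint_pair (opstar p).
Proof.
by move=> [p1 p2 pa pb pc]; split=> // x y; rewrite /= (ipC hip) -pa -(ipC hip).
Qed.

Lemma opmulLl k (p q z : oppair) : adjoint_pair z ->
  opmul (k *: p + q) z = k *: opmul p z + opmul q z.
Proof.
move=> [_ z2 _ _ _]; congr pair; apply: funext => x; last exact: z2.
Qed.

Lemma opmulLr k (p q z : oppair) : adjoint_pair z ->
  opmul z (k *: p + q) = k *: opmul z p + opmul z q.
Proof.
move=> [z1 _ _ _ _]; congr pair; apply: funext => x; first exact: z1.
Qed.

Lemma opstarL k p q : opstar (k *: p + q) = conjc k *: opstar p + opstar q.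
Proof.
by congr pair; apply: funext => x; rewrite /= ?conjcK.
Qed.

Definition op_opdata : opdata R := {|
  od_space := oppair; od_dom := adjoint_pair; od_mul := opmul; od_star := opstar;
  od_dom0 := adjoint_pair0; od_domL := adjoint_pairL; od_domM := adjoint_pairM;
  od_dom_star := adjoint_pair_star;
  od_mulA := fun a b c _ _ _ => erefl;
  od_mulLl := fun k a b c _ _ h => opmulLl k a b h;
  od_mulLr := fun k a b c _ _ h => opmulLr k a b h;
  od_starL := fun k a b _ _ => opstarL k a b;
  od_starK := fun a _ => let: (x, y) as a := a return opstar (opstar a) = a in erefl;
  od_starM := fun a b _ _ => erefl;
  od_vec := K; od_idx := unit;
  od_ip := fun _ => ip; od_ipP := fun _ => hip;
  od_act := fun p x => p.1 x;
  od_actL := fun k a b x _ _ => erefl;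
  od_actM := fun a b x _ _ => erefl;
  od_adj := fun _ a x y h => let: And5 _ _ e _ _ := h in e x y;
  od_bnd := fun a h => let: And5 _ _ _ (ex_intro2 c c0 hc) _ := h in
     ex_intro2 _ _ c c0 (fun _ => hc) |}.

Definition opalg : cstarAlgType R := completion (op_preCstar op_opdata).
Definition opj (p : oppair) : opalg := @cinj R (op_preCstar op_opdata) p.

Lemma opjL k p q : adjoint_pair p -> adjoint_pair q -> opj (k *: p + q) = k *: opj p + opj q.
Proof. exact: (@cinjL R (op_preCstar op_opdata)). Qed.
Lemma opjM p q : adjoint_pair p -> adjoint_pair q -> opj (opmul p q) = opj p *c opj q.
Proof. exact: (@cinjM R (op_preCstar op_opdata)). Qed.
Lemma opj_star p : adjoint_pair p -> opj (opstar p) = cstar (opj p).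
Proof. exact: (@cinj_star R (op_preCstar op_opdata)). Qed.
Lemma nm_opj p : adjoint_pair p -> nm (opj p) = @op_nm R op_opdata p.
Proof. exact: (@nm_cinj R (op_preCstar op_opdata)). Qed.

Lemma opid_adjoint : adjoint_pair (id, id).
Proof.
have b : bounded_map id by exists 1 => // x; rewrite expr1n mul1r.
by split.
Qed.

Lemma opj_one : is_one (opj (id, id)).
Proof.
by apply: (@cinj_unit R (op_preCstar op_opdata)); [exact: opid_adjoint|case].
Qed.

Lemma opj_eq p q : adjoint_pair p -> adjoint_pair q ->
  (forall x, sqnm ip (p.1 x - q.1 x) = 0) -> opj p = opj q.
Proof.
move=> hp hq h; apply/eqP; rewrite -subr_eq0 -(scaleN1r (opj q)) addrC -opjL //.
apply/eqP/nm_le0; rewrite nm_opj; last exact: adjoint_pairL.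
apply: op_nm_le; split=> [|i x]; first exact: lexx.
rewrite -[X in sqnm _ X <= _]/((-1) *: q.1 x + p.1 x) scaleN1r addrC h.
by rewrite expr0n mul0r.
Qed.

Lemma opj_act_null p x : adjoint_pair p -> opj p = 0 -> sqnm ip (p.1 x) = 0.
Proof.
move=> hp h0; apply/eqP; rewrite eq_le sqnm_ge0 // andbT.
have := @op_nmP R op_opdata p tt x hp; rewrite -(nm_opj hp) h0 nm0.
by rewrite expr0n mul0r.
Qed.

End AdjointableOperators.

(** * Rank-one operators and representations *)

Section RankOne.
Variables (R : realType) (K : lmodType R[i]) (ip : K -> K -> R[i]).
Hypothesis hip : semi_inner ip.
Notation X := (opalg hip).
Notation oj := (opj hip).

(** The operator |x><y| together with its adjoint |y><x|. A vector x of K is represented in the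
    C*-algebra by |x><y| with y fixed. *)
Definition rkpair (x y : K) : oppair K := (fun z => ip y z *: x, fun z => ip x z *: y).
Definition rk (x y : K) : X := oj (rkpair x y).

Lemma rk_adjoint x y : adjoint_pair ip (rkpair x y).
Proof.
have lin a b : linear (fun z => ip a z *: b).
  by move=> k z w; rewrite (ipLr hip) scalerDl scalerA.
have bnd a b : bounded_map ip (fun z => ip a z *: b).
  exists (Num.sqrt (sqnm ip a * sqnm ip b)) => [|z]; first exact: sqrtr_ge0.
  have a0 := sqnm_ge0 hip a; have b0 := sqnm_ge0 hip b.
  rewrite sqr_sqrtr ?mulr_ge0 // (sqnmZ hip).
  apply: le_trans (ler_wpM2r b0 (ip_cauchy a z hip)) _.
  by rewrite mulrAC.
split=> [||z w||]; [exact: lin|exact: lin| |exact: bnd|exact: bnd].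
by rewrite /= (ipZl hip) (ipZr hip) -(ipC hip) mulrC.
Qed.

Lemma rk_star x y : cstar (rk x y) = rk y x.
Proof. by rewrite /rk -opj_star; [|exact: rk_adjoint]. Qed.

Lemma oj_rk p x y : adjoint_pair ip p -> oj p *c rk x y = rk (p.1 x) y.
Proof.
move=> hp; have [p1 p2 pa _ _] := hp.
rewrite /rk -opjM //; last exact: rk_adjoint.
congr (oj _); congr pair; apply: funext => z /=; first exact: (linZ p1).
by rewrite -pa.
Qed.

Lemma rk_linl y : linear (fun x => rk x y).
Proof.
move=> k x x'; rewrite /rk -opjL; try exact: rk_adjoint.
congr (oj _); congr pair; apply: funext => z.
  rewrite -[RHS]/(k *: (ip y z *: x) + ip y z *: x').
  by rewrite scalerDr !scalerA mulrC.
rewrite -[RHS]/(conjc k *: (ip x z *: y) + ip x' z *: y).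
by rewrite (ipDl hip) (ipZl hip) scalerDl scalerA.
Qed.

Lemma rkM x y z w : rk x y *c rk z w = ip y z *: rk x w.
Proof. by rewrite /rk oj_rk ?(linZ (rk_linl w)) //; exact: rk_adjoint. Qed.

Lemma rk_null x x' y : sqnm ip (x - x') = 0 -> rk x y = rk x' y.
Proof.
move=> h; apply: opj_eq; try exact: rk_adjoint.
by move=> z; rewrite /= -scalerBr (sqnmZ hip) h mulr0.
Qed.

Lemma rk_eq0 y : rk y y = 0 -> sqnm ip y = 0.
Proof.
move=> /(opj_act_null y (rk_adjoint y y)) /=.
rewrite (sqnmZ hip) => /eqP; rewrite mulf_eq0 => /orP[|/eqP //].
rewrite expf_eq0 /= => /eqP h; have : ip y y = 0.
  by apply/eqP; rewrite -normr_eq0 cabsE h.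
by rewrite /sqnm => ->.
Qed.

End RankOne.

Definition star_rep (R : realType) (A : cstarAlgType R) (K : lmodType R[i])
    (ip : K -> K -> R[i]) (al : A -> K -> K) : Prop :=
  [/\ forall x, linear (fun a => al a x), forall a, linear (al a),
      forall a b x, al (a *c b) x = al a (al b x)
    & forall a x y, ip (al a x) y = ip x (al (cstar a) y)].

Section RepHom.
Variables (R : realType) (A : cstarAlgType R) (e : A) (K : lmodType R[i]) (ip : K -> K -> R[i]).
Hypotheses (hip : semi_inner ip) (e1 : is_one e).
Variable al : A -> K -> K.
Hypotheses (hal : star_rep ip al) (al1 : forall x, al e x = x).
Hypothesis alb : forall a x, sqnm ip (al a x) <= nm a ^+ 2 * sqnm ip x.

Definition rep_pair (a : A) : oppair K := (al a, al (cstar a)).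
Definition rep_hom (a : A) : opalg hip := opj hip (rep_pair a).

Lemma rep_adjoint a : adjoint_pair ip (rep_pair a).
Proof.
have [l1 l2 m s] := hal.
have bnd b : bounded_map ip (al b) by exists (nm b); [exact: nm_ge0|exact: alb].
by split; [exact: l2|exact: l2|exact: s|exact: bnd|exact: bnd].
Qed.

Lemma rep_unital_hom : unital_star_hom rep_hom.
Proof.
have [l1 l2 m s] := hal.
apply: (unital_star_homI _ e1).
  split=> [k x y|x y|x].
  - rewrite /rep_hom -opjL; try exact: rep_adjoint.
    congr (opj _ _); congr pair; apply: funext => z; first exact: l1.
    by rewrite cstar_antilinear; exact: l1.
  - rewrite /rep_hom -opjM; try exact: rep_adjoint.
    congr (opj _ _); congr pair; apply: funext => z; first exact: m.
    by rewrite cstarM; exact: m.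
  - rewrite /rep_hom -opj_star; last exact: rep_adjoint.
    by congr (opj _ _); congr pair; apply: funext => z; rewrite /= cstarK.
suff -> : rep_hom e = opj hip (id, id) by exact: opj_one.
by congr (opj _ _); congr pair; apply: funext => z; rewrite /= ?(cstar_one e1).
Qed.

Lemma rep_rk a x y : rep_hom a *c rk hip x y = rk hip (al a x) y.
Proof. by rewrite /rep_hom oj_rk //; exact: rep_adjoint. Qed.

End RepHom.

(* J is a partial isometry with domain projection q and range orthogonal to q;
   U exchanges the two ranges and fixes the orthogonal complement of their sum. *)
Lemma exchange_unitary (R : realType) (T : cstarAlgType R) (e J q : T) : is_one e ->
  selfadj q -> q *c q = q -> cstar J *c J = q -> q *c J = 0 ->
  exists U, [/\ selfadj U, U *c U = e, U *c J = q & U *c q = J].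
Proof.
move=> e1 qs qq JJ qJ.
have Jsq : cstar J *c q = 0 by rewrite -qs -cstarM qJ cstar0.
have Jq : J *c q = J.
  apply/eqP; rewrite -subr_eq0; apply/eqP/cstar_mul_eq0.
  rewrite cstarB cstarM qs cmulBl !cmulBr -!cmulA (cmulA (cstar J) J q) JJ qq subrr.
  by rewrite qq !subrr.
have J2 : J *c J = 0 by rewrite -{1}Jq -cmulA qJ cmul0r.
have Js2 : cstar J *c cstar J = 0 by rewrite -cstarM J2 cstar0.
pose f := e - q - J *c cstar J.
have fJ : f *c J = 0.
  by rewrite /f !cmulBl (cmul1l e1) qJ -cmulA JJ Jq subr0 subrr.
have fq : f *c q = 0.
  by rewrite /f !cmulBl (cmul1l e1) qq -cmulA Jsq cmul0r subrr subr0.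
have fs : selfadj f.
  by rewrite /selfadj /f !cstarB (cstar_one e1) qs cstarM cstarK.
have Jf : cstar J *c f = 0 by rewrite -fs -cstarM fJ cstar0.
have qf : q *c f = 0 by rewrite -fs -qs -cstarM fq cstar0.
have Jf' : J *c f = 0 by rewrite -Jq -cmulA qf cmul0r.
have fJs : f *c cstar J = 0 by rewrite -fs -cstarM Jf' cstar0.
have ff : f *c f = f.
  by rewrite {1}/f !cmulBl (cmul1l e1) qf -cmulA Jf cmul0r !subr0.
have fE : J *c cstar J + q + f = e by rewrite /f; lcomb R.
clearbody f; exists (J + cstar J + f); split.
- by rewrite /selfadj !cstarD cstarK fs [cstar J + J]addrC.
- rewrite !cmulDl !cmulDr J2 Js2 JJ Jf Jf' fJ fJs ff !addr0 !add0r.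
  by rewrite -fE; lcomb R.
- by rewrite !cmulDl J2 JJ fJ add0r addr0.
- by rewrite !cmulDl Jq Jsq fq !addr0.
Qed.

Lemma conj_unitary_hom (R : realType) (A B : cstarAlgType R) (f : A -> B) (e U : B) :
  is_one e -> unital_star_hom f -> selfadj U -> U *c U = e ->
  unital_star_hom (fun a => U *c f a *c U).
Proof.
move=> e1 [hf fu] Us UU; split=> [|a a1].
  split=> [k x y|x y|x].
  - by rewrite (homD hf) (homZ hf) cmulDr cmulDl cmulZr cmulZl.
  - rewrite (homM hf); transitivity (U *c f x *c (U *c U) *c f y *c U); last by rewrite !cmulA.
    by rewrite UU (cmul1r e1) !cmulA.
  - by rewrite (hom_star hf) !cstarM Us cmulA.
suff -> : U *c f a *c U = e by [].
by rewrite (cmul1r (fu _ a1)) UU.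
Qed.

(** * Dilation of finitely many matrix coefficients *)

Section MatrixAlgebra.
Variables (R : realType) (N : nat).
Notation I2 := ('I_N * 'I_N)%type.
Implicit Types A B : 'M[R[i]]_N.

Definition mxstar A : 'M[R[i]]_N := map_mx (@conjc R) A^T.
Definition mxunit (k : 'I_#|{: I2}|) : 'M[R[i]]_N :=
  delta_mx (enum_val k).1 (enum_val k).2.

Lemma mxunit_star_mul k A :
  \tr (mxstar (mxunit k) *m A) = A (enum_val k).1 (enum_val k).2.
Proof.
rewrite /mxtrace (bigD1 (enum_val k).2) //= big1 ?addr0 => [|j /negPf hj].
  rewrite mxE (bigD1 (enum_val k).1) //= big1 ?addr0 => [|j /negPf hj].
    by rewrite !mxE rmorph_nat !eqxx mul1r.
  by rewrite !mxE rmorph_nat hj mul0r.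
by rewrite mxE big1 // => i _; rewrite !mxE rmorph_nat hj andbF mul0r.
Qed.

Lemma mxstar_antilin k A B : mxstar (k *: A + B) = conjc k *: mxstar A + mxstar B.
Proof. by apply/matrixP => i j; rewrite !mxE conjcD conjcM. Qed.

Lemma mxstarK : involutive mxstar.
Proof. by move=> A; apply/matrixP => i j; rewrite !mxE conjcK. Qed.

Lemma mxstarM A B : mxstar (A *m B) = mxstar B *m mxstar A.
Proof.
apply/matrixP => i j; rewrite !mxE conjc_sum; apply: eq_bigr => k _.
by rewrite !mxE conjcM mulrC.
Qed.

Lemma mx_mull_lin B : linear (fun A => A *m B).
Proof. by move=> k x y; rewrite mulmxDl scalemxAl. Qed.
Lemma mx_mulr_lin A : linear (mulmx A : 'M[R[i]]_N -> 'M[R[i]]_N).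
Proof. by move=> k x y; rewrite mulmxDr scalemxAr. Qed.

Lemma mxtr_lin k A B : \tr (k *: A + B) = k * \tr A + \tr B.
Proof. by rewrite mxtraceD mxtraceZ. Qed.

Lemma mxtr_star A : \tr (mxstar A) = conjc (\tr A).
Proof. by rewrite /mxtrace conjc_sum; apply: eq_bigr => i _; rewrite !mxE. Qed.

Lemma mxunit_span A : A = \sum_k \tr (mxstar (mxunit k) *m A) *: mxunit k.
Proof.
under eq_bigr => k _ do rewrite mxunit_star_mul.
rewrite -(big_enum_val (A := {: I2}) (fun p => A p.1 p.2 *: delta_mx p.1 p.2)).
rewrite {1}[A]matrix_sum_delta pair_bigA /=.
by apply: eq_bigl.
Qed.

Lemma mxunit_orth k l : \tr (mxstar (mxunit k) *m mxunit l) = (k == l)%:R.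
Proof. by rewrite mxunit_star_mul mxE -xpair_eqE -!surjective_pairing (inj_eq enum_val_inj). Qed.

(** Matrices with the usual trace and the matrix units. As [talg] asks for no norm, none has to be
    put on them. *)
Definition mx_talg : talg R := {|
  ta_space := 'M[R[i]]_N; tmul := @mulmx _ N N N; tstar := mxstar; tone := 1%:M;
  ttr := @mxtrace _ N; tbas := mxunit;
  tmulA := @mulmxA _ N N N N; tmul1l := @mul1mx _ N N; tmul1r := @mulmx1 _ N N;
  tmul_linl := mx_mull_lin; tmul_linr := mx_mulr_lin;
  tstar_antilin := mxstar_antilin; tstarK := mxstarK; tstarM := mxstarM;
  ttrL := mxtr_lin; ttrC := @mxtrace_mulC _ N N; ttr_star := mxtr_star;
  tbas_span := mxunit_span; tbas_orth := mxunit_orth |}.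

End MatrixAlgebra.

Section CoordinateHom.
Variables (R : realType) (Q : talg R) (X Y : cstarAlgType R) (e : X) (e' : Y).
Hypotheses (e1 : is_one e) (e1' : is_one e').
Variable f : X -> Y.
Hypotheses (hf : star_hom f) (fe : f e = e').
Notation j1 := (@ptj R Q X e e1).
Notation j2 := (@ptj R Q Y e' e1').

Definition pcoord (y : ptensor Q e1) : PX Q X := projT1 (cid (ptj_onto y)).
Lemma pcoordE y : y = j1 (pcoord y).
Proof. exact: (projT2 (cid (ptj_onto y))). Qed.
Lemma pcoord_j z : pcoord (j1 z) = z.
Proof.
apply/eqP; rewrite -subr_eq0; apply/eqP; apply: (@ptj_inj R Q X e e1).
by rewrite (linB (@ptj_lin R Q X e e1)) -pcoordE subrr.
Qed.

Lemma pcoordL k x y : pcoord (k *: x + y) = k *: pcoord x + pcoord y.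
Proof.
have h := @ptj_lin R Q X e e1 k (pcoord x) (pcoord y).
by rewrite -[RHS]pcoord_j h -!pcoordE.
Qed.
Lemma pcoordM x y : pcoord (x *c y) = pmul (pcoord x) (pcoord y).
Proof. by rewrite -[RHS]pcoord_j ptjM -!pcoordE. Qed.
Lemma pcoord_star x : pcoord (cstar x) = pstar (pcoord x).
Proof. by rewrite -[RHS]pcoord_j ptj_star -!pcoordE. Qed.

Definition ptens_map (y : ptensor Q e1) : ptensor Q e1' := j2 (pmap f (pcoord y)).

Lemma ptens_mapE p x : ptens_map (ptens e1 p x) = ptens e1' p (f x).
Proof. by rewrite /ptens_map pcoord_j pmap_pt. Qed.

Lemma ptens_map_hom : star_hom ptens_map.
Proof.
split=> [k x y|x y|x]; rewrite /ptens_map.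
- by rewrite pcoordL (pmap_lin hf); exact: ptj_lin.
- by rewrite pcoordM pmapM // ptjM.
- by rewrite pcoord_star pmap_star // ptj_star.
Qed.

Lemma ptens_map_inj : injective f -> injective ptens_map.
Proof.
move=> fi; apply: (hom_inj ptens_map_hom) => y /ptj_inj h.
rewrite (pcoordE y); suff -> : pcoord y = 0 by exact: lin0 (@ptj_lin R Q X e e1).
apply/ffunP => k; apply: fi; rewrite ffunE (hom0 hf).
by have := congr1 (fun w : {ffun _ -> Y} => w k) h; rewrite !ffunE.
Qed.

End CoordinateHom.

Section Compression.
Variables (R : realType) (O1 : cstarAlgType R) (e1 : O1) (e11 : is_one e1).
Variables (W : lmodType R[i]) (ip : W -> W -> R[i]).
Hypothesis hip : semi_inner ip.
Variable al : O1 -> W -> W.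
Hypothesis hal : star_rep ip al.
Variables (N : nat) (g : 'I_N -> W).
Notation Q := (mx_talg R N).
Notation fs k := (enum_val k).1.
Notation sn k := (enum_val k).2.

(** The vector functional at (g_a)_a of the representation of the matrices over O1 on W^N. *)
Definition compression_coord (z : PX Q O1) : R[i] :=
  \sum_k ip (g (fs k)) (al (z k) (g (sn k))).

Lemma compression_coordL c z w :
  compression_coord (c *: z + w) = c * compression_coord z + compression_coord w.
Proof.
have [l1 _ _ _] := hal.
rewrite /compression_coord mulr_sumr -big_split; apply: eq_bigr => k _.
by rewrite !ffunE l1 (ipLr hip).
Qed.

Lemma compression_coord_pt (A : 'M[R[i]]_N) o :
  compression_coord (@pt R Q O1 A o) = \sum_a \sum_b A a b * ip (g a) (al o (g b)).
Proof.
have [l1 _ _ _] := hal.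
rewrite /compression_coord pair_bigA /= (big_enum_val (A := {: 'I_N * 'I_N})
  (fun p => A p.1 p.2 * ip (g p.1) (al o (g p.2)))).
apply: eq_bigr => k _; rewrite ffunE (linZ (l1 _)) (ipZr hip); congr (_ * _).
exact: mxunit_star_mul.
Qed.

Lemma compression_coord_sum I (r : seq I) (F : I -> PX Q O1) :
  compression_coord (\sum_(i <- r) F i) = \sum_(i <- r) compression_coord (F i).
Proof.
have c0 : compression_coord 0 = 0.
  have := compression_coordL 1 0 0; rewrite scale1r mul1r addr0.
  by move=> /(congr1 (fun x => x - compression_coord 0)); rewrite addrK subrr.
have cD z w : compression_coord (z + w) = compression_coord z + compression_coord w.
  by have := compression_coordL 1 z w; rewrite scale1r mul1r.
exact: (big_morph _ cD c0).
Qed.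

(** The vector (V a)_a is the image of (g_a)_a under the matrix z, and the value is its square
    norm. *)
Lemma compression_coord_ge0 z : 0 <= compression_coord (pmul (pstar z) z).
Proof.
have [l1 l2 lM lS] := hal.
pose V a : W := \sum_k (a == fs k)%:R *: al (z k) (g (sn k)).
suff -> : compression_coord (pmul (pstar z) z) = \sum_a ip (V a) (V a).
  by rewrite sumr_ge0 // => a _; case: hip => _ _; exact.
rewrite {2}(@pt_expand R Q O1 z) /pstar pmul_suml compression_coord_sum.
transitivity (\sum_k \sum_l (fs k == fs l)%:R *
    ip (al (z k) (g (sn k))) (al (z l) (g (sn l)))).
  apply: eq_bigr => k _; rewrite pmul_sumr compression_coord_sum; apply: eq_bigr => l _.
  rewrite pmul_pt compression_coord_pt (bigD1 (sn k)) //= [X in _ + X]big1 ?addr0.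
    rewrite (bigD1 (sn l)) //= [X in _ + X]big1 ?addr0.
      rewrite lM -lS; congr (_ * _).
      rewrite mxE (bigD1 (fs k)) //= big1 ?addr0.
        by rewrite !mxE rmorph_nat !eqxx mul1r andbT eq_sym.
      by move=> i /negPf hi; rewrite !mxE rmorph_nat hi mul0r.
    move=> b /negPf hb; rewrite mxE big1 ?mul0r // => i _.
    by rewrite !mxE hb andbF mulr0.
  move=> a /negPf ha; rewrite big1 // => b _; rewrite mxE big1 ?mul0r // => i _.
  by rewrite !mxE rmorph_nat ha andbF mul0r.
transitivity (\sum_a \sum_k \sum_l ((a == fs k)%:R * (a == fs l)%:R) *
    ip (al (z k) (g (sn k))) (al (z l) (g (sn l)))).
  rewrite [RHS]exchange_big; apply: eq_bigr => k _.
  rewrite [RHS]exchange_big; apply: eq_bigr => l _; rewrite -mulr_suml; congr (_ * _).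
  rewrite (bigD1 (fs k)) //= big1 ?addr0 ?eqxx ?mul1r //.
  by move=> a /negPf ->; rewrite mul0r.
apply: eq_bigr => a _; rewrite (ip_suml hip); apply: eq_bigr => k _.
rewrite (ip_sumr hip); apply: eq_bigr => l _.
by rewrite (ipZl hip) (ipZr hip) rmorph_nat mulrA.
Qed.

Definition compression (y : ptensor Q e11) : R[i] := compression_coord (pcoord y).

Lemma compression_posfun : posfun compression.
Proof.
split=> [k x y|x]; rewrite /compression; first by rewrite pcoordL compression_coordL.
by rewrite pcoordM pcoord_star; exact: compression_coord_ge0.
Qed.

Lemma compression_delta a b o :
  compression (ptens e11 (delta_mx a b : ta_space Q) o) = ip (g a) (al o (g b)).
Proof.
rewrite /compression pcoord_j compression_coord_pt (bigD1 a) //= [X in _ + X]big1 ?addr0.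
  rewrite (bigD1 b) //= big1 ?addr0; first by rewrite mxE !eqxx mul1r.
  by move=> j /negPf hj; rewrite mxE hj andbF mul0r.
by move=> i /negPf hi; rewrite big1 // => j _; rewrite mxE hi mul0r.
Qed.

End Compression.

Section LeftRepresentation.
Variables (R : realType) (A B : cstarAlgType R) (eA : A) (eB : B) (f : A -> B) (F : B -> R[i]).
Hypotheses (hA : is_one eA) (hB : is_one eB) (hf : unital_star_hom f) (hF : posfun F).

(** The GNS representation, on B itself with the form of F instead of on a completed quotient. *)
Lemma left_rep : star_rep (pf_ip F) (fun a x => f a *c x).
Proof.
have [h _] := hf; split=> [x k a b|a k x y|a b x|a x y].
- by rewrite (homD h) (homZ h) cmulDl cmulZl.
- by rewrite cmulDr cmulZr.
- by rewrite (homM h) cmulA.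
- by rewrite /pf_ip cstarM -(hom_star h) cmulA.
Qed.

Lemma left_rep_bounded a x : sqnm (pf_ip F) (f a *c x) <= nm a ^+ 2 * sqnm (pf_ip F) x.
Proof.
have [h fu] := hf; have hn := nm_hom h hA (fu _ hA) a.
rewrite /sqnm /pf_ip.
have -> : cstar (f a *c x) *c (f a *c x) = cstar x *c (cstar (f a) *c f a) *c x.
  by rewrite cstarM !cmulA.
have := pf_conj hF hB (f a) x; rewrite lecE => /andP[_ hc].
apply: le_trans hc _.
have -> : complex.Re ((nm (f a) ^+ 2)%:C * F (cstar x *c x)) =
    nm (f a) ^+ 2 * complex.Re (F (cstar x *c x)).
  by case: (F _) => r t /=; rewrite mul0r subr0.
have x0 := sqnm_ge0 (pf_semi hB hF) x; apply: ler_wpM2r; first exact: x0.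
by rewrite lerXn2r ?nnegrE ?nm_ge0.
Qed.

End LeftRepresentation.

Section FunctionalDilation.
Variables (R : realType) (O1 O2 : cstarAlgType R) (e1 : O1) (e2 : O2).
Hypotheses (e11 : is_one e1) (e21 : is_one e2).
Variable pi : O1 -> O2.
Hypotheses (hpi : star_hom pi) (pi1 : pi e1 = e2) (pii : injective pi).
Variable Q : talg R.

Lemma ptensM (X : cstarAlgType R) (e : X) (u : is_one e) p q x y :
  ptens u (p : ta_space Q) x *c ptens u q y = ptens u (tmul p q) (x *c y).
Proof. by rewrite /ptens -ptjM pmul_pt. Qed.

Lemma ptens_star (X : cstarAlgType R) (e : X) (u : is_one e) p x :
  cstar (ptens u (p : ta_space Q) x) = ptens u (tstar p) (cstar x).
Proof. by rewrite /ptens -ptj_star pstar_pt. Qed.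

Lemma ptens_linr (X : cstarAlgType R) (e : X) (u : is_one e) p :
  linear (ptens u (p : ta_space Q)).
Proof. by move=> k x y; rewrite /ptens (@pt_linr R Q X p k x y); exact: ptj_lin. Qed.

Lemma ptens_one (X : cstarAlgType R) (e : X) (u : is_one e) : is_one (ptens u (tone Q) e).
Proof. exact: (@ptj_one R Q X e u). Qed.

Lemma pairing_sandwich (X T : cstarAlgType R) (e : X) (t : ta_space Q -> X -> T) p q x :
  is_one e -> (forall p q x y, t p x *c t q y = t (tmul p q) (x *c y)) ->
  (forall p x, cstar (t p x) = t (tstar p) (cstar x)) ->
  cstar (t p e) *c (t (tone Q) x *c t q e) = t (tmul (tstar p) q) x.
Proof.
by move=> u tM tS; rewrite tS !tM tmul1l (cstar_one u) (cmul1l u) (cmul1r u).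
Qed.

(** Extend F along id (x) pi, which is injective, and take the GNS representation of the extension,
    restricted to 1 (x) O2, with the vectors p (x) 1. *)
Lemma posfun_dilation (F : ptensor Q e11 -> R[i]) : posfun F ->
  exists (K : lmodType R[i]) (ph : K -> K -> R[i]) (ka : O2 -> K -> K) (D : ta_space Q -> K),
    [/\ semi_inner ph, star_rep ph ka, forall x, ka e2 x = x,
        forall o x, sqnm ph (ka o x) <= nm o ^+ 2 * sqnm ph x &
        forall p q o, ph (D p) (ka (pi o) (D q)) = F (ptens e11 (tmul (tstar p) q) o)].
Proof.
move=> hF.
pose h : ptensor Q e11 -> ptensor Q e21 := ptens_map e21 pi.
have hh : star_hom h by exact: ptens_map_hom.
have u1 : is_one (ptens e11 (tone Q) e1) by exact: ptens_one.
have u2 : is_one (ptens e21 (tone Q) e2) by exact: ptens_one.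
have hE p x : h (ptens e11 p x) = ptens e21 p (pi x) by exact: ptens_mapE.
have hu : is_one (h (ptens e11 (tone Q) e1)) by rewrite hE pi1.
have hi : injective h by exact: ptens_map_inj.
have [F' hF' F'E] := posfun_extension hh u1 hu hi hF.
pose io o := ptens e21 (tone Q) o.
have hio : star_hom io.
  split=> [k x y|x y|x]; first exact: ptens_linr.
  - by rewrite /io ptensM tmul1l.
  - by rewrite /io ptens_star tstar1.
pose ph := pf_ip F'.
have hph : semi_inner ph := pf_semi u2 hF'.
have hiou : unital_star_hom io by exact: unital_star_homI hio e21 u2.
exists (ptensor Q e21 : lmodType R[i]), ph, (fun o x => io o *c x), (fun p => ptens e21 p e2).
split; [exact: hph|exact: (left_rep F' hiou)|exact: (cmul1l u2)|
  exact: (left_rep_bounded e21 u2 hiou hF')|move=> p q o].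
transitivity (F' (ptens e21 (tmul (tstar p) q) (pi o))).
  exact: (congr1 F' (pairing_sandwich p q (pi o) e21 (ptensM e21) (ptens_star e21))).
by rewrite -hE; exact: F'E.
Qed.

End FunctionalDilation.

Section Dilation.
Variables (R : realType) (O1 O2 : cstarAlgType R) (e1 : O1) (e2 : O2).
Hypotheses (e11 : is_one e1) (e21 : is_one e2).
Variable pi : O1 -> O2.
Hypotheses (hpi : star_hom pi) (pi1 : pi e1 = e2) (pii : injective pi).
Variables (W : lmodType R[i]) (ip : W -> W -> R[i]).
Hypothesis hip : semi_inner ip.
Variable al : O1 -> W -> W.
Hypothesis hal : star_rep ip al.

(* The matrix coefficients of al at the g i make up a positive functional on
   the matrices over O1, which extends to the matrices over O2. *)
Lemma dilation (I : finType) (g : I -> W) (i0 : I) :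
  exists (K : lmodType R[i]) (ph : K -> K -> R[i]) (ka : O2 -> K -> K) (d : I -> K),
    [/\ semi_inner ph, star_rep ph ka, forall x, ka e2 x = x,
        forall o x, sqnm ph (ka o x) <= nm o ^+ 2 * sqnm ph x &
        forall a b o, ph (d a) (ka (pi o) (d b)) = ip (g a) (al o (g b))].
Proof.
have hF := compression_posfun e11 hip hal (fun i : 'I_#|I| => g (enum_val i)).
have [K [ph [ka [D [h1 h2 h3 h4 h5]]]]] := posfun_dilation e21 hpi pi1 pii hF.
(* The product of the adjoint of the matrix unit (i0, a) with the matrix unit (i0, b) is the matrix
   unit (a, b), for any fixed row i0. *)
exists K, ph, ka, (fun i => D (delta_mx (enum_rank i0) (enum_rank i))).
split=> // a b o; rewrite h5.
transitivity (compression ip al (fun i : 'I_#|I| => g (enum_val i))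
    (ptens e11 (delta_mx (enum_rank a) (enum_rank b) : ta_space (mx_talg R #|I|)) o)); last first.
  by rewrite compression_delta // !enum_rankK.
congr (compression ip al _ (ptens e11 _ o)); apply/matrixP => i j.
rewrite mxE (bigD1 (enum_rank i0)) //= big1 ?addr0.
  by rewrite !mxE rmorph_nat !eqxx /= -natrM mulnb.
by move=> k /negPf hk; rewrite !mxE hk mulr0.
Qed.

End Dilation.

Section OrthonormalDilation.
Variables (R : realType) (O1 O2 : cstarAlgType R) (e1 : O1) (e2 : O2).
Hypotheses (e11 : is_one e1) (e21 : is_one e2).
Variable pi : O1 -> O2.
Hypotheses (hpi : star_hom pi) (pi1 : pi e1 = e2) (pii : injective pi).
Variables (W : lmodType R[i]) (ip : W -> W -> R[i]).
Hypothesis hip : semi_inner ip.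
Variable al : O1 -> W -> W.
Hypotheses (hal : star_rep ip al) (al1 : forall x, al e1 x = x).
Variables (I : finType) (g : I -> W).
Hypothesis gON : forall a b, ip (g a) (g b) = (a == b)%:R.

(** Doubling K makes room: the vectors d live in the first summand, while the second holds the
    orthonormal family w, a copy of part of d chosen by f. *)
Lemma orthonormal_dilation (J : finType) (j0 : J) (f : J -> I) : injective f ->
  exists (K : lmodType R[i]) (ph : K -> K -> R[i]) (ka : O2 -> K -> K) (d : I -> K) (w : J -> K),
    [/\ [/\ semi_inner ph, star_rep ph ka, forall x, ka e2 x = x &
            forall o x, sqnm ph (ka o x) <= nm o ^+ 2 * sqnm ph x],
        forall a b o, ph (d a) (ka (pi o) (d b)) = ip (g a) (al o (g b)),
        forall i j, ph (w i) (w j) = (i == j)%:R &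
        forall i b, ph (w i) (d b) = 0].
Proof.
move=> fi.
have [K [ph [ka [d [h1 h2 h3 h4 h5]]]]] := dilation e11 e21 hpi pi1 pii hip hal g (f j0).
have d1 a b : ph (d a) (d b) = (a == b)%:R by rewrite -{1}(h3 (d b)) -pi1 h5 al1 gON.
pose ph2 (x y : (K * K)%type) := ph x.1 y.1 + ph x.2 y.2.
have hph2 : semi_inner ph2.
  split=> [k x y z|x y|x]; rewrite /ph2 /=.
  - by rewrite !(ipLr h1) mulrDr addrACA.
  - by rewrite conjcD -!(ipC h1).
  - by case: h1 => _ _ h; rewrite addr_ge0.
exists (K * K)%type, ph2, (fun o x => (ka o x.1, ka o x.2)),
  (fun b => (d b, 0)), (fun i => (0, d (f i))).
have [k1 k2 k3 k4] := h2.
split; rewrite /ph2 /=.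
- split=> //.
  + split=> [x k a b|o k x y|a b x|a x y] /=.
    * by congr pair; exact: k1.
    * by congr pair; exact: k2.
    * by rewrite !k3.
    * by rewrite !k4.
  + by move=> [x y] /=; rewrite !h3.
  + move=> o [x y]; rewrite /sqnm /= !raddfD /= mulrDr.
    by apply: lerD; exact: h4.
- by move=> a b o; rewrite (ip0l h1) addr0 h5.
- by move=> i j; rewrite (ip0l h1) add0r d1 (inj_eq fi).
- by move=> i b; rewrite (ip0l h1) (ip0r h1) addr0.
Qed.

End OrthonormalDilation.

(** * Transfer between orthonormal families *)

Section OrthonormalFamily.
Variables (R : realType) (W : lmodType R[i]) (ip : W -> W -> R[i]).
Hypothesis hip : semi_inner ip.
Variables (I : finType) (g : I -> W).

Definition spanned z : Prop := sqnm ip (z - \sum_b ip (g b) z *: g b) = 0.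

Lemma spanned_sum n (z : 'I_n -> W) : (forall l, spanned (z l)) -> spanned (\sum_l z l).
Proof.
move=> h; rewrite /spanned.
have -> : \sum_l z l - \sum_b ip (g b) (\sum_l z l) *: g b =
    \sum_l 1 *: (z l - \sum_b ip (g b) (z l) *: g b).
  under [RHS]eq_bigr => l _ do rewrite scale1r.
  rewrite [RHS]big_split sumrN exchange_big /=; congr (_ - _); apply: eq_bigr => b _.
  by rewrite (ip_sumr hip) scaler_suml.
exact: (sqnm_null_sum hip _ h).
Qed.

Lemma spanned_ip x z : spanned z -> ip x z = \sum_b ip (g b) z * ip x (g b).
Proof.
move=> /(ip_null hip x); rewrite (ipBr hip) => /eqP; rewrite subr_eq0 => /eqP ->.
by rewrite (ip_sumr hip); apply: eq_bigr => b _; rewrite (ipZr hip).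
Qed.

Variables (K : lmodType R[i]) (ph : K -> K -> R[i]).
Hypothesis hph : semi_inner ph.
Variable d : I -> K.
Hypothesis dON : forall a b, ph (d a) (d b) = (a == b)%:R.

(** The partial isometry taking g to d; it preserves inner products as soon as one of the two
    vectors is spanned by g up to a null vector. *)
Definition transfer z : K := \sum_b ip (g b) z *: d b.

Lemma transfer_lin : linear transfer.
Proof.
move=> k x y; rewrite /transfer scaler_sumr -big_split; apply: eq_bigr => b _.
by rewrite (ipLr hip) scalerDl scalerA.
Qed.

Lemma ip_transfer x z : ph x (transfer z) = \sum_b ip (g b) z * ph x (d b).
Proof. by rewrite (ip_sumr hph); apply: eq_bigr => b _; rewrite (ipZr hph). Qed.

Lemma ip_d_transfer a z : ph (d a) (transfer z) = ip (g a) z.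
Proof.
rewrite ip_transfer (bigD1 a) //= big1 ?addr0; first by rewrite dON eqxx mulr1.
by move=> b /negPf hb; rewrite dON eq_sym hb mulr0.
Qed.

Lemma transfer_isometry x z : spanned z -> ph (transfer x) (transfer z) = ip x z.
Proof.
move=> hz; rewrite ip_transfer (spanned_ip _ hz); apply: eq_bigr => b _; congr (_ * _).
by rewrite (ipC hph) ip_d_transfer -(ipC hip).
Qed.

Variables (T : W -> W) (Tad : W -> W) (S Sad : K -> K).
Hypothesis hT : forall x y, ip (T x) y = ip x (Tad y).
Hypothesis hS : forall x y, ph (S x) y = ph x (Sad y).
Hypothesis dS : forall a b, ph (d a) (S (d b)) = ip (g a) (T (g b)).
Hypothesis dSS : forall a b, ph (d a) (Sad (S (d b))) = ip (g a) (Tad (T (g b))).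
Hypotheses (Sl : linear S) (Sadl : linear Sad).

(* The two vectors have equal norms and equal inner products with all d a. *)
Lemma transfer_intertwine z : spanned z -> spanned (T z) ->
  sqnm ph (S (transfer z) - transfer (T z)) = 0.
Proof.
move=> hz hTz.
have ST x : ph (d x) (S (transfer z)) = ip (g x) (T z).
  rewrite /transfer (lin_sum Sl) (ip_sumr hph).
  transitivity (ip (Tad (g x)) z).
    rewrite (spanned_ip _ hz); apply: eq_bigr => b _; rewrite (linZ Sl) (ipZr hph) dS.
    by congr (_ * _); rewrite (ipC hip) hT -(ipC hip).
  by rewrite (ipC hip) -hT -(ipC hip).
have nS : ph (S (transfer z)) (S (transfer z)) = ip (T z) (T z).
  rewrite hS hT.
  transitivity (\sum_a \sum_b conjc (ip (g a) z) * ip (g b) z * ip (g a) (Tad (T (g b)))).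
    rewrite {1}/transfer (ip_suml hph); apply: eq_bigr => a _.
    rewrite (ipZl hph) /transfer (lin_sum Sl) (lin_sum Sadl) (ip_sumr hph) mulr_sumr.
    apply: eq_bigr => b _.
    by rewrite (linZ Sl) (linZ Sadl) (ipZr hph) dSS mulrA.
  have E a : ip (g a) (Tad (T z)) = \sum_b ip (g b) z * ip (g a) (Tad (T (g b))).
    rewrite -hT (ipC hip) hT -(ipC hip) (spanned_ip _ hz); apply: eq_bigr => b _.
    by congr (_ * _); rewrite (ipC hip) -hT -(ipC hip) hT.
  rewrite (ipC hip) (spanned_ip _ hz) conjc_sum; apply: eq_bigr => a _.
  rewrite conjcM -[X in _ = _ * X](ipC hip) E mulr_sumr.
  by apply: eq_bigr => b _; rewrite mulrA.
have tS : ph (transfer (T z)) (S (transfer z)) = ip (T z) (T z).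
  rewrite (ipC hph) ip_transfer (spanned_ip _ hTz) conjc_sum; apply: eq_bigr => a _.
  by rewrite conjcM -[X in _ * X](ipC hph) ST -(ipC hip) mulrC.
rewrite /sqnm (ipBr hph) !(ipBl hph) nS tS (ipC hph) tS.
by rewrite (transfer_isometry _ hTz) -(ipC hip) !subrr.
Qed.

End OrthonormalFamily.

(** * Injectivity for injective pi *)

Section CoefRepresentation.
Variables (R : realType) (P O : cstarAlgType R) (u : P) (eO : O).
Hypotheses (findim : finite_dimensional P) (u1 : is_one u) (eO1 : is_one eO).
Variable M : qmaps P O.
Notation q := (qcoef findim u1 M).
Notation T := (qmaps_tensor M).

Lemma qcoefL k a b : q (k *: a + b) = k *: q a + q b.
Proof.
have [[hl _ _] _] := @qmaps_Phi_hom _ _ _ M.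
apply: (palg_injective (T := T)); rewrite -(qcoefE findim u1 M (k *: a + b)) hl !(qcoefE findim u1); symmetry.
exact: palg_lin (tens_star_pairing T) _ _ _.
Qed.

Lemma qcoefM a b : q (a *c b) = pmul (q a) (q b).
Proof.
have [h _] := @qmaps_Phi_hom _ _ _ M.
apply: (palg_injective (T := T)); rewrite -(qcoefE findim u1 M (a *c b)) (homM h) !(qcoefE findim u1); symmetry.
exact: palgM (tens_star_pairing T) _ _.
Qed.

Lemma qcoef_star a : q (cstar a) = pstar (q a).
Proof.
have [h _] := @qmaps_Phi_hom _ _ _ M.
apply: (palg_injective (T := T)); rewrite -(qcoefE findim u1 M (cstar a)) (hom_star h) !(qcoefE findim u1); symmetry.
exact: palg_star (tens_star_pairing T) _.
Qed.

Lemma qcoef_one : q eO = @pone R (fin_talg findim u1) M (qunit M).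
Proof.
have [_ hu] := @qmaps_Phi_hom _ _ _ M.
have t1 : is_one (tens T u (qunit M)) by apply: tens_one => //; exact: qunitP.
apply: (palg_injective (T := T)); rewrite -(qcoefE findim u1 M eO) (is_one_unique (hu _ eO1) t1); symmetry.
exact: palg_pt (tens_star_pairing T) _ _.
Qed.

Lemma qcoef_rep s : posfun s -> star_rep (pip s) (fun a => pmul (q a)).
Proof.
move=> hs; split=> [x k a b|a k x y|a b x|a x y].
- by rewrite qcoefL; exact: pmul_linl.
- exact: pmul_linr.
- by rewrite qcoefM -pmulA.
- by rewrite qcoef_star; apply: pip_adj => //; exact: qunitP.
Qed.

Lemma qcoef_rep_one z : pmul (q eO) z = z.
Proof. by rewrite qcoef_one; apply: pone1l; exact: qunitP. Qed.

End CoefRepresentation.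

Section Transport.
Variables (R : realType) (P O1 O2 : cstarAlgType R) (u : P) (e1 : O1) (e2 : O2).
Hypotheses (findim : finite_dimensional P) (u1 : is_one u).
Hypotheses (e11 : is_one e1) (e21 : is_one e2).
Variables (M1 : qmaps P O1) (M2 : qmaps P O2) (pi : O1 -> O2) (Lam : M1 -> M2).
Hypothesis hpi : star_hom pi.
Hypothesis hLam : unital_star_hom Lam.
Notation PT := (fin_talg findim u1).
Notation n := (fdim findim u1).
Notation bas := (@fbas R P findim u u1).
Notation q1 := (qcoef findim u1 M1).
Notation q2 := (qcoef findim u1 M2).
Hypothesis LamE : forall a l, Lam (q1 a l) = q2 (pi a) l.
Variable s : M1 -> R[i].
Hypothesis hs : posfun s.
Variables (r : nat) (v : 'I_r -> M1).
Hypothesis vON : forall i j, s (cstar (v i) *c v j) = (i == j)%:R.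
Notation I := ('I_n * 'I_r)%type.
Notation W := (PX PT M1).

Definition gvec (b : I) : W := @pt R PT M1 (bas b.1) (v b.2).
Notation ipW := (@pip R PT M1 s).
Let hip : semi_inner ipW. Proof. by apply: pip_semi => //; exact: qunitP. Qed.
Notation sp := (spanned (pf_ip s) v).

Lemma ip_gvec_pt b p x :
  ipW (gvec b) (@pt R PT M1 p x) = ftrace findim u1 (cstar (bas b.1) *c p) * s (cstar (v b.2) *c x).
Proof. exact: pip_pt. Qed.

Lemma gvec_orthonormal a b : ipW (gvec a) (gvec b) = (a == b)%:R.
Proof. by rewrite {2}/gvec ip_gvec_pt fbas_orth vON -natrM mulnb -xpair_eqE -!surjective_pairing. Qed.

Lemma spanned_pt p x : sp x -> spanned ipW gvec (@pt R PT M1 p x).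
Proof.
move=> hx.
have E : \sum_b ipW (gvec b) (@pt R PT M1 p x) *: gvec b =
    @pt R PT M1 p (\sum_i s (cstar (v i) *c x) *: v i).
  rewrite (lin_sum (@pt_linr R PT M1 p)).
  rewrite {2}(fbas_span findim u1 p).
  transitivity (\sum_i \sum_k (ftrace findim u1 (cstar (bas k) *c p) * s (cstar (v i) *c x)) *:
      gvec (k, i)).
    rewrite exchange_big pair_bigA; apply: eq_bigr => b _.
    by rewrite ip_gvec_pt -surjective_pairing.
  apply: eq_bigr => i _.
  rewrite (lin_sum (@pt_linl R PT M1 (s (cstar (v i) *c x) *: v i))); apply: eq_bigr => k _.
  rewrite (linZ (@pt_linl R PT M1 _)) (linZ (@pt_linr R PT M1 _)) scalerA.
  by [].
rewrite /spanned E -(linB (@pt_linr R PT M1 p)).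
rewrite /sqnm pip_pt // [X in _ * X](sqnmE (pf_semi (@qunitP _ _ _ M1) hs)) hx mulr0.
by [].
Qed.

Variables (K : lmodType R[i]) (ph : K -> K -> R[i]) (ka : O2 -> K -> K) (d : I -> K) (w : 'I_r -> K).
Hypotheses (hph : semi_inner ph) (hka : star_rep ph ka) (ka1 : forall x, ka e2 x = x).
Hypothesis kab : forall o x, sqnm ph (ka o x) <= nm o ^+ 2 * sqnm ph x.
Hypothesis dka : forall a b o, ph (d a) (ka (pi o) (d b)) = ipW (gvec a) (pmul (q1 o) (gvec b)).
Hypothesis dON : forall a b, ph (d a) (d b) = (a == b)%:R.
Hypothesis wON : forall i j, ph (w i) (w j) = (i == j)%:R.
Hypothesis wd : forall i b, ph (w i) (d b) = 0.

Notation dd := (transfer ipW gvec d).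

(** The transfer from v to w, the latter being the copy in K of the span of v. *)
Definition omega (x : M1) : K := \sum_i s (cstar (v i) *c x) *: w i.

Lemma omega_lin : linear omega.
Proof.
move=> k x y; rewrite /omega scaler_sumr -big_split; apply: eq_bigr => i _.
by rewrite cmulDr cmulZr (pfL hs) scalerDl scalerA.
Qed.

Lemma transfer_pt p x :
  dd (@pt R PT M1 p x) = \sum_i s (cstar (v i) *c x) *: dd (@pt R PT M1 p (v i)).
Proof.
rewrite /transfer; under [RHS]eq_bigr => i _ do rewrite scaler_sumr.
rewrite exchange_big; apply: eq_bigr => -[k j] _ /=.
rewrite (bigD1 j) //= big1 ?addr0.
  by rewrite !ip_gvec_pt vON eqxx mulr1 scalerA mulrC.
move=> i /negPf hi; rewrite ip_gvec_pt /= vON eq_sym hi mulr0 scale0r scaler0.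
by [].
Qed.

Lemma transfer_intertwines a p x : sp x -> (forall l, sp (q1 a l *c x)) ->
  sqnm ph (ka (pi a) (dd (@pt R PT M1 p x)) - dd (pmul (q1 a) (@pt R PT M1 p x))) = 0.
Proof.
move=> hx hax; have [k1 k2 k3 k4] := hka.
have [a1 a2 a3 a4] := qcoef_rep findim u1 hs.
apply: (transfer_intertwine (T := pmul (q1 a)) (S := ka (pi a)) (Tad := pmul (q1 (cstar a))) (Sad := ka (pi (cstar a))) hip hph dON).
- by move=> x' y; exact: a4.
- by move=> x' y; rewrite k4 (hom_star hpi).
- by move=> b c; exact: dka.
- by move=> b c; rewrite -k3 -(homM hpi) dka a3.
- exact: k2.
- exact: k2.
- exact: spanned_pt.
rewrite (@pt_expand R PT M1 (q1 a)) pmul_suml; apply: spanned_sum => // l.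
by rewrite pmul_pt; exact: spanned_pt.
Qed.

Variables (X : cstarAlgType R) (eX : X) (rkX : K -> K -> X) (kaX : O2 -> X).
Hypothesis eX1 : is_one eX.
Hypothesis rl : forall y, linear (fun x => rkX x y).
Hypothesis rM : forall x y z t, rkX x y *c rkX z t = ph y z *: rkX x t.
Hypothesis rS : forall x y, cstar (rkX x y) = rkX y x.
Hypothesis rn : forall x x' y, sqnm ph (x - x') = 0 -> rkX x y = rkX x' y.
Hypothesis kaXu : unital_star_hom kaX.
Hypothesis kr : forall o x y, kaX o *c rkX x y = rkX (ka o x) y.

Definition proj_w : X := \sum_i rkX (w i) (w i).
(** The operator D_k sends omega(x) to the copy of e_k^* (x) x. The adjoint on e_k is what lets
    [casimir] act on J = sum_k e_k (x) D_k. *)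
Definition dcoef k : X := \sum_i rkX (dd (@pt R PT M1 (cstar (bas k)) (v i))) (w i).

Lemma proj_w_selfadj : selfadj proj_w.
Proof. by rewrite /selfadj /proj_w cstar_sum; apply: eq_bigr => i _; rewrite rS. Qed.

Lemma rk_w_sum (F : 'I_r -> K) x y :
  (\sum_i rkX (F i) (w i)) *c rkX (omega x) y = rkX (\sum_i s (cstar (v i) *c x) *: F i) y.
Proof.
rewrite /omega !(lin_sum (rl y)) cmul_suml; apply: eq_bigr => i _.
rewrite cmul_sumr (bigD1 i) //= big1 ?addr0.
  by rewrite !(linZ (rl y)) cmulZr rM wON eqxx scale1r.
by move=> j /negPf hj; rewrite (linZ (rl y)) cmulZr rM wON eq_sym hj scale0r scaler0.
Qed.

Lemma proj_w_omega x y : proj_w *c rkX (omega x) y = rkX (omega x) y.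
Proof. exact: rk_w_sum. Qed.

Lemma omega_v j : omega (v j) = w j.
Proof.
rewrite /omega (bigD1 j) //= big1 ?addr0; first by rewrite vON eqxx scale1r.
by move=> i /negPf hi; rewrite vON hi scale0r.
Qed.

Lemma proj_w_idem : proj_w *c proj_w = proj_w.
Proof.
rewrite {2}/proj_w cmul_sumr; apply: eq_bigr => i _.
by rewrite -{1}omega_v proj_w_omega omega_v.
Qed.

Lemma dcoef_omega k x y :
  dcoef k *c rkX (omega x) y = rkX (dd (@pt R PT M1 (cstar (bas k)) x)) y.
Proof. by rewrite rk_w_sum -transfer_pt. Qed.

Lemma proj_w_dcoef k : proj_w *c dcoef k = 0.
Proof.
rewrite cmul_suml big1 // => i _; rewrite cmul_sumr big1 // => j _.
rewrite rM (ip_transfer _ _ hph) big1 ?scale0r // => b _.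
by rewrite wd mulr0.
Qed.

Lemma v_spanned j : sp (v j).
Proof.
rewrite /spanned (bigD1 j) //= /pf_ip vON eqxx scale1r big1 ?addr0.
  by rewrite subrr /sqnm cmul0r (pf0 hs).
by move=> i /negPf hi; rewrite vON hi scale0r.
Qed.

Lemma dcoefM k l : cstar (dcoef k) *c dcoef l = (k == l)%:R *: proj_w.
Proof.
rewrite /dcoef cstar_sum cmul_suml scaler_sumr; apply: eq_bigr => i _.
rewrite rS cmul_sumr (bigD1 i) //= big1 ?addr0 => [|j /negPf hj];
  rewrite rM (transfer_isometry hip hph dON); try (by apply: spanned_pt; exact: v_spanned).
  rewrite pip_pt //= cstarK ftraceC fbas_orth vON eqxx mulr1 eq_sym.
  by [].
by rewrite pip_pt //= vON eq_sym hj mulr0 scale0r.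
Qed.

Variable TX : tensorProduct P X.
Notation te := (tens TX).

Definition dilJ : TX := \sum_k te (bas k) (dcoef k).

(** By [dcoefM] only the diagonal terms e_k^* e_k (x) [proj_w] survive, and the regular trace makes
    them add up to 1 (x) [proj_w]. *)
Lemma dilJ_iso : cstar dilJ *c dilJ = te u proj_w.
Proof.
have [tl tr tM tS] := tens_star_pairing TX.
rewrite /dilJ cstar_sum cmul_suml.
transitivity (\sum_k te (cstar (bas k) *c bas k) proj_w).
  apply: eq_bigr => k _; rewrite cmul_sumr tS (bigD1 k) //= big1 ?addr0.
    by rewrite tM dcoefM eqxx scale1r.
  by move=> l /negPf hl; rewrite tM dcoefM eq_sym hl scale0r (lin0 (tr _)).
by rewrite -(lin_sum (tl proj_w)) sum_star_fbas_mul.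
Qed.

Lemma proj_dilJ : te u proj_w *c dilJ = 0.
Proof.
have [tl tr tM tS] := tens_star_pairing TX.
rewrite /dilJ cmul_sumr big1 // => k _.
by rewrite tM proj_w_dcoef (lin0 (tr _)).
Qed.

Lemma dilJ_tens p x y : dilJ *c te p (rkX (omega x) y) =
  \sum_k te (bas k *c p) (rkX (dd (@pt R PT M1 (cstar (bas k)) x)) y).
Proof.
have [tl tr tM tS] := tens_star_pairing TX.
by rewrite /dilJ cmul_suml; apply: eq_bigr => k _; rewrite tM dcoef_omega.
Qed.

(* By casimir, with [sum_k e_k p (x) e_k^* = sum_k e_k (x) p e_k^*]. *)
Lemma dilJ_intertwines a x y : sp x -> (forall l, sp (q1 a l *c x)) ->
  te u (kaX (pi a)) *c (dilJ *c te u (rkX (omega x) y)) =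
  dilJ *c \sum_l te (bas l) (rkX (omega (q1 a l *c x)) y).
Proof.
move=> hx hax; have [tl tr tM tS] := tens_star_pairing TX.
have ddl : linear dd by exact: transfer_lin.
rewrite dilJ_tens cmul_sumr.
transitivity (\sum_k \sum_l te (bas k)
    (rkX (dd (@pt R PT M1 (bas l *c cstar (bas k)) (q1 a l *c x))) y)).
  apply: eq_bigr => k _; rewrite tM (cmul1l u1) (cmul1r u1) kr.
  rewrite (rn _ (transfer_intertwines _ hx hax)) -(lin_sum (tr (bas k))); congr (te _ _).
  rewrite {1}(@pt_expand R PT M1 (q1 a)) pmul_suml (lin_sum ddl) (lin_sum (rl y)).
  by apply: eq_bigr => l _; rewrite pmul_pt.
rewrite exchange_big cmul_sumr; apply: eq_bigr => l _.
rewrite dilJ_tens.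
have h := @casimir R PT TX (fun p p' => te p (rkX (dd (@pt R PT M1 p' (q1 a l *c x))) y)) (bas l).
symmetry; apply: h => [z|p] k p1 p2; first exact: tl.
by rewrite (@pt_linl R PT M1) ddl rl tr.
Qed.

(** The homomorphism is built as a composite through [Lam], which gives the norm bound; the second
    clause says that its generators act on the copies omega(x) as they do on x. *)
Lemma transport_exists : exists2 mu : M1 -> X, unital_star_hom mu &
  (forall x, nm (mu x) <= nm (Lam x)) /\
  forall a x y, sp x -> (forall l, sp (q1 a l *c x)) ->
    forall l, mu (q1 a l) *c rkX (omega x) y = rkX (omega (q1 a l *c x)) y.
Proof.
have [tl tr tM tS] := tens_star_pairing TX.
have t1 : is_one (te u eX) by exact: tens_one.
have [U [Us UU UJ Uq]] : exists U, [/\ selfadj U, U *c U = te u eX,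
    U *c dilJ = te u proj_w & U *c te u proj_w = dilJ].
  apply: (exchange_unitary t1); [| |exact: dilJ_iso|exact: proj_dilJ].
  - by rewrite /selfadj tS (cstar_one u1) proj_w_selfadj.
  - by rewrite tM (cmul1l u1) proj_w_idem.
have hk : unital_star_hom (fun o => te u (kaX o)).
  have [h hu] := kaXu; apply: (unital_star_homI _ e21).
    split=> [k x y|x y|x]; first by rewrite (homD h) (homZ h) tr.
    - by rewrite (homM h) tM (cmul1l u1).
    - by rewrite (hom_star h) tS (cstar_one u1).
  by apply: tens_one => //; exact: hu.
have hpsi := conj_unitary_hom t1 hk Us UU.
have [lam hlam psiE] := qmaps_lift findim u1 e21 M2 eX1 hpsi.
exists (lam \o Lam); first exact: unital_star_hom_comp.
split=> [x|a x y hx hax l].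
  have m1 : is_one (qunit M2) by exact: qunitP.
  exact: (nm_hom hlam.1 m1 (hlam.2 _ m1)).
pose rh : PX PT X := [ffun l => rkX (omega (q1 a l *c x)) y].
pose lh : PX PT X := [ffun l => lam (q2 (pi a) l) *c rkX (omega x) y].
suff : lh = rh.
  by move=> /(congr1 (fun F : {ffun _ -> X} => F l)); rewrite !ffunE /= LamE.
apply: (palg_injective (T := TX)); rewrite /palg.
transitivity (U *c te u (kaX (pi a)) *c U *c te u (rkX (omega x) y)).
  rewrite psiE /palg cmul_suml; apply: eq_bigr => k _.
  by rewrite tM (cmul1r u1) !ffunE.
have qo z p : te u proj_w *c te p (rkX (omega z) y) = te p (rkX (omega z) y).
  by rewrite tM (cmul1l u1) proj_w_omega.
(* U turns the projection 1 (x) [proj_w] into J, the intertwining relation moves the representation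
   past J, and U turns J back into the projection. *)
rewrite -{1}(qo x u) cmulA -[U *c _ *c U *c _]cmulA Uq -!cmulA dilJ_intertwines //.
rewrite cmulA UJ cmul_sumr; apply: eq_bigr => k _.
by rewrite qo ffunE.
Qed.

End Transport.

(** * From finitely many vectors to all words *)

Section PiInjective.
Variables (R : realType) (P O1 O2 : cstarAlgType R) (u : P) (e1 : O1) (e2 : O2).
Hypotheses (findim : finite_dimensional P) (u1 : is_one u) (u0 : u <> 0).
Hypotheses (e11 : is_one e1) (e21 : is_one e2).
Variables (M1 : qmaps P O1) (M2 : qmaps P O2) (pi : O1 -> O2) (Lam : M1 -> M2).
Hypotheses (hpi : star_hom pi) (pi1 : pi e1 = e2) (pii : injective pi).
Hypothesis hmap : is_qmaps_map id pi Lam.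
Notation q1 := (qcoef findim u1 M1).
Notation one1 := (@qunit R P O1 M1).
Let one1P : is_one one1 := @qunitP R P O1 M1.

(** [what x] stands for the vector x. The relation is demanded only where x and all its products
    with the coordinates of a stay in the finite list L. *)
Definition transported (X : cstarAlgType R) (mu what : M1 -> X) (L : seq M1) : Prop :=
  forall a x, x \in L -> (forall l, q1 a l *c x \in L) ->
    forall l, mu (q1 a l) *c what x = what (q1 a l *c x).

(** With eta = omega(1), vectors are encoded as [what x] = |omega(x)><eta| and E is |eta><eta|, so
    that the conclusion mentions C*-algebras only. E is nonzero because <eta, eta> = s(1). *)
Lemma transport (s : M1 -> R[i]) (L : seq M1) : posfun s -> s one1 <> 0 -> one1 \in L ->
  exists (X : cstarAlgType R) (mu what : M1 -> X) (E : X),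
    [/\ unital_star_hom mu /\ (forall x, nm (mu x) <= nm (Lam x)), linear what,
        transported mu what L,
        forall x, x \in L -> cstar (what x) *c what x = s (cstar x *c x) *: E & E <> 0].
Proof.
move=> hs s1 L1.
have hip := pf_semi one1P hs.
have [r [v [vON vsp]]] := gram_schmidt hip (fun i : 'I_(size L) => nth 0 L i).
have Lsp x : x \in L -> spanned (pf_ip s) v x.
  move=> xL; have ix : (index x L < size L)%N by rewrite index_mem.
  by have := vsp (Ordinal ix); rewrite /= nth_index.
have r0 : (0 < r)%N.
  rewrite lt0n; apply/eqP => r0; apply: s1; move: v vON vsp Lsp; rewrite r0 => v _ _ Lsp.
  have := spanned_ip hip one1 (Lsp _ L1).
  by rewrite big_ord0 /pf_ip (cstar_one one1P) (cmul1l one1P).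
have n0 : (0 < fdim findim u1)%N.
  rewrite lt0n; apply/eqP => n0; apply: u0.
  rewrite [u](fbas_span findim u1) big1 // => -[k hk]; exfalso.
  by move: hk; rewrite [X in (_ < X)%N]n0.
pose k0 := Ordinal n0; pose j0 := Ordinal r0.
have hipW : semi_inner (@pip R (fin_talg findim u1) M1 s) by apply: pip_semi one1P _ hs.
have gON : forall a b, pip s (gvec v a) (gvec v b) = (a == b)%:R :=
  gvec_orthonormal (findim := findim) (u1 := u1) hs vON.
have hal := qcoef_rep findim u1 hs.
have al1 z : pmul (q1 e1) z = z by exact: qcoef_rep_one.
have fi : injective (fun j : 'I_r => (k0, j)) by move=> i j [].
have [K [ph [ka [d [w [[hph hka ka1 kab] dka wON wd]]]]]] :=
  orthonormal_dilation e11 e21 hpi pi1 pii hipW hal al1 gON j0 fi.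
have dON a b : ph (d a) (d b) = (a == b)%:R by rewrite -{1}(ka1 (d b)) -pi1 dka al1 gON.
have X1 : is_one (opj hph (id, id)) by exact: opj_one.
have LamE a l : Lam (q1 a l) = qcoef findim u1 M2 (pi a) l by exact: qmaps_map_id_coef.
have [mu hmu [mun mut]] := transport_exists e21 hpi hmap.1 LamE hs vON hph hka dka dON wON wd
  X1 (rk_linl hph) (rkM hph) (rk_star hph) (rk_null hph) (rep_unital_hom hph e21 hka ka1 kab)
  (rep_rk hph hka kab) (fin_tensor findim u1 X1).
pose eta := omega s v w one1.
have omE x z : spanned (pf_ip s) v z ->
    ph (omega s v w x) (omega s v w z) = s (cstar x *c z).
  by move=> hz; exact: (transfer_isometry hip hph wON x hz).
exists (opalg hph), mu, (fun x => rk hph (omega s v w x) eta), (rk hph eta eta).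
split.
- by split.
- move=> k x y; rewrite (omega_lin hs); exact: rk_linl.
- by move=> a x xL axL l; apply: mut => [|l']; exact: Lsp.
- by move=> x xL; rewrite rk_star rkM omE //; exact: Lsp.
- move=> /rk_eq0 h; apply: s1.
  have := sqnmE hph eta; rewrite h omE; last exact: Lsp.
  by rewrite (cstar_one one1P) (cmul1l one1P).
Qed.

(** Words grow on the left, one generator at a time, since this is how [transported] lets a word act
    on the vector 1. *)
Inductive coef_span : M1 -> Prop :=
| Coef_one : coef_span one1
| Coef_lin k x y : coef_span x -> coef_span y -> coef_span (k *: x + y)
| Coef_mul a l x : coef_span x -> coef_span (q1 a l *c x).

Lemma coef_spanZ k x : coef_span x -> coef_span (k *: x).
Proof.
move=> hx; have -> : k *: x = (k - 1) *: x + x by rewrite scalerBl scale1r subrK.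
exact: Coef_lin.
Qed.

Lemma coef_spanD x y : coef_span x -> coef_span y -> coef_span (x + y).
Proof. by move=> hx hy; rewrite -[x]scale1r; exact: Coef_lin. Qed.

Lemma coef_span_sum I (r : seq I) (F : I -> M1) :
  (forall i, coef_span (F i)) -> coef_span (\sum_(i <- r) F i).
Proof.
move=> h; apply: big_ind => //; last exact: coef_spanD.
by rewrite -(scale0r one1); exact/coef_spanZ/Coef_one.
Qed.

Lemma coef_spanM x y : coef_span x -> coef_span y -> coef_span (x *c y).
Proof.
move=> hx hy; elim: hx => [|k x1 x2 _ h1 _ h2|a l x' _ h].
- by rewrite (cmul1l one1P).
- by rewrite cmulDl cmulZl; exact: Coef_lin.
- by rewrite -cmulA; exact: Coef_mul.
Qed.

Lemma coef_span_q a l : coef_span (q1 a l).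
Proof. by rewrite -[q1 a l](cmul1r one1P); exact/Coef_mul/Coef_one. Qed.

Lemma coef_span_star x : coef_span x -> coef_span (cstar x).
Proof.
elim=> [|k x1 x2 _ h1 _ h2|a l x' _ h].
- by rewrite (cstar_one one1P); exact: Coef_one.
- by rewrite cstar_antilinear; exact: Coef_lin.
- rewrite cstarM; apply: coef_spanM => //.
  rewrite -[a]cstarK qcoef_star /pstar sum_ffunE cstar_sum.
  apply: coef_span_sum => k.
  by rewrite ffunE cstarZ cstarK; exact/coef_spanZ/coef_span_q.
Qed.

Lemma coef_span_dense x (d : R) : 0 < d -> exists2 m, coef_span m & nm (x - m) < d.
Proof.
move: x d; apply: (qmaps_generated (findim := findim) (u1 := u1) e11
  (D := fun x => forall d : R, 0 < d -> exists2 m, coef_span m & nm (x - m) < d)).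
- by move=> d d0; exists one1; [exact: Coef_one|rewrite subrr nm0].
- move=> k x y hx hy d d0.
  have k0 : 0 < cabs k + 1 by rewrite ltr_wpDl ?cabs_ge0.
  have [m hm xm] := hx _ (divr_gt0 (divr_gt0 d0 (ltr0n R 2)) k0).
  have [m' hm' ym] := hy _ (divr_gt0 d0 (ltr0n R 2)).
  exists (k *: m + m'); first exact: Coef_lin.
  have -> : k *: x + y - (k *: m + m') = k *: (x - m) + (y - m').
    by rewrite scalerBr opprD addrACA.
  apply: le_lt_trans (nmD _ _) _; rewrite nmZ.
  rewrite ltr_pdivlMr // in xm.
  have := nm_ge0 (x - m); move: xm ym; move: (nm (x - m)) (nm (y - m')) (cabs k) => a b c.
  by move=> *; lra.
- move=> x y hx hy d d0.
  have x0 : 0 < nm x + 1 by rewrite ltr_wpDl ?nm_ge0.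
  have y0 : 0 < nm y + 1 by rewrite ltr_wpDl ?nm_ge0.
  have d2 : 0 < d / 2 by rewrite divr_gt0.
  (* The bound 1 ensures |m'| <= |y| + 1, the factor provided for when x is approximated. *)
  have [|m' hm' ym] := hy (Num.min 1 (d / 2 / (nm x + 1))).
    by rewrite lt_min ltr01 divr_gt0.
  have [m hm xm] := hx _ (divr_gt0 d2 y0).
  exists (m *c m'); first exact: coef_spanM.
  have -> : x *c y - m *c m' = x *c (y - m') + (x - m) *c m'.
    by rewrite cmulBr cmulBl addrA subrK.
  apply: le_lt_trans (nmD _ _) _.
  move: ym; rewrite lt_min => /andP[ym1 ym].
  have h1 := nmM x (y - m'); have h2 := nmM (x - m) m'.
  have h3 : nm m' <= nm y + 1.
    have -> : m' = y - (y - m') by rewrite subKr.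
    by apply: le_trans (nmB _ _) _; rewrite lerD2l ltW.
  have h4 : nm (x - m) * nm m' <= nm (x - m) * (nm y + 1).
    by rewrite ler_wpM2l ?nm_ge0.
  rewrite !ltr_pdivlMr // in xm ym.
  have := nm_ge0 (y - m'); move: xm ym h1 h4 h2.
  move: (nm (_ *c _)) (nm (_ *c _)) (nm (x - m)) (nm (y - m')) (nm x) (nm y) (nm m').
  by move=> *; lra.
- move=> x hx d d0; have [m hm xm] := hx _ d0.
  by exists (cstar m); [exact: coef_span_star|rewrite -cstarB nm_cstar].
- move=> v l hv vl d d0; have d2 : 0 < d / 2 by rewrite divr_gt0.
  have [N hN] := vl _ d2; have [m hm vm] := hv N _ d2; exists m => //.
  apply: le_lt_trans (nm_dist (v N) _ _) _.
  by have := hN N (leqnn N); rewrite nmBC; move: vm; lra.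
- move=> a k d d0; exists (q1 a k); first exact: coef_span_q.
  by rewrite subrr nm0.
Qed.

(** L collects the vectors met while m acts on 1 letter by letter. It is found before mu and [what]
    are, and any larger list also serves, so that lists can be merged along sums. *)
Lemma coef_span_transported m : coef_span m -> exists2 L : seq M1, one1 \in L &
  forall (X : cstarAlgType R) (mu what : M1 -> X) (L' : seq M1),
    unital_star_hom mu -> linear what -> {subset L <= L'} -> transported mu what L' ->
    mu m *c what one1 = what m.
Proof.
elim=> [|k x y _ [Lx x1 hx] _ [Ly y1 hy]|a l x _ [L L1 hL]].
- exists [:: one1]; first exact: mem_head.
  by move=> X mu what L' [_ hu] _ _ _; rewrite (cmul1l (hu _ one1P)).
- exists (Lx ++ Ly) => [|X mu what L' hmu wl sL tr]; first by rewrite mem_cat x1.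
  rewrite (homD hmu.1) (homZ hmu.1) cmulDl cmulZl wl.
  rewrite (hx X mu what L') ?(hy X mu what L') // => z hz; apply: sL;
    by rewrite mem_cat hz ?orbT.
- exists (x :: [seq q1 a l | l <- enum 'I_(fdim findim u1)] ++
      [seq q1 a l *c x | l <- enum 'I_(fdim findim u1)] ++ L).
    by rewrite inE !mem_cat L1 !orbT.
  move=> X mu what L' hmu wl sL tr.
  rewrite (homM hmu.1) -cmulA (hL X mu what L') //; last first.
    by move=> z hz; apply: sL; rewrite inE !mem_cat hz !orbT.
  apply: tr; first by apply: sL; rewrite mem_head.
  move=> l'; apply: sL; rewrite inE !mem_cat.
  by rewrite (map_f (fun l => q1 a l *c x)) ?orbT // mem_enum.
Qed.

(** By [transport], |what(x)|^2 = s(x^* x) |E| for x = 1 and x = m, while what(m) = mu(m) what(1)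
    and |mu(m)| <= |Lam m|; the factor |E| cancels. *)
Lemma coef_span_le (s : M1 -> R[i]) m : posfun s -> coef_span m ->
  complex.Re (s (cstar m *c m)) <= nm (Lam m) ^+ 2 * complex.Re (s one1).
Proof.
move=> hs hm.
have s1E : s one1 = (complex.Re (s one1))%:C.
  apply: ge0_complexE; have := hs.2 one1.
  by rewrite (cstar_one one1P) (cmul1l one1P).
have sm := ge0_complexE (hs.2 m).
have [s0|s0] := pselect (s one1 = 0).
  have := pf_nm hs one1P m; rewrite s0 mulr0 /= mulr0 => h.
  by move: h; rewrite lecE => /andP[_].
have [L L1 hL] := coef_span_transported hm.
have [X [mu [what [E [[hmu mun] wl tr wE E0]]]]] :=
  transport hs s0 (mem_head one1 (m :: L)).
have wm : mu m *c what one1 = what m.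
  by apply: (hL X mu what _ hmu wl _ tr) => z hz; rewrite !inE hz !orbT.
have En : 0 < nm E.
  by rewrite lt_neqAle nm_ge0 andbT eq_sym; apply/eqP => /nm0_eq0.
have nw x : x \in [:: one1, m & L] -> nm (what x) ^+ 2 = complex.Re (s (cstar x *c x)) * nm E.
  move=> hx; rewrite -nm_sq wE // nmZ {1}(ge0_complexE (hs.2 x)) cabs_real ger0_norm //.
  by rewrite -ler0c -(ge0_complexE (hs.2 x)) hs.2.
rewrite -(ler_pM2r En) -nw; last by rewrite !inE eqxx orbT.
have := nw one1 (mem_head _ _); rewrite (cstar_one one1P) (cmul1l one1P) -mulrA => <-.
rewrite -exprMn lerXn2r ?nnegrE ?nm_ge0 ?mulr_ge0 ?nm_ge0 // -wm.
apply: le_trans (nmM _ _) _; apply: ler_wpM2r; first exact: nm_ge0.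
exact: mun.
Qed.

Lemma qmaps_map_pi_inj_nz : injective Lam.
Proof.
have hL := hmap.1.1; apply: (hom_inj hL) => x Lx; apply: contrapT => x0.
have xx0 : cstar x *c x <> 0 by move=> /cstar_mul_eq0.
have [s hs sx] := posfun_gt0 one1P (pos_star_mul one1P x) xx0.
have hip := pf_semi one1P hs.
have s1 : 0 <= complex.Re (s one1).
  by have := sqnm_ge0 hip one1; rewrite /sqnm /pf_ip (cstar_one one1P) (cmul1l one1P).
set c := complex.Re (s one1) in s1.
set t := sqnm (pf_ip s) x.
have t0 : 0 < t by move: sx; rewrite ltcE => /andP[].
(* For a word m within d of x, both x - m and m have square norm at most d^2 s(1), the second
   because Lam(m) = Lam(m - x); the square of a sum at most doubles, hence 4. *)
have h (d : R) : 0 < d -> t <= 4 * d ^+ 2 * c.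
  move=> d0; have [m hm xm] := coef_span_dense x d0.
  have h1 : t <= 2 * sqnm (pf_ip s) (x - m) + 2 * sqnm (pf_ip s) m.
    rewrite /t -{1}(subrK m x) (sqnmD hip).
    by have := re_ip_le hip (x - m) m ltr01; rewrite invr1; lra.
  have h2 : sqnm (pf_ip s) (x - m) <= d ^+ 2 * c.
    have := pf_nm hs one1P (x - m); rewrite lecE => /andP[_ h2].
    apply: le_trans h2 _.
    have -> : complex.Re ((nm (x - m) ^+ 2)%:C * s one1) = nm (x - m) ^+ 2 * c.
      by rewrite /c; case: (s one1) => a b /=; rewrite mul0r subr0.
    rewrite ler_wpM2r //.
    by rewrite lerXn2r ?nnegrE ?nm_ge0 // ltW.
  have h3 : sqnm (pf_ip s) m <= d ^+ 2 * c.
    apply: le_trans (coef_span_le hs hm) _; rewrite ler_wpM2r //.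
    rewrite lerXn2r ?nnegrE ?nm_ge0 ?(ltW d0) //.
    have -> : Lam m = Lam (m - x) by rewrite (homB hL) Lx subr0.
    have := nm_hom hL one1P (hmap.1.2 _ one1P) (m - x).
    by rewrite nmBC; move: xm; lra.
  by move: h1 h2 h3; lra.
(* The choice e = t / (4c + 4 + t) gives e < 1 and 4 e c < t, contradicting t <= 4 e^2 c. *)
have D0 : 0 < 4 * c + 4 + t by lra.
have e0 : 0 < t / (4 * c + 4 + t) by rewrite divr_gt0.
have := h _ e0; set e := t / _ in e0 *.
have e1' : e < 1 by rewrite /e ltr_pdivrMr //; lra.
have eE : e * (4 * c + 4 + t) = t by rewrite /e divfK // gt_eqF.
move=> ht.
have : 4 * e ^+ 2 * c <= e * (4 * c).
  by rewrite expr2; have := mulr_ge0 (ltW e0) s1; nra.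
by move: eE ht e0; nra.
Qed.

End PiInjective.

Theorem theorem2p15 (R : realType) (P P1 P2 O O1 O2 : cstarAlgType R)
    (rho : P2 -> P1) (pi : O1 -> O2)
    (finP : finite_qspace P) (finP1 : finite_qspace P1)
    (finP2 : finite_qspace P2)
    (compO : compact_qspace O) (compO1 : compact_qspace O1)
    (compO2 : compact_qspace O2)
    (rho_hom : unital_star_hom rho) (pi_hom : unital_star_hom pi)
    (M_P_O1 : qmaps P O1) (M_P_O2 : qmaps P O2)
    (M_P1_O : qmaps P1 O) (M_P2_O : qmaps P2 O)
    (M_id_pi : M_P_O1 -> M_P_O2) (M_rho_id : M_P1_O -> M_P2_O)
    (M_id_piP : is_qmaps_map id pi M_id_pi)
    (M_rho_idP : is_qmaps_map rho id M_rho_id) :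
  [/\ surjective pi -> surjective M_id_pi,
      injective rho -> surjective M_rho_id,
      injective pi -> injective M_id_pi
    & surjective rho -> (nonzero P1 \/ nonzero O) -> injective M_rho_id].
Proof.
split=> [pis|ri|pii|rs nz].
- exact: qmaps_map_id_onto M_id_piP pis.
- exact: qmaps_map_rho_onto rho_hom.1 M_rho_idP ri.
- have [[u u1] findim] := finP; have [e1 e11] := compO1; have [e2 e21] := compO2.
  have pi1 : pi e1 = e2 by exact: is_one_unique (pi_hom.2 _ e11) e21.
  (* The dilation argument needs a basis vector of P, so P = 0 is treated apart. *)
  have [u0|u0] := pselect (u = 0); last first.
    exact: (qmaps_map_pi_inj_nz findim u1 u0 e11 e21 pi_hom.1 pi1 pii M_id_piP).
  rewrite u0 in u1.
  exact: qmaps_map_pi_inj_zero findim u1 compO1 compO2 M_id_piP.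
- exact: qmaps_map_rho_inj rho_hom M_rho_idP rs nz.
Qed.
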